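(* Let $(A_r)_{r\ge0}$ be a sequence of diagram algebras over $R$ satisfying (D1)–(D6), with quotients $\phi_r:A_r^{\mathbb K}\to Q_r^{\mathbb K}$ satisfying (Q1)–(Q3) (see context). Assume that $(A_r)_{r\ge0}$ has additive or multiplicative Jucys–Murphy elements, that the separation condition holds, that all $Q_r^{\mathbb K}$ are split semisimple, and that (SN) holds: $F_{\mathsf t}$ is evaluable whenever $\mathsf t\in\mathrm{Std}_r$ is permissible. Then: (1) The family of idempotents $\bar F_{\mathsf t}=\phi\circ\pi(F_{\mathsf t})$, where $r\ge1$ and $\mathsf t\in\mathrm{Std}_r$ is permissible, is the family of Gelfand–Zeitlin idempotents for the tower $(Q_r^{\mathbb K})_{r\ge0}$. In the following statements let $\lambda,\mu$ be permissible points in $\widehat A_r$ for some $r$, and let $\mathsf s,\mathsf t\in\mathrm{Std}_{r,\mathrm{perm}}(\lambda)$ and $\mathsf u,\mathsf v\in\mathrm{Std}_{r,\mathrm{perm}}(\mu)$. (2) $\bar f^\lambda_{\mathsf t}\bar F^\mu_{\mathsf u\mathsf v}=\delta_{\lambda,\mu}\delta_{\mathsf t,\mathsf u}\,\pi(\langle f^\lambda_{\mathsf t},f^\lambda_{\mathsf t}\rangle)\,\bar f^\lambda_{\mathsf v}$ and $\bar F^\lambda_{\mathsf s\mathsf t}\bar F^\mu_{\mathsf u\mathsf v}=\delta_{\lambda,\mu}\delta_{\mathsf t,\mathsf u}\,\pi(\langle f^\lambda_{\mathsf t},f^\lambda_{\mathsf t}\rangle)\,\bar F^\lambda_{\mathsf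 s\mathsf v}$. (3) $\pi(\langle f^\lambda_{\mathsf t},f^\lambda_{\mathsf s}\rangle)\neq0$ if and only if $\mathsf t=\mathsf s$. (4) $\pi(\langle f^\lambda_{\mathsf t},f^\lambda_{\mathsf t}\rangle)^{-1}\bar F^\lambda_{\mathsf t\mathsf t}=\bar F_{\mathsf t}$. (5) The set of elements $\bar E^\lambda_{\mathsf s\mathsf t}=\pi(\langle f^\lambda_{\mathsf s},f^\lambda_{\mathsf s}\rangle)^{-1}\bar F^\lambda_{\mathsf s\mathsf t}$, for $\lambda\in\widehat A_r$ permissible and $\mathsf s,\mathsf t\in\mathrm{Std}_{r,\mathrm{perm}}(\lambda)$, is a complete family of matrix units with $\bar E^\lambda_{\mathsf s\mathsf t}\bar E^\mu_{\mathsf u\mathsf v}=\delta_{\lambda,\mu}\delta_{\mathsf t,\mathsf u}\bar E^\lambda_{\mathsf s\mathsf v}$ and $\bar E^\lambda_{\mathsf s\mathsf s}=\bar F_{\mathsf s}$. (6) Suppose that $a\in A_r$ has matrix coefficients $a(\mathsf s,\mathsf t)$ with respect to the seminormal basis $\{f^\lambda_{\mathsf t}\}$ of $\Delta^{\mathbb F}_{A_r}(\lambda)$, i.e. $f^\lambda_{\mathsf t}a=\sum_{\mathsf s\in\mathrm{Std}_r(\lambda)}a(\mathsf s,\mathsf t)f^\lambda_{\mathsf s}$. Then for $\mathsf t\in\mathrm{Std}_r(\lambda)$ permissible, $$\bar f^\lambda_{\mathsf t}\,\phi\circ\pi(a)=\sum_{\mathsf s\in\mathrm{Std}_{r,\mathrm{perm}}(\lambda)}\pi(a(\mathsf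 s,\mathsf t))\,\bar f^\lambda_{\mathsf s}.$$
   Context: **Cellular algebras.** Let $R$ be an integral domain and $A$ a unital $R$-algebra. A cell datum for $A$ consists of an $R$-linear anti-automorphism $*$ with $(x^* )^*=x$, a finite poset $(\widehat A,\trianglerighteq)$, a finite set $\mathrm{Std}(\lambda)$ for each $\lambda\in\widehat A$, and an $R$-basis $\{c^\lambda_{\mathsf s\mathsf t}\}$ ($\mathsf s,\mathsf t\in\mathrm{Std}(\lambda)$) such that, with $A^{\triangleright\lambda}$ (resp. $A^{\trianglerighteq\lambda}$) the span of the $c^\mu_{\mathsf s\mathsf t}$ with $\mu\triangleright\lambda$ (resp. $\mu\trianglerighteq\lambda$): (a) $c^\lambda_{\mathsf s\mathsf t}a\equiv\sum_{\mathsf v}r(a;\mathsf t,\mathsf v)c^\lambda_{\mathsf s\mathsf v}\bmod A^{\triangleright\lambda}$ with $r(a;\mathsf t,\mathsf v)\in R$ independent of $\mathsf s$; (b) $(c^\lambda_{\mathsf s\mathsf t})^*\equiv c^\lambda_{\mathsf t\mathsf s}\bmod A^{\triangleright\lambda}$. The cell module $\Delta(\lambda)$ is the right $A$-module with basis $\{c^\lambda_{\mathsf t}\}$, $c^\lambda_{\mathsf t}a=\sum_{\mathsf v}r(a;\mathsf t,\mathsf v)c^\lambda_{\mathsf v}$. It carries the bilinear form determined by $c^\lambda_{\mathsf s\mathsf t}c^\lambda_{\mathsf u\mathsf v}\equiv\langle c^\lambda_{\mathsf t},c^\lambda_{\mathsf u}\rangle c^\lambda_{\mathsf s\mathsf v}\bmod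 A^{\triangleright\lambda}$. $A$ is cyclic cellular if all $\Delta(\lambda)$ are cyclic. With $\alpha_\lambda:A^{\trianglerighteq\lambda}/A^{\triangleright\lambda}\to\Delta(\lambda)^*\otimes_R\Delta(\lambda)$, $c^\lambda_{\mathsf s\mathsf t}+A^{\triangleright\lambda}\mapsto(c^\lambda_{\mathsf s})^*\otimes c^\lambda_{\mathsf t}$, and $\delta(\lambda)$ a generator of $\Delta(\lambda)$, a cell generator is $m_\lambda\in A^{\trianglerighteq\lambda}$ with $\alpha_\lambda(m_\lambda+A^{\triangleright\lambda})=\delta(\lambda)^*\otimes\delta(\lambda)$; then $\Delta(\lambda)\cong(m_\lambda A+A^{\triangleright\lambda})/A^{\triangleright\lambda}$. **Sequences of diagram algebras.** $R$ is an integral domain with field of fractions $\mathbb F$, $(A_r)_{r\ge0}$ an increasing sequence of cellular $R$-algebras with unital inclusions and consistent involutions, posets $\widehat A_r$ and cell modules $\Delta_{A_r}(\lambda)$. Assumptions: (D1) $A_0=R$. (D2) Each $A_r$ is cyclic cellular; generators $\delta_r(\lambda)$ and cell generators $m_\lambda$ are fixed ($m_\varnothing=1$, $\widehat A_0=\{\varnothing\}$). (D3) $m_\lambda=m_\lambda^*$. (D4) $A_r^{\mathbb F}=A_r\otimes_R\mathbb F$ is split semisimple. (D5) The restriction of each $\Delta_{A_r}(\mu)$ to $A_{r-1}$ has a filtration $0=M_0\subseteq\dots\subseteq M_n$ with $M_i/M_{i-1}\cong\Delta_{A_{r-1}}(\lambda^{(i)})$, $\lambda^{(i)}\triangleright\lambda^{(i+1)}$.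 The branching diagram $\widehat A=\bigsqcup\widehat A_r$ has an edge $\lambda\to\mu$ iff $\Delta_{A_{r-1}}(\lambda)$ occurs in such a filtration of $\Delta_{A_r}(\mu)$; $\mathrm{Std}_r(\nu)$ is the set of paths $\mathsf t$ from $\varnothing=\mathsf t(0)$ to $\mathsf t(r)=\nu$, and $\mathrm{Std}_r=\bigcup_\nu\mathrm{Std}_r(\nu)$. Down-branching factors $d_{\lambda\to\mu}\in A_r$ are fixed such that, with $\mu(1)\triangleright\dots\triangleright\mu(n)$ the points with $\mu(j)\to\nu$, $\Delta_{A_r}(\nu)$ has a filtration by $A_{r-1}$-submodules $M_j$ with isomorphisms $M_j/M_{j-1}\cong\Delta_{A_{r-1}}(\mu(j))$ carrying $\delta_r(\nu)d_{\mu(j)\to\nu}+M_{j-1}$ to $\delta_{r-1}(\mu(j))$. (D6) There are $u_{\lambda\to\mu}\in A_r$ with $m_\mu d_{\lambda\to\mu}=(u_{\lambda\to\mu})^*m_\lambda$. Put $d_{\mathsf t}=d_{\mathsf t(r-1)\to\mathsf t(r)}\cdots d_{\mathsf t(0)\to\mathsf t(1)}$, $m^\lambda_{\mathsf s\mathsf t}=d_{\mathsf s}^*m_\lambda d_{\mathsf t}$ (a cellular basis of $A_r$, equivalent to the original one: same ideals $A_r^{\trianglerighteq\lambda}$, isomorphic cell modules), $m^\lambda_{\mathsf t}=m_\lambda d_{\mathsf t}+A_r^{\triangleright\lambda}$ (basis of $\Delta_{A_r}(\lambda)$). Cell modules and forms are taken with respect to the basis $m^\lambda_{\mathsf s\mathsf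 t}$. **Quotients.** $S$ is an integral domain with field of fractions $\mathbb K$, $\pi:R\to S$ a surjective ring homomorphism, $A_r^S=A_r\otimes_RS$, $A_r^{\mathbb K}=A_r\otimes_R\mathbb K$. $(Q_r^{\mathbb K})_{r\ge0}$ is a tower of unital $\mathbb K$-algebras with common identity, with surjective homomorphisms $\phi_r:A_r^{\mathbb K}\to Q_r^{\mathbb K}$ (written $\phi$) compatible with inclusions; $Q_r^S=\phi(A_r^S)$. (Q1) There are subsets $\widehat A_{r,\mathrm{perm}}\subseteq\widehat A_r$ of permissible points; $\varnothing$ is permissible; each permissible $\mu\in\widehat A_r$ has a permissible $\nu\in\widehat A_{r+1}$ with $\mu\to\nu$ and (if $r\ge1$) a permissible $\lambda\in\widehat A_{r-1}$ with $\lambda\to\mu$. A path is permissible if all its vertices are; $\mathrm{Std}_{r,\mathrm{perm}}(\nu)$ is the set of permissible paths to $\nu$. (Q2) If $\mathsf t\in\mathrm{Std}_r(\nu)$ is not permissible and $k\ge1$ is the first index with $\mu=\mathsf t(k)$ not permissible, there are $\mathfrak b_\mu,\mathfrak b'_\mu\in A_k^S$ with $m_\mu=\mathfrak b_\mu-\mathfrak b'_\mu$, $\mathfrak b_\mu\in\ker\phi$, $\mathfrak b'_\mu\in m_\mu A_k^{\mathbb K}\cap(A_k^S)^{\triangleright\mu}$. (Q3) $\dim_{\overline{\mathbb K}}Q_r^{\overline{\mathbb K}}=\sum_{\nu\in\widehat A_{r,\mathrm{perm}}}(\sharp\mathrm{Std}_{r,\mathrm{perm}}(\nu))^2$, $\overline{\mathbb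 K}$ the algebraic closure. Under these assumptions $Q_r^S$ is cellular with cellular basis $\{\phi(m^\lambda_{\mathsf s\mathsf t})\}$, $\lambda$, $\mathsf s,\mathsf t$ permissible; its cell modules are $\Delta_{Q_r}(\lambda)$. **Jucys–Murphy elements.** An additive family is a sequence $(L_i)_{i\ge1}$ with $L_r\in A_r$, $L_r=L_r^*$, $L_r$ commuting with $A_{r-1}$, and such that for each $\lambda\in\widehat A_r$ the element $L_1+\dots+L_r$ acts on $\Delta_{A_r}(\lambda)$ by a scalar $d(\lambda)\in R$; contents are $\kappa(\lambda\to\mu)=d(\mu)-d(\lambda)$ with $d(\varnothing)=0$. A multiplicative family is defined in the same way with $L_r$ invertible, with the product $L_1\cdots L_r$ acting by an invertible scalar $d(\lambda)$, and contents $d(\mu)/d(\lambda)$ with $d(\varnothing)=1$. Put $\kappa_{\mathsf t}(i)=\kappa(\mathsf t(i-1)\to\mathsf t(i))$. Separation condition: for distinct $\mathsf s,\mathsf t\in\mathrm{Std}_r$ there is $i\le r$ with $\kappa_{\mathsf s}(i)\ne\kappa_{\mathsf t}(i)$. **Seminormal data.** $z_r^\lambda$ is the minimal central idempotent of $A_r^{\mathbb F}$ for the simple module $\Delta^{\mathbb F}_{A_r}(\lambda)=\Delta_{A_r}(\lambda)\otimes_R\mathbb F$. For $\mathsf t\in\mathrm{Std}_r$, $F_{\mathsf t}=\prod_{0\le j\le r}z_j^{\mathsf t(j)}$ (the Gelfand–Zeitlin idempotents of the tower $(A_r^{\mathbb F})$; the Gelfand–Zeitlin idempotents of $(Q_r^{\mathbb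 K})$ are defined in the same way, for permissible paths, from the minimal central idempotents of the $Q_j^{\mathbb K}$ corresponding to the simple modules $\Delta^{\mathbb K}_{Q_j}(\mathsf t(j))$). $f^\lambda_{\mathsf t}=m^\lambda_{\mathsf t}F_{\mathsf t}\in\Delta^{\mathbb F}_{A_r}(\lambda)$ and $F^\lambda_{\mathsf s\mathsf t}=F_{\mathsf s}m^\lambda_{\mathsf s\mathsf t}F_{\mathsf t}$. Let $\mathfrak p=\ker\pi$ and $R_{\mathfrak p}\subset\mathbb F$ the localization; $\pi$ extends to $R_{\mathfrak p}\to\mathbb K$, and, by applying $\pi$ to coefficients in the Murphy bases, to $A_r^{R_{\mathfrak p}}\to A_r^{\mathbb K}$ and $\Delta^{R_{\mathfrak p}}_{A_r}(\lambda)\to\Delta^{\mathbb K}_{A_r}(\lambda)$. Elements of $R_{\mathfrak p}$, $A_r^{R_{\mathfrak p}}$, $\Delta^{R_{\mathfrak p}}_{A_r}(\lambda)$ are called evaluable. Under (SN), for permissible $\mathsf s,\mathsf t$ the elements $F_{\mathsf t},f^\lambda_{\mathsf t},F^\lambda_{\mathsf s\mathsf t},\langle f^\lambda_{\mathsf s},f^\lambda_{\mathsf t}\rangle$ are evaluable. Put $\bar F_{\mathsf t}=\phi\circ\pi(F_{\mathsf t})$, $\bar F^\lambda_{\mathsf s\mathsf t}=\phi\circ\pi(F^\lambda_{\mathsf s\mathsf t})$. For permissible $\lambda$, $\Delta^{\mathbb K}_{Q_r}(\lambda)$ is identified with the simple head of $\Delta^{\mathbb K}_{A_r}(\lambda)$,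 with quotient map also denoted $\phi$ (sending $m^\lambda_{\mathsf t}$ to the corresponding basis element for $\mathsf t$ permissible); $\bar f^\lambda_{\mathsf t}=\phi(\pi(f^\lambda_{\mathsf t}))=\phi(m^\lambda_{\mathsf t}\pi(F_{\mathsf t}))$ for $\mathsf t$ permissible. *)

(* Defs.v *)
From HB Require Import structures.
From mathcomp Require Import all_boot all_order all_algebra all_field.
From mathcomp Require Import boolp classical_sets.

Set Implicit Arguments.
Unset Strict Implicit.
Unset Printing Implicit Defensive.

Import Order.TTheory GRing.Theory.
Local Open Scope ring_scope.

(* Conventions: the dominance order "lam |> mu" is "mu < lam" in the poset of  *)
(* points; right modules over an algebra A are given by an explicit action     *)
(* map M -> A -> M, because the library only has left modules.                 *)

Section Bases.
Context (K : comNzRingType) (V : lmodType K) (I : finType) (b : I -> V).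

Definition is_basis : Prop :=
  forall v, exists! k : {ffun I -> K}, v = \sum_i k i *: b i.

Definition coords (v : V) : {ffun I -> K} :=
  xget 0 [set k : {ffun I -> K} | v = \sum_i k i *: b i].

End Bases.

(* (B, j) is A (x)_R F, given by its universal property: every R-semilinear    *)
(* map from A to an F-module factors uniquely through j.  As j is a ring       *)
(* morphism, this also determines the product of B.                            *)
Definition scalar_extension (R F : comNzRingType) (f : R -> F)
    (A : algType R) (B : algType F) (j : {rmorphism A -> B}) : Prop :=
  (forall r a, j (r *: a) = f r *: j a) /\
  (forall (N : lmodType F) (g : A -> N),
     (forall a b, g (a + b) = g a + g b) ->
     (forall r a, g (r *: a) = f r *: g a) ->
     exists h : {linear B -> N},
       (forall a, h (j a) = g a) /\
       (forall h' : {linear B -> N}, (forall a, h' (j a) = g a) -> h' =1 h)).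

(* B is isomorphic to a finite product of matrix algebras over F. *)
Definition split_semisimple (F : fieldType) (B : algType F) : Prop :=
  exists (I : finType) (n : I -> nat)
         (h : forall i, {lrmorphism B -> 'M[F]_((n i).+1)}),
    forall y : (forall i, 'M[F]_((n i).+1)), exists! x : B, forall i, h i x = y i.

Section Idempotents.
Context (F : comNzRingType) (B : algType F).

Definition central_idempotent (e : B) : Prop :=
  e * e = e /\ forall b, e * b = b * e.

Definition minimal_central_idempotent (z : B) : Prop :=
  [/\ z != 0, central_idempotent z &
      forall e, central_idempotent e -> e * z = e -> e = 0 \/ e = z].

(* The minimal central idempotent of a semisimple algebra B that belongs to a  *)
(* simple right module M is the one that acts as the identity of M.            *)
Definition block_idempotent (M : Type) (act : M -> B -> M) : B :=
  xget 0 [set z | minimal_central_idempotent z /\ forall x, act x z = x].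

End Idempotents.

Section CellModules.
Context (K : comNzRingType) (A : algType K) (L : finType) (T : L -> finType).
Context (c : forall l, T l -> T l -> A).

Definition cell_index : finType := {l : L & (T l * T l)%type}.

Definition cell_basis (i : cell_index) : A := c (tagged i).1 (tagged i).2.

Definition cell_coef (a : A) (l : L) (s t : T l) : K :=
  coords cell_basis a (Tagged (fun l => (T l * T l)%type) (s, t)).

Definition cell_module (l : L) : lmodType K := {ffun T l -> K^o}.

Definition cell_vec (l : L) (t : T l) : cell_module l := [ffun v => (v == t)%:R].

(* r(a; t, v) is the coefficient of c_sv in c_st a for every s; we read it off *)
(* at s = t.                                                                   *)
Definition cell_action (l : L) (x : cell_module l) (a : A) : cell_module l :=
  [ffun v => \sum_t x t * cell_coef (c t t * a) t v].

(* <c_t, c_u> is the coefficient of c_sv in c_st c_uv for all s and v; we read *)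
(* it off at s = t, v = u.                                                     *)
Definition cell_form (l : L) (x y : cell_module l) : K :=
  \sum_t \sum_u x t * y u * cell_coef (c t t * c u u) t u.

End CellModules.

Section CellularAlgebras.
Context (disp : Order.disp_t) (R : idomainType) (A : algType R).
Context (L : finPOrderType disp) (T : L -> finType).
Context (c : forall l, T l -> T l -> A).

Definition cell_ideal_gt (l : L) (x : A) : Prop :=
  exists k : cell_index T -> R,
    x = \sum_(i | (l < tag i)%O) k i *: cell_basis c i.

Definition cell_ideal_ge (l : L) (x : A) : Prop :=
  exists k : cell_index T -> R,
    x = \sum_(i | (l <= tag i)%O) k i *: cell_basis c i.

Definition algebra_involution (star : A -> A) : Prop :=
  [/\ forall a b, star (a + b) = star a + star b,
      forall r a, star (r *: a) = r *: star a,
      forall a b, star (a * b) = star b * star a &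
      forall a, star (star a) = a].

Definition cell_datum (star : A -> A) : Prop :=
  [/\ algebra_involution star,
      is_basis (cell_basis c),
      forall (l : L) (t : T l) (a : A), exists r : T l -> R,
        forall s, cell_ideal_gt l (c s t * a - \sum_v r v *: c s v) &
      forall (l : L) (s t : T l), cell_ideal_gt l (star (c s t) - c t s)].

Definition cyclic_generator (l : L) (x : cell_module R T l) : Prop :=
  forall y, exists a, y = cell_action c x a.

(* Delta(l)^* (x) Delta(l) is free on the pairs (c_s)^* (x) c_t; its elements  *)
(* are written as coefficient functions on pairs.                              *)
Definition cell_tensor (l : L) (x y : cell_module R T l) : {ffun T l * T l -> R} :=
  [ffun p => x p.1 * y p.2].

Definition cell_alpha (l : L) (a : A) : {ffun T l * T l -> R} :=
  [ffun p => cell_coef c a p.1 p.2].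

Definition cell_generator (l : L) (x : cell_module R T l) (m : A) : Prop :=
  cell_ideal_ge l m /\ cell_alpha l m = cell_tensor x x.

End CellularAlgebras.

Record cellular_tower (R : idomainType) := CellularTower {
  ct_disp : Order.disp_t;
  alg : nat -> algType R;
  inc : forall r, {lrmorphism alg r -> alg r.+1};
  star : forall r, alg r -> alg r;
  points : nat -> finPOrderType ct_disp;
  tabs : forall r, points r -> finType;
  cellb : forall r (l : points r), tabs l -> tabs l -> alg r;
  ct_inc_inj : forall r, injective (inc r);
  ct_star_inc : forall r a, star (inc r a) = inc r (star a);
  ct_cellular : forall r, cell_datum (@cellb r) (@star r)
}.
Arguments inc {R c} r.
Arguments star {R c r}.
Arguments points {R} c r.
Arguments tabs {R} c r l.
Arguments cellb {R} c r l s t.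

Section Branching.
Context (R : idomainType) (A : cellular_tower R).

Definition Delta (r : nat) (l : points A r) : lmodType R := cell_module R (tabs A r) l.

Definition Dact (r : nat) (l : points A r) : Delta l -> alg A r -> Delta l :=
  cell_action (cellb A r) (l := l).

Definition restricted_submodule (r : nat) (nu : points A r.+1) (M : set (Delta nu)) :
    Prop :=
  [/\ M 0, forall x y, M x -> M y -> M (x + y), forall k x, M x -> M (k *: x) &
      forall x a, M x -> M (Dact x (inc r a))].

(* g induces an isomorphism from M / M' onto Delta(mu), i.e. g is a surjective *)
(* morphism of right (alg A r)-modules from M to Delta(mu) with kernel M'.     *)
Definition subquotient_iso (r : nat) (nu : points A r.+1) (M' M : set (Delta nu))
    (mu : points A r) (g : Delta nu -> Delta mu) : Prop :=
  [/\ forall k x y, M x -> M y -> g (k *: x + y) = k *: g x + g y,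
      forall x a, M x -> g (Dact x (inc r a)) = Dact (g x) a,
      forall y, exists2 x, M x & g x = y &
      forall x, M x -> (g x = 0 <-> M' x)].

Definition cell_filtration (r : nat) (nu : points A r.+1) (n : nat)
    (ls : n.-tuple (points A r)) (M : nat -> set (Delta nu))
    (g : forall i : 'I_n, Delta nu -> Delta (tnth ls i)) : Prop :=
  [/\ forall x, M 0%N x <-> x = 0,
      forall x, M n x,
      forall i, (i < n)%N -> (M i `<=` M i.+1)%classic,
      forall i, (i <= n)%N -> restricted_submodule (M i) &
      sorted (fun x y => (y < x)%O) ls /\
      forall i : 'I_n, subquotient_iso (M i) (M i.+1) (g i)].

Definition edge (r : nat) (l : points A r) (nu : points A r.+1) : bool :=
  `[< exists n (ls : n.-tuple (points A r)) (M : nat -> set (Delta nu))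
        (g : forall i : 'I_n, Delta nu -> Delta (tnth ls i)),
        cell_filtration M g /\ l \in ls >].

(* Std_r(nu): a path to nu at level r+1 is a path to the penultimate point     *)
(* together with an edge from that point to nu.                                *)
Fixpoint Std (r : nat) : points A r -> finType :=
  match r return points A r -> finType with
  | 0 => fun _ => unit
  | r'.+1 => fun nu => {l : {l : points A r' | edge l nu} & Std (val l)}
  end.

Definition prev_point (r : nat) (nu : points A r.+1) (t : Std nu) : points A r :=
  val (tag t).

Definition prev_path (r : nat) (nu : points A r.+1) (t : Std nu) :
  Std (prev_point t) := tagged t.

Definition level_point : Type := {r : nat & points A r}.

(* The list t(0), ..., t(r). *)
Fixpoint vertices (r : nat) : forall nu : points A r, Std nu -> seq level_point :=
  match r return forall nu : points A r, Std nu -> seq level_point with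
  | 0 => fun nu _ => [:: Tagged (points A) nu]
  | r'.+1 => fun nu t => rcons (vertices (prev_path t)) (Tagged (points A) nu)
  end.

Definition all_paths (r : nat) : finType := {nu : points A r & Std nu}.

(* The list kappa_t(1), ..., kappa_t(r). *)
Fixpoint contents (kappa : forall r, points A r -> points A r.+1 -> R) (r : nat) :
    forall nu : points A r, Std nu -> seq R :=
  match r return forall nu : points A r, Std nu -> seq R with
  | 0 => fun _ _ => [::]
  | r'.+1 => fun nu t =>
      rcons (contents kappa (prev_path t)) (kappa r' (prev_point t) nu)
  end.

Definition separation (kappa : forall r, points A r -> points A r.+1 -> R) : Prop :=
  forall r (s t : all_paths r), s <> t ->
  exists2 i, (i < r)%N &
    nth 0 (contents kappa (tagged s)) i <> nth 0 (contents kappa (tagged t)) i.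

End Branching.

Section Murphy.
Context (R : idomainType) (A : cellular_tower R).
Context (mgen : forall r, points A r -> alg A r).
Context (dfac : forall r, points A r -> points A r.+1 -> alg A r.+1).

(* d_t = d_{t(r-1) -> t(r)} ... d_{t(0) -> t(1)} *)
Fixpoint dpath (r : nat) : forall nu : points A r, Std nu -> alg A r :=
  match r return forall nu : points A r, Std nu -> alg A r with
  | 0 => fun _ _ => 1
  | r'.+1 => fun nu t => dfac (prev_point t) nu * inc r' (dpath (prev_path t))
  end.

Definition murphy_elt (r : nat) (l : points A r) (s t : Std l) : alg A r :=
  star (dpath s) * mgen l * dpath t.

End Murphy.

(* A sequence of diagram algebras with its fixed data; gen is delta_r(lambda), *)
(* mgen is m_lambda and dfac is d_{lambda -> mu}, whose values are only        *)
(* relevant on edges.  (algF, jF) is the tower of algebras A_r (x)_R F.        *)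
Record diagram_algebras (R : idomainType) := DiagramAlgebras {
  tower :> cellular_tower R;
  empty_pt : points tower 0;
  gen : forall r (l : points tower r), Delta l;
  mgen : forall r, points tower r -> alg tower r;
  dfac : forall r, points tower r -> points tower r.+1 -> alg tower r.+1;
  algF : nat -> algType {fraction R};
  jF : forall r, {rmorphism alg tower r -> algF r};
  incF : forall r, {lrmorphism algF r -> algF r.+1};
  jF_ext : forall r, scalar_extension (@tofrac R) (jF r);
  jF_inc : forall r a, incF r (jF r a) = jF r.+1 (inc r a);
  level0_alg : bijective (fun k : R => k *: (1 : alg tower 0));
  level0_pt : forall l : points tower 0, l = empty_pt;
  gen_cyclic : forall r (l : points tower r),
    cyclic_generator (cellb tower r) (gen l);
  mgen_cell : forall r (l : points tower r),
    cell_generator (cellb tower r) (gen l) (mgen l);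
  mgen_empty : mgen empty_pt = 1;
  mgen_star : forall r (l : points tower r), star (mgen l) = mgen l;
  algF_split : forall r, split_semisimple (algF r);
  restriction_filtered : forall r (nu : points tower r.+1),
    exists n (ls : n.-tuple (points tower r)) (M : nat -> set (Delta nu))
           (g : forall i : 'I_n, Delta nu -> Delta (tnth ls i)),
      cell_filtration M g;
  dfac_filtration : forall r (nu : points tower r.+1),
    exists n (ls : n.-tuple (points tower r)) (M : nat -> set (Delta nu))
           (g : forall i : 'I_n, Delta nu -> Delta (tnth ls i)),
      [/\ cell_filtration M g,
          forall l, (l \in ls) = edge l nu &
          forall i : 'I_n, let x := Dact (gen nu) (dfac (tnth ls i) nu) in
            M i.+1 x /\ g i x = gen (tnth ls i)];
  ubranch : forall r (l : points tower r) (nu : points tower r.+1), edge l nu ->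
    exists u : alg tower r.+1,
      mgen nu * dfac l nu = star u * inc r (mgen l)
}.
Arguments empty_pt {R} d.
Arguments gen {R} d {r} l.
Arguments mgen {R} d {r} l.
Arguments dfac {R} d {r} l nu.
Arguments algF {R} d r.
Arguments jF {R d} r.
Arguments incF {R d} r.

Section DiagramAlgebraNotions.
Context (R : idomainType) (D : diagram_algebras R).
Local Notation F := {fraction R}.

Definition murphy (r : nat) (l : points D r) (s t : Std l) : alg D r :=
  murphy_elt (@mgen R D) (@dfac R D) s t.

Definition murphyF (r : nat) (l : points D r) (s t : Std l) : algF D r :=
  jF r (murphy s t).

(* From here on cell modules are taken with respect to the Murphy bases.       *)
Definition MDelta (r : nat) (l : points D r) : lmodType R :=
  cell_module R (@Std R D r) l.

Definition MDact (r : nat) (l : points D r) : MDelta l -> alg D r -> MDelta l :=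
  cell_action (@murphy r) (l := l).

(* The Murphy basis is also a basis of algF D r, and MDelta l (x)_R F is its   *)
(* cell module.                                                                *)
Definition DeltaF (r : nat) (l : points D r) : lmodType F :=
  cell_module F (@Std R D r) l.

Definition DactF (r : nat) (l : points D r) : DeltaF l -> algF D r -> DeltaF l :=
  cell_action (@murphyF r) (l := l).

Definition formF (r : nat) (l : points D r) : DeltaF l -> DeltaF l -> F :=
  cell_form (@murphyF r) (l := l).

Definition mvecF (r : nat) (l : points D r) (t : Std l) : DeltaF l :=
  cell_vec F t.

Definition zF (r : nat) (l : points D r) : algF D r :=
  block_idempotent (@DactF r l).

Fixpoint GZF (r : nat) : forall nu : points D r, Std nu -> algF D r :=
  match r return forall nu : points D r, Std nu -> algF D r with
  | 0 => fun nu _ => zF nu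
  | r'.+1 => fun nu t => incF r' (GZF (prev_path t)) * zF nu
  end.

Definition fvec (r : nat) (l : points D r) (t : Std l) : DeltaF l :=
  DactF (mvecF t) (GZF t).

Definition Felt (r : nat) (l : points D r) (s t : Std l) : algF D r :=
  GZF s * murphyF s t * GZF t.

(* Jucys-Murphy families: L r stands for L_{r+1} in A_{r+1}.                   *)
Fixpoint JM_sum (L : forall r, alg D r.+1) (r : nat) : alg D r :=
  match r return alg D r with
  | 0 => 0
  | r'.+1 => inc r' (JM_sum L r') + L r'
  end.

Fixpoint JM_prod (L : forall r, alg D r.+1) (r : nat) : alg D r :=
  match r return alg D r with
  | 0 => 1
  | r'.+1 => inc r' (JM_prod L r') * L r'
  end.

Definition additive_JM (L : forall r, alg D r.+1) (d : forall r, points D r -> R) :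
    Prop :=
  [/\ forall r, star (L r) = L r,
      forall r (a : alg D r), L r * inc r a = inc r a * L r,
      forall r (l : points D r) (x : MDelta l), MDact x (JM_sum L r) = d r l *: x &
      d 0%N (empty_pt D) = 0].

Definition multiplicative_JM (L : forall r, alg D r.+1)
    (d : forall r, points D r -> R) : Prop :=
  [/\ forall r, star (L r) = L r,
      forall r (a : alg D r), L r * inc r a = inc r a * L r,
      forall r, exists L' : alg D r.+1, L r * L' = 1 /\ L' * L r = 1,
      forall r (l : points D r), d r l \is a GRing.unit /\
        forall x : MDelta l, MDact x (JM_prod L r) = d r l *: x &
      d 0%N (empty_pt D) = 1].

Definition additive_content (d : forall r, points D r -> R) :
    forall r, points D r -> points D r.+1 -> R :=
  fun r l mu => d r.+1 mu - d r l.

Definition multiplicative_content (d : forall r, points D r -> R) :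
    forall r, points D r -> points D r.+1 -> R :=
  fun r l mu => d r.+1 mu / d r l.

Definition separated_JM (L : forall r, alg D r.+1) (d : forall r, points D r -> R) :
    Prop :=
  (additive_JM L d /\ separation (additive_content d)) \/
  (multiplicative_JM L d /\ separation (multiplicative_content d)).

End DiagramAlgebraNotions.

Section Specialization.
Context (R S : idomainType) (pi : {rmorphism R -> S}).

(* x lies in the localization of R at ker pi. *)
Definition evaluable (x : {fraction R}) : Prop :=
  exists a s, pi s != 0 /\ x = tofrac a / tofrac s.

(* The extension of pi to that localization (0 outside of it). *)
Definition evalF (x : {fraction R}) : {fraction S} :=
  xget 0 [set y : {fraction S} | exists a s,
    [/\ pi s != 0, x = tofrac a / tofrac s & y = tofrac (pi a) / tofrac (pi s)]].

End Specialization.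

Section Permissible.
Context (R : idomainType) (D : diagram_algebras R) (perm : forall r, pred (points D r)).

Definition perm_vertex (p : level_point D) : bool := perm (tagged p).

Definition perm_path (r : nat) (l : points D r) (t : Std l) : bool :=
  all perm_vertex (vertices t).

(* Std_{r,perm}(l); it is empty unless l itself is permissible. *)
Definition Std_perm (r : nat) (l : points D r) : finType := {t : Std l | perm_path t}.

(* mu is the first non-permissible vertex of t. *)
Definition first_nonperm (r : nat) (l : points D r) (t : Std l) (k : nat)
    (mu : points D k) : Prop :=
  [/\ onth (vertices t) k = Some (Tagged (points D) mu), ~~ perm mu &
      all perm_vertex (take k (vertices t))].

End Permissible.

Section SForm.
Context (R S : idomainType) (pi : {rmorphism R -> S}) (D : diagram_algebras R).
Context (AK : nat -> algType {fraction S}).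
Context (jK : forall r, {rmorphism alg D r -> AK r}).

(* The image of A_r (x)_R S in A_r (x)_R K: the S-span of the image of A_r. *)
Definition in_AS (r : nat) (x : AK r) : Prop :=
  exists n (k : 'I_n -> S) (a : 'I_n -> alg D r),
    x = \sum_i tofrac (k i) *: jK r (a i).

Definition in_AS_gt (r : nat) (mu : points D r) (x : AK r) : Prop :=
  exists k : cell_index (tabs D r) -> S,
    x = \sum_(i | (mu < tag i)%O) tofrac (k i) *: jK r (cell_basis (cellb D r) i).

End SForm.

(* Quotients of a sequence of diagram algebras; (algK, jK) is the tower of the *)
(* A_r (x)_R K, Kbar an algebraic closure of K and (Qbar, jbar) the tower of   *)
(* the Q_r (x)_K Kbar.                                                         *)
Record diagram_quotients (R S : idomainType) (pi : {rmorphism R -> S})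
    (D : diagram_algebras R) := DiagramQuotients {
  algK : nat -> algType {fraction S};
  jK : forall r, {rmorphism alg D r -> algK r};
  incK : forall r, {lrmorphism algK r -> algK r.+1};
  jK_ext : forall r, scalar_extension (fun k => tofrac (pi k)) (jK r);
  jK_inc : forall r a, incK r (jK r a) = jK r.+1 (inc r a);
  algQ : nat -> algType {fraction S};
  incQ : forall r, {lrmorphism algQ r -> algQ r.+1};
  incQ_inj : forall r, injective (incQ r);
  phi : forall r, {lrmorphism algK r -> algQ r};
  phi_surj : forall r (y : algQ r), exists x, phi r x = y;
  phi_inc : forall r x, phi r.+1 (incK r x) = incQ r (phi r x);
  perm : forall r, pred (points D r);
  perm_empty : perm (empty_pt D);
  perm_up : forall r (mu : points D r), perm mu ->
    exists2 nu : points D r.+1, perm nu & edge mu nu;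
  perm_down : forall r (mu : points D r.+1), perm mu ->
    exists2 l : points D r, perm l & edge l mu;
  perm_kernel : forall r (nu : points D r) (t : Std nu) k (mu : points D k),
    first_nonperm perm t mu ->
    exists b b' : algK k,
      [/\ in_AS jK b /\ in_AS jK b', jK k (mgen D mu) = b - b', phi k b = 0,
          exists a, b' = jK k (mgen D mu) * a & in_AS_gt jK mu b'];
  Kbar : closedFieldType;
  iota : {rmorphism {fraction S} -> Kbar};
  Kbar_algebraic : forall x : Kbar, algebraicOver iota x;
  Qbar : nat -> falgType Kbar;
  jbar : forall r, {rmorphism algQ r -> Qbar r};
  jbar_ext : forall r, scalar_extension iota (jbar r);
  dim_quotient : forall r,
    \dim (fullv : {vspace Qbar r}) =
      (\sum_(nu : points D r | perm nu) #|Std_perm perm nu| ^ 2)%N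
}.
Arguments jK {R S pi D d} r.
Arguments incQ {R S pi D d} r.
Arguments phi {R S pi D d} r.
Arguments perm {R S pi D} d {r} _.

Section QuotientNotions.
Context (R S : idomainType) (pi : {rmorphism R -> S}) (D : diagram_algebras R).
Context (W : diagram_quotients pi D).
Local Notation K := {fraction S}.

Definition pStd (r : nat) (l : points D r) : finType := Std_perm (@perm R S pi D W) l.

Definition murphyK (r : nat) (l : points D r) (s t : Std l) : algK W r :=
  jK r (murphy s t).

Definition DeltaK (r : nat) (l : points D r) : lmodType K :=
  cell_module K (@Std R D r) l.

Definition DactK (r : nat) (l : points D r) : DeltaK l -> algK W r -> DeltaK l :=
  cell_action (@murphyK r) (l := l).

Definition murphyQ (r : nat) (l : points D r) (s t : pStd l) : algQ W r :=
  phi r (murphyK (val s) (val t)).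

(* Delta_{Q_r}(l) (x)_S K: the cell module of Q_r for the cellular basis       *)
(* phi(m_st), with s and t permissible.                                        *)
Definition DeltaQ (r : nat) (l : points D r) : lmodType K := cell_module K (@pStd r) l.

Definition DactQ (r : nat) (l : points D r) : DeltaQ l -> algQ W r -> DeltaQ l :=
  cell_action (@murphyQ r) (l := l).

Definition zQ (r : nat) (l : points D r) : algQ W r := block_idempotent (@DactQ r l).

Fixpoint GZQ (r : nat) : forall nu : points D r, Std nu -> algQ W r :=
  match r return forall nu : points D r, Std nu -> algQ W r with
  | 0 => fun nu _ => zQ nu
  | r'.+1 => fun nu t => incQ r' (GZQ (prev_path t)) * zQ nu
  end.

Definition evaluableA (r : nat) (x : algF D r) : Prop :=
  forall i, evaluable pi (coords (cell_basis (@murphyF R D r)) x i).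

Definition evalA (r : nat) (x : algF D r) : algK W r :=
  \sum_i evalF pi (coords (cell_basis (@murphyF R D r)) x i) *:
         cell_basis (@murphyK r) i.

Definition evalD (r : nat) (l : points D r) (x : DeltaF l) : DeltaK l :=
  [ffun t => evalF pi (x t)].

(* The quotient map from Delta_{A_r}(l) (x) K to its simple head, identified   *)
(* with Delta_{Q_r}(l) (x) K so that m_t goes to the basis element of t.       *)
Definition head_map (q : forall r (l : points D r), DeltaK l -> DeltaQ l) : Prop :=
  forall r (l : points D r), perm W l ->
  [/\ forall k x y, q r l (k *: x + y) = k *: q r l x + q r l y,
      forall x a, q r l (DactK x a) = DactQ (q r l x) (phi r a) &
      forall t : pStd l, q r l (cell_vec K (val t)) = cell_vec K t].

Definition Fbar (r : nat) (l : points D r) (t : Std l) : algQ W r :=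
  phi r (evalA (GZF t)).

Definition Feltbar (r : nat) (l : points D r) (s t : Std l) : algQ W r :=
  phi r (evalA (Felt s t)).

Definition fbar (q : forall r (l : points D r), DeltaK l -> DeltaQ l)
    (r : nat) (l : points D r) (t : Std l) : DeltaQ l :=
  q r l (evalD (fvec t)).

Definition formbar (r : nat) (l : points D r) (s t : Std l) : K :=
  evalF pi (formF (fvec s) (fvec t)).

Definition Ebar (r : nat) (l : points D r) (s t : Std l) : algQ W r :=
  (formbar s s)^-1 *: Feltbar s t.

End QuotientNotions.

Section MatrixUnits.
Context (K : fieldType) (B : algType K) (L : finType) (T : L -> finType).
Context (E : forall l, T l -> T l -> B).

Definition matrix_units : Prop :=
  (forall l (s t u v : T l), E s t * E u v = if t == u then E s v else 0) /\
  (forall l m (s t : T l) (u v : T m), l != m -> E s t * E u v = 0).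

Definition complete_matrix_units : Prop :=
  [/\ matrix_units, is_basis (cell_basis E) & \sum_l \sum_(s : T l) E s s = 1].

End MatrixUnits.

(* Main.v *)
Require Import Defs.
From HB Require Import structures.
From mathcomp Require Import all_boot all_order all_algebra all_field.
From mathcomp Require Import boolp classical_sets.
Set Implicit Arguments.
Unset Strict Implicit.
Unset Printing Implicit Defensive.
Import Order.TTheory GRing.Theory.
Local Open Scope ring_scope.

(* The elements d_t turn the filtrations of restricted cell modules into bases, *)
(* so the Murphy elements form a cellular basis, and a path basis vector acted   *)
(* on by a lower algebra only produces paths with a more dominant tail.  Hence   *)
(* f_t = m_t + (larger paths), and over the fraction field F_st acts as a scaled *)
(* matrix unit; faithfulness of the cell modules (nondegeneracy of the forms)    *)
(* gives the product formulas and F_tt = <f_t, f_t> F_t there.  Evaluation and   *)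
(* phi are multiplicative, so these formulas descend to Q.  The kernel of phi is *)
(* stable under star because Q is split semisimple; with (Q2) this shows that    *)
(* the permissible Murphy elements span Q, and they are a basis by (Q3).  In     *)
(* this basis the image of F_tt has coefficient 1 at (t, t), which forces        *)
(* pi <f_t, f_t> <> 0.  The normalized elements are then a full system of matrix *)
(* units, whose block sums are the minimal central idempotents of Q.             *)

(** Permissible paths index a basis of [Q_r], and evaluated seminormal vectors have leading
    coefficient 1 with respect to it; so the seminormal form of [A_r] over [{fraction R}] survives
    evaluation. Three facts carry the argument.

    Triangularity. The vectors [gpath t] form bases of the cell modules ([gpath_basis]). When an
    element of a lower algebra acts on such a vector, the coefficients of paths through the same
    point are those of the lower level, and all other new paths run through more dominant points
    ([branchB]). Hence f_t is [e_t] plus terms of larger [rank] ([fvec_tri]), and F_st is congruent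
    to the tensor of f_s and f_t modulo more dominant cells ([Felt_eqm]). Cell modules of a
    semisimple cellular algebra are jointly faithful ([cell_faithful]), so identities between the
    F_st may be checked on the f_t; this gives [Felt_mul] and [Felt_diag].

    Reduction to permissible paths. (Q2), carried along paths by the factorizations (D6), rewrites
    the image of m d_t for nonpermissible t in terms of larger rank ([nonperm_reduction]), and this
    is iterated in [perm_reduction_gen]. It treats the right index; the left index follows by
    [star], because the kernel of [phi] is stable under [star] ([split_kernel_star]). So the
    permissible Murphy elements span [Q_r], and by the dimension formula (Q3) they form a basis
    ([murphyQ_basis]).

    Nonvanishing. The reduction fixes permissible paths and otherwise produces only larger ranks, so
    the image of F_tt keeps coefficient 1 at (t, t) ([Feltbar_neq0]). It is also the evaluation of
    <f_t, f_t> times the image of F_t, so that scalar is nonzero. The normalized elements are then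
    independent matrix units, as many as a basis; their block sums are the minimal central
    idempotents ([zQ_Fbar]), which gives the Gelfand-Zeitlin idempotents by induction on the level
    ([Fbar_GZQ]). The images of the permissible F_s sum to 1, and inserting this sum yields the
    matrix coefficients ([coefficient_action]). *)

Lemma scale_swap (K : comNzRingType) (V : lmodType K) (a b : K) (v : V) :
  a *: (b *: v) = b *: (a *: v).
Proof. by rewrite !scalerA mulrC. Qed.

(** * Bases and spans *)

Section Spans.
Context (K : comNzRingType) (V : lmodType K) (I : finType) (b : I -> V).

Definition span_on (P : pred I) (x : V) : Prop :=
  exists k : I -> K, x = \sum_(i | P i) k i *: b i.

Lemma span_on0 P : span_on P 0.
Proof. by exists (fun=> 0); rewrite big1 // => i _; rewrite scale0r. Qed.

Lemma span_onD P x y : span_on P x -> span_on P y -> span_on P (x + y).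
Proof.
move=> [k ->] [k' ->]; exists (fun i => k i + k' i).
by rewrite -big_split; apply: eq_bigr => i _; rewrite scalerDl.
Qed.

Lemma span_onZ P a x : span_on P x -> span_on P (a *: x).
Proof.
move=> [k ->]; exists (fun i => a * k i).
by rewrite scaler_sumr; apply: eq_bigr => i _; rewrite scalerA.
Qed.

Lemma span_onN P x : span_on P x -> span_on P (- x).
Proof. by move=> Px; rewrite -scaleN1r; apply: span_onZ. Qed.

Lemma span_on_sum P (J : finType) (Q : pred J) (x : J -> V) :
  (forall j, Q j -> span_on P (x j)) -> span_on P (\sum_(j | Q j) x j).
Proof. by move=> Px; elim/big_ind: _ => //; [apply: span_on0 | apply: span_onD]. Qed.

Lemma span_on_base (P : pred I) i : P i -> span_on P (b i).
Proof.
move=> Pi; exists (fun j => (j == i)%:R); rewrite (bigD1 i) //= eqxx scale1r.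
by rewrite big1 ?addr0 // => j /andP[_ /negPf ->]; rewrite scale0r.
Qed.

Lemma span_on_ind (P : pred I) (Q : V -> Prop) x : span_on P x ->
  Q 0 -> (forall u v, Q u -> Q v -> Q (u + v)) -> (forall k u, Q u -> Q (k *: u)) ->
  (forall i, P i -> Q (b i)) -> Q x.
Proof.
by move=> [k ->] Q0 QD QZ Qb; elim/big_ind: _ => // i Pi; apply/QZ/Qb.
Qed.

Lemma is_basisP : is_basis b <->
  (forall v, span_on predT v) /\
  (forall k : I -> K, \sum_i k i *: b i = 0 -> forall i, k i = 0).
Proof.
split=> [bB|[bS bI] v].
  split=> [v|k k0 i]; first by have [k [-> _]] := bB v; exists k.
  have [k' [_ k'U]] := bB 0.
  have k'0 : k' = [ffun=> 0].
    by apply: k'U; rewrite big1 // => j _; rewrite ffunE scale0r.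
  have : k' = finfun k.
    by apply: k'U; rewrite -[LHS]k0; apply: eq_bigr => j _; rewrite ffunE.
  by rewrite k'0 => /ffunP/(_ i); rewrite !ffunE.
have [k vE] := bS v; exists (finfun k); split.
  by rewrite vE; apply: eq_bigr => i _; rewrite ffunE.
move=> k' vE'; apply/ffunP=> i; rewrite ffunE; apply/eqP; rewrite -subr_eq0; apply/eqP.
apply: (bI (fun i => k i - k' i)).
under eq_bigr do rewrite scalerBl.
by rewrite big_split /= sumrN -vE -vE' subrr.
Qed.

Hypothesis bB : is_basis b.

Lemma coordsE v : v = \sum_i coords b v i *: b i.
Proof.
rewrite /coords; case: xgetP => [k _ //|] /=; have [k [vE _]] := bB v.
by move=> /(_ k) /(_ vE).
Qed.

Lemma coords_uniq v (k : I -> K) : v = \sum_i k i *: b i -> forall i, coords b v i = k i.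
Proof.
move=> vE i; have [_ /(_ (fun i => coords b v i - k i)) bI] := is_basisP.1 bB.
apply/eqP; rewrite -subr_eq0; apply/eqP/bI.
under eq_bigr do rewrite scalerBl.
by rewrite big_split /= sumrN -coordsE -vE subrr.
Qed.

Lemma coordsD x y i : coords b (x + y) i = coords b x i + coords b y i.
Proof.
apply: (coords_uniq (k := fun i => coords b x i + coords b y i)).
by under eq_bigr do rewrite scalerDl; rewrite big_split /= -!coordsE.
Qed.

Lemma coordsZ a x i : coords b (a *: x) i = a * coords b x i.
Proof.
apply: (coords_uniq (k := fun i => a * coords b x i)).
by under eq_bigr do rewrite -scalerA; rewrite -scaler_sumr -coordsE.
Qed.

Lemma coords0 i : coords b 0 i = 0.
Proof. by rewrite -(scale0r 0) coordsZ mul0r. Qed.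

Lemma coordsB x y i : coords b (x - y) i = coords b x i - coords b y i.
Proof. by rewrite coordsD -scaleN1r coordsZ mulN1r. Qed.

Lemma coords_sum (J : finType) (P : pred J) (x : J -> V) i :
  coords b (\sum_(j | P j) x j) i = \sum_(j | P j) coords b (x j) i.
Proof.
by apply: (big_morph (fun x => coords b x i)) => [u v|]; rewrite ?coordsD ?coords0.
Qed.

Lemma coords_base i j : coords b (b i) j = (j == i)%:R.
Proof.
apply: (coords_uniq (k := fun j => (j == i)%:R)).
rewrite (bigD1 i) //= eqxx scale1r.
by rewrite big1 ?addr0 // => l /negPf ->; rewrite scale0r.
Qed.

Lemma coords_inj x y : (forall i, coords b x i = coords b y i) -> x = y.
Proof.
by move=> xy; rewrite [x]coordsE [y]coordsE; apply: eq_bigr => i _; rewrite xy.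
Qed.

Lemma span_onP (P : pred I) x : span_on P x <-> forall i, ~~ P i -> coords b x i = 0.
Proof.
split=> [Px i Pi|x0].
  apply: (span_on_ind (Q := fun x => coords b x i = 0) Px) => [|u v u0 v0|k u u0|j Pj].
  - exact: coords0.
  - by rewrite coordsD u0 v0 addr0.
  - by rewrite coordsZ u0 mulr0.
  - by rewrite coords_base; case: eqP Pi => // ->; rewrite Pj.
exists (coords b x); rewrite {1}[x]coordsE (bigID P) /= [X in _ + X]big1 ?addr0 //.
by move=> i /x0 ->; rewrite scale0r.
Qed.

Lemma base_neq0 i : b i != 0.
Proof.
apply/eqP => b0; have := coords_base i i.
by rewrite b0 coords0 eqxx => /esym/eqP; rewrite oner_eq0.
Qed.

End Spans.

Section SpanMonotone.
Context (K : comNzRingType) (V : lmodType K) (I : finType) (b : I -> V).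

Lemma span_onS (P Q : pred I) x : subpred P Q -> span_on b P x -> span_on b Q x.
Proof.
move=> PQ Px; apply: (span_on_ind (Q := span_on b Q) Px); [exact: span_on0 | exact: span_onD |
  exact: span_onZ | by move=> i /PQ; apply: span_on_base].
Qed.

End SpanMonotone.

Section FieldBases.
Context (F : fieldType) (V : lmodType F) (I : finType) (b e : I -> V).
Hypothesis bB : is_basis b.

(** The coordinate matrix of [e] in [b] has trivial left kernel, hence is invertible, and its
    inverse expands any vector in [e]. This is the dimension argument for modules known only through
    a finite basis. *)
Lemma free_same_size_basis :
  (forall k : I -> F, \sum_i k i *: e i = 0 -> forall i, k i = 0) -> is_basis e.
Proof.
move=> eI; apply/is_basisP; split=> // v.
pose M : 'M[F]_#|I| := \matrix_(i, j) coords b (e (enum_val i)) (enum_val j).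
have sumE (k : I -> F) : \sum_i k i *: e i =
    \sum_j (\sum_i k i * coords b (e i) j) *: b j.
  under eq_bigr => i _ do rewrite {1}[e i](coordsE bB) scaler_sumr.
  rewrite exchange_big; apply: eq_bigr => j _; rewrite scaler_suml.
  by apply: eq_bigr => i _; rewrite scalerA.
have Mu : M \in unitmx.
  rewrite -row_free_unit -kermx_eq0; apply/eqP/row_matrixP => i.
  rewrite row0; set u := row i _.
  have uM : u *m M = 0 by apply/sub_kermxP; apply: row_sub.
  have u0 j : u 0 (enum_rank j) = 0.
    apply: (eI (fun j => u 0 (enum_rank j))); rewrite sumE big1 // => l _.
    move/matrixP: uM => /(_ 0 (enum_rank l)); rewrite !mxE.
    rewrite (reindex enum_rank) /=; last by apply: onW_bij; exact: enum_rank_bij.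
    rewrite (eq_bigr (fun i => u 0 (enum_rank i) * coords b (e i) l)) => [->|i' _].
      by rewrite scale0r.
    by rewrite [M _ _]mxE !enum_rankK.
  by apply/rowP => j; rewrite -[j]enum_valK u0 mxE.
pose w : 'rV[F]_#|I| := (\row_j coords b v (enum_val j)) *m invmx M.
exists (fun i => w 0 (enum_rank i)); rewrite sumE [LHS](coordsE bB).
apply: eq_bigr => l _; congr (_ *: _).
have : w *m M = \row_j coords b v (enum_val j) by rewrite mulmxKV.
move/matrixP => /(_ 0 (enum_rank l)); rewrite [RHS]mxE enum_rankK => <-; rewrite mxE.
rewrite (reindex enum_rank) /=; last by apply: onW_bij; exact: enum_rank_bij.
by apply: eq_bigr => i _; rewrite [M _ _]mxE !enum_rankK.
Qed.

End FieldBases.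

(** * Cellular algebras over a domain *)

Section CellularTheory.
Context (disp : Order.disp_t) (K : idomainType) (A : algType K).
Context (L : finPOrderType disp) (T : L -> finType).
Context (c : forall l, T l -> T l -> A) (star : A -> A).
Hypothesis cellA : cell_datum c star.

Local Notation cb := (cell_basis c).
Local Notation ix s t := (Tagged (fun l => (T l * T l)%type) (s, t)).
Local Notation "x ** a" := (cell_action c x a) (at level 40).
Local Notation "<< x , y >>" := (cell_form c x y) (at level 0).
Local Notation e_ t := (cell_vec K t).

Let cB : is_basis cb. Proof. by case: cellA. Qed.
Let starI : algebra_involution star. Proof. by case: cellA. Qed.

(** For an upward closed [P] this is a two-sided ideal stable under [star]. Besides [l < m] and
    [l <= m], the choice [~~ (m <= l)] is used for inductions from the bottom of the poset. *)
Definition ideal_of (P : pred L) (x : A) : Prop :=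
  span_on cb (fun i => P (tag i)) x.

Definition cell_eqm (l : L) (x y : A) : Prop := cell_ideal_gt c l (x - y).

Lemma starD x y : star (x + y) = star x + star y. Proof. by case: starI. Qed.
Lemma starZ k x : star (k *: x) = k *: star x. Proof. by case: starI. Qed.
Lemma starM x y : star (x * y) = star y * star x. Proof. by case: starI. Qed.
Lemma starK x : star (star x) = x. Proof. by case: starI. Qed.
Lemma star0 : star 0 = 0. Proof. by rewrite -(scale0r 0) starZ !scale0r. Qed.
Lemma starB x y : star (x - y) = star x - star y.
Proof. by rewrite starD -scaleN1r starZ scaleN1r. Qed.
Lemma star_sum (J : finType) (P : pred J) (x : J -> A) :
  star (\sum_(j | P j) x j) = \sum_(j | P j) star (x j).
Proof. exact: (big_morph _ starD star0). Qed.

Lemma cell_coefD x y l (s t : T l) : cell_coef c (x + y) s t = cell_coef c x s t + cell_coef c y s t.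
Proof. exact: coordsD. Qed.
Lemma cell_coefB x y l (s t : T l) : cell_coef c (x - y) s t = cell_coef c x s t - cell_coef c y s t.
Proof. exact: coordsB. Qed.
Lemma cell_coefZ k x l (s t : T l) : cell_coef c (k *: x) s t = k * cell_coef c x s t.
Proof. exact: coordsZ. Qed.
Lemma cell_coef_sum (J : finType) (P : pred J) (x : J -> A) l (s t : T l) :
  cell_coef c (\sum_(j | P j) x j) s t = \sum_(j | P j) cell_coef c (x j) s t.
Proof. exact: coords_sum. Qed.
Lemma cell_coef_c l (s t u v : T l) : cell_coef c (c s t) u v = ((u == s) && (v == t))%:R.
Proof.
have -> : c s t = cb (ix s t) by [].
by rewrite /cell_coef coords_base // eq_Tagged /= xpair_eqE.
Qed.

Lemma ideal_coef P x l (s t : T l) : ideal_of P x -> ~~ P l -> cell_coef c x s t = 0.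
Proof. by move=> /(span_onP cB) x0 Pl; apply: x0. Qed.

Lemma ideal_c (P : pred L) l (s t : T l) : P l -> ideal_of P (c s t).
Proof. by move=> Pl; apply: (@span_on_base _ _ _ cb _ (ix s t)). Qed.

Lemma ideal_ofS (P Q : pred L) x : subpred P Q -> ideal_of P x -> ideal_of Q x.
Proof. by move=> PQ; apply: span_onS => i /PQ. Qed.

Lemma eqm_refl l x : cell_eqm l x x.
Proof. by rewrite /cell_eqm subrr; apply: span_on0. Qed.

Lemma eqm_sym l x y : cell_eqm l x y -> cell_eqm l y x.
Proof. by move=> xy; rewrite /cell_eqm -opprB; apply: span_onN. Qed.

Lemma eqm_trans l y x z : cell_eqm l x y -> cell_eqm l y z -> cell_eqm l x z.
Proof.
by move=> xy yz; rewrite /cell_eqm -(subrK y x) -addrA; apply: span_onD.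
Qed.

Lemma eqmD l x y x' y' : cell_eqm l x y -> cell_eqm l x' y' -> cell_eqm l (x + x') (y + y').
Proof. by move=> xy xy'; rewrite /cell_eqm opprD addrACA; apply: span_onD. Qed.

Lemma eqmZ l k x y : cell_eqm l x y -> cell_eqm l (k *: x) (k *: y).
Proof. by move=> xy; rewrite /cell_eqm -scalerBr; apply: span_onZ. Qed.

Lemma eqm_sum l (J : finType) (P : pred J) (x y : J -> A) :
  (forall j, P j -> cell_eqm l (x j) (y j)) ->
  cell_eqm l (\sum_(j | P j) x j) (\sum_(j | P j) y j).
Proof.
by move=> xy; rewrite /cell_eqm -sumrB; apply: span_on_sum.
Qed.

Lemma eqm_coef l x y (s t : T l) : cell_eqm l x y -> cell_coef c x s t = cell_coef c y s t.
Proof.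
move=> /(ideal_coef (P := fun m => (l < m)%O) s t) /=; rewrite ltxx => /(_ isT).
by rewrite cell_coefB => /eqP; rewrite subr_eq0 => /eqP.
Qed.

(** The structure constants do not depend on [s], so they must be the coefficients of [c t t * a] in
    row [t]; this justifies the form of [cell_action]. *)
Lemma cell_mulr_eqm l (s t : T l) a :
  cell_eqm l (c s t * a) (\sum_v cell_coef c (c t t * a) t v *: c s v).
Proof.
case: cellA => _ _ /(_ l t a)[r ra] _.
have rE v : cell_coef c (c t t * a) t v = r v.
  rewrite (eqm_coef t v (ra t)) cell_coef_sum (bigD1 v) //= cell_coefZ cell_coef_c.
  rewrite !eqxx mulr1 big1 ?addr0 //= => u uv.
  by rewrite cell_coefZ cell_coef_c eqxx eq_sym (negPf uv) mulr0.
by under eq_bigr do rewrite rE; apply: ra.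
Qed.

Lemma star_c_eqm l (s t : T l) : cell_eqm l (star (c s t)) (c t s).
Proof. by case: cellA => _ _ _; apply. Qed.

Section Upsets.
Variable P : pred L.
Hypothesis P_up : forall l m, P l -> (l <= m)%O -> P m.

Lemma eqm_ideal l x y : P l -> cell_eqm l x y -> ideal_of P y -> ideal_of P x.
Proof.
move=> Pl xy Py; rewrite -(subrK y x); apply: span_onD => //.
by apply: ideal_ofS xy => m /ltW; apply: P_up.
Qed.

Lemma ideal_mulr x a : ideal_of P x -> ideal_of P (x * a).
Proof.
move=> Px; apply: (span_on_ind (Q := fun x => ideal_of P (x * a)) Px).
- by rewrite mul0r; apply: span_on0.
- by move=> u v Pu Pv; rewrite mulrDl; apply: span_onD.
- by move=> k u Pu; rewrite -scalerAl; apply: span_onZ.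
move=> [l [s t]] /= Pl; apply: (eqm_ideal Pl (cell_mulr_eqm s t a)).
by apply: span_on_sum => v _; apply/span_onZ/ideal_c.
Qed.

Lemma ideal_star x : ideal_of P x -> ideal_of P (star x).
Proof.
move=> Px; apply: (span_on_ind (Q := fun x => ideal_of P (star x)) Px).
- by rewrite star0; apply: span_on0.
- by move=> u v Pu Pv; rewrite starD; apply: span_onD.
- by move=> k u Pu; rewrite starZ; apply: span_onZ.
move=> [l [s t]] /= Pl; apply: (eqm_ideal Pl (star_c_eqm s t)); exact: ideal_c.
Qed.

Lemma ideal_mull x a : ideal_of P x -> ideal_of P (a * x).
Proof.
by move=> Px; rewrite -[_ * _]starK starM; apply/ideal_star/ideal_mulr/ideal_star.
Qed.

End Upsets.

Lemma gt_up (l l' m : L) : (l < l')%O -> (l' <= m)%O -> (l < m)%O.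
Proof. exact: lt_le_trans. Qed.

Lemma eqm_mulr l x y a : cell_eqm l x y -> cell_eqm l (x * a) (y * a).
Proof.
by move=> xy; rewrite /cell_eqm -mulrBl; apply: (ideal_mulr (@gt_up l)).
Qed.

Lemma eqm_mull l x y a : cell_eqm l x y -> cell_eqm l (a * x) (a * y).
Proof.
by move=> xy; rewrite /cell_eqm -mulrBr; apply: (ideal_mull (@gt_up l)).
Qed.

Lemma eqm_star l x y : cell_eqm l x y -> cell_eqm l (star x) (star y).
Proof.
by move=> xy; rewrite /cell_eqm -starB; apply: (ideal_star (@gt_up l)).
Qed.

(* The representative of [x (x) y] under the isomorphism alpha_l. *)
Definition tens (l : L) (x y : cell_module K T l) : A :=
  \sum_s \sum_t ((x s : K) * (y t : K)) *: c s t.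

Lemma cell_vecE l (t v : T l) : (e_ t) v = (v == t)%:R. Proof. by rewrite ffunE. Qed.

Lemma cell_modD l (x y : cell_module K T l) t : (x + y) t = x t + y t :> K.
Proof. by rewrite ffunE. Qed.
Lemma cell_modZ l k (x : cell_module K T l) t : (k *: x) t = k * x t :> K.
Proof. by rewrite ffunE. Qed.
Lemma cell_modB l (x y : cell_module K T l) t : (x - y) t = x t - y t :> K.
Proof. by rewrite !ffunE. Qed.
Lemma cell_mod0 l t : (0 : cell_module K T l) t = 0 :> K.
Proof. by rewrite ffunE. Qed.
Lemma cell_mod_sum (J : finType) (P : pred J) l (x : J -> cell_module K T l) t :
  (\sum_(j | P j) x j) t = \sum_(j | P j) x j t :> K.
Proof. by rewrite sum_ffunE. Qed.

Lemma cell_module_sum l (x : cell_module K T l) : x = \sum_t (x t : K) *: e_ t.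
Proof.
apply/ffunP => v; rewrite sum_ffunE (bigD1 v) //= !ffunE eqxx.
rewrite [_ *: _]mulr1 big1 ?addr0 // => u uv.
by rewrite !ffunE eq_sym (negPf uv) [_ *: _]mulr0.
Qed.

Lemma tens_vec l (s t : T l) : tens (e_ s) (e_ t) = c s t.
Proof.
rewrite /tens (bigD1 s) //= (bigD1 t) //= !ffunE !eqxx mulr1 scale1r.
rewrite big1 ?addr0 => [|u ut]; last by rewrite !ffunE (negPf ut) mulr0 scale0r.
rewrite big1 ?addr0 // => u us; rewrite big1 // => v _.
by rewrite !ffunE (negPf us) mul0r scale0r.
Qed.

Lemma tensDl l (x x' y : cell_module K T l) : tens (x + x') y = tens x y + tens x' y.
Proof.
rewrite /tens -big_split; apply: eq_bigr => s _; rewrite -big_split.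
by apply: eq_bigr => t _; rewrite ffunE mulrDl scalerDl.
Qed.

Lemma tensDr l (x y y' : cell_module K T l) : tens x (y + y') = tens x y + tens x y'.
Proof.
rewrite /tens -big_split; apply: eq_bigr => s _; rewrite -big_split.
by apply: eq_bigr => t _; rewrite ffunE mulrDr scalerDl.
Qed.

Lemma tensZl l k (x y : cell_module K T l) : tens (k *: x) y = k *: tens x y.
Proof.
rewrite /tens scaler_sumr; apply: eq_bigr => s _; rewrite scaler_sumr.
by apply: eq_bigr => t _; rewrite ffunE scalerA mulrA.
Qed.

Lemma tensZr l k (x y : cell_module K T l) : tens x (k *: y) = k *: tens x y.
Proof.
rewrite /tens scaler_sumr; apply: eq_bigr => s _; rewrite scaler_sumr.
by apply: eq_bigr => t _; rewrite ffunE scalerA mulrCA.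
Qed.

Lemma tens0l l (y : cell_module K T l) : tens 0 y = 0.
Proof. by rewrite -(scale0r 0) tensZl scale0r. Qed.

Lemma tens0r l (x : cell_module K T l) : tens x 0 = 0.
Proof. by rewrite -(scale0r 0) tensZr scale0r. Qed.

Lemma tens_suml l (J : finType) (P : pred J) (x : J -> cell_module K T l) y :
  tens (\sum_(j | P j) x j) y = \sum_(j | P j) tens (x j) y.
Proof. by apply: (big_morph (fun x => tens x y)) => [u v|]; rewrite ?tensDl ?tens0l. Qed.

Lemma tens_sumr l (J : finType) (P : pred J) x (y : J -> cell_module K T l) :
  tens x (\sum_(j | P j) y j) = \sum_(j | P j) tens x (y j).
Proof. by apply: (big_morph (tens x)) => [u v|]; rewrite ?tensDr ?tens0r. Qed.

Lemma tens_coef l (x y : cell_module K T l) u v : cell_coef c (tens x y) u v = x u * y v.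
Proof.
rewrite /tens cell_coef_sum (bigD1 u) //= cell_coef_sum (bigD1 v) //=.
rewrite cell_coefZ cell_coef_c !eqxx mulr1.
rewrite big1 ?addr0 => [|w wv]; last first.
  by rewrite cell_coefZ cell_coef_c [v == _]eq_sym (negPf wv) andbF mulr0.
rewrite big1 ?addr0 // => w wu; rewrite cell_coef_sum big1 // => t _.
by rewrite cell_coefZ cell_coef_c [u == _]eq_sym (negPf wu) mulr0.
Qed.

Lemma tens_ge l (x y : cell_module K T l) : ideal_of (fun m => l <= m)%O (tens x y).
Proof.
by do 2!apply: span_on_sum => ? _; apply/span_onZ/ideal_c.
Qed.

Lemma tens_eqm_coef l (x y x' y' : cell_module K T l) u v :
  cell_eqm l (tens x y) (tens x' y') -> x u * y v = x' u * y' v :> K.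
Proof. by move=> /(eqm_coef u v); rewrite !tens_coef. Qed.

Lemma act_vec l (t v : T l) a : (e_ t ** a) v = cell_coef c (c t t * a) t v.
Proof.
rewrite ffunE (bigD1 t) //= ffunE eqxx mul1r big1 ?addr0 // => u ut.
by rewrite ffunE (negPf ut) mul0r.
Qed.

Lemma actDl l (x y : cell_module K T l) a : (x + y) ** a = x ** a + y ** a.
Proof.
apply/ffunP => v; rewrite !ffunE -big_split; apply: eq_bigr => t _.
by rewrite ffunE mulrDl.
Qed.

Lemma actZl l k (x : cell_module K T l) a : (k *: x) ** a = k *: (x ** a).
Proof.
apply/ffunP => v; rewrite !ffunE [RHS]mulr_sumr; apply: eq_bigr => t _.
by rewrite ffunE mulrA.
Qed.

Lemma actDr l (x : cell_module K T l) a b : x ** (a + b) = x ** a + x ** b.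
Proof.
apply/ffunP => v; rewrite !ffunE -big_split; apply: eq_bigr => t _.
by rewrite mulrDr cell_coefD mulrDr.
Qed.

Lemma actZr l k (x : cell_module K T l) a : x ** (k *: a) = k *: (x ** a).
Proof.
apply/ffunP => v; rewrite !ffunE [RHS]mulr_sumr; apply: eq_bigr => t _.
by rewrite -scalerAr cell_coefZ mulrCA.
Qed.

Lemma act0l l a : (0 : cell_module K T l) ** a = 0.
Proof. by rewrite -(scale0r 0) actZl !scale0r. Qed.

Lemma act0r l (x : cell_module K T l) : x ** 0 = 0.
Proof. by have := actZr 0 x 0; rewrite !scale0r. Qed.

Lemma actBr l (x : cell_module K T l) a b : x ** (a - b) = x ** a - x ** b.
Proof. by rewrite actDr; have := actZr (-1) x b; rewrite !scaleN1r => ->. Qed.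

Lemma act_suml l (J : finType) (P : pred J) (x : J -> cell_module K T l) a :
  (\sum_(j | P j) x j) ** a = \sum_(j | P j) x j ** a.
Proof.
by apply: (big_morph (fun x => x ** a)) => [u v|]; rewrite ?actDl ?act0l.
Qed.

Lemma act_sumr l (J : finType) (P : pred J) (x : cell_module K T l) (a : J -> A) :
  x ** (\sum_(j | P j) a j) = \sum_(j | P j) x ** a j.
Proof. by apply: (big_morph (cell_action c x)) => [u v|]; rewrite ?actDr ?act0r. Qed.

(** Modulo more dominant cells the algebra acts from the right on the second factor only, and by
    [tens_mull] from the left on the first. Module identities can thus be read off from products in
    [A]. *)
Lemma tens_mulr l (x y : cell_module K T l) a : cell_eqm l (tens x y * a) (tens x (y ** a)).
Proof.
rewrite [X in tens X _ * _]cell_module_sum [X in tens X (_ ** _)]cell_module_sum.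
rewrite !tens_suml mulr_suml; apply: eqm_sum => s _; rewrite !tensZl -scalerAl; apply: eqmZ.
rewrite [y]cell_module_sum act_suml !tens_sumr mulr_suml; apply: eqm_sum => t _.
rewrite actZl !tensZr -scalerAl; apply: eqmZ; rewrite tens_vec.
apply: eqm_trans (cell_mulr_eqm s t a) _.
rewrite [X in tens _ X]cell_module_sum tens_sumr; apply: eqm_sum => v _.
by rewrite tensZr tens_vec act_vec; apply: eqm_refl.
Qed.

Lemma tens_star l (x y : cell_module K T l) : cell_eqm l (star (tens x y)) (tens y x).
Proof.
rewrite /tens [X in cell_eqm _ _ X]exchange_big star_sum; apply: eqm_sum => s _.
rewrite star_sum; apply: eqm_sum => t _; rewrite starZ mulrC; apply: eqmZ.
exact: star_c_eqm.
Qed.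

Lemma tens_mull l (x y : cell_module K T l) a :
  cell_eqm l (a * tens x y) (tens (x ** star a) y).
Proof.
rewrite -[_ * _]starK starM.
apply: eqm_trans (eqm_star (eqm_mulr _ (tens_star _ _))) _.
exact: eqm_trans (eqm_star (tens_mulr _ _ _)) (tens_star _ _).
Qed.

(** Associativity of [A], seen through tensors with first factor [e_ v], whose coefficient 1 at [v]
    lets the second factor be recovered. *)
Lemma actM l (x : cell_module K T l) a b : x ** (a * b) = (x ** a) ** b.
Proof.
apply/ffunP => v.
have : cell_eqm l (tens (e_ v) (x ** (a * b))) (tens (e_ v) ((x ** a) ** b)).
  apply: eqm_trans (eqm_sym (tens_mulr _ _ _)) _; rewrite mulrA.
  apply: eqm_trans (eqm_mulr _ (tens_mulr _ _ _)) _; exact: tens_mulr.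
by move/(tens_eqm_coef v v); rewrite !ffunE eqxx !mul1r.
Qed.

Lemma act1 l (x : cell_module K T l) : x ** 1 = x.
Proof.
apply/ffunP => v.
have : cell_eqm l (tens (e_ v) (x ** 1)) (tens (e_ v) x).
  by apply: eqm_trans (eqm_sym (tens_mulr _ _ _)) _; rewrite mulr1; apply: eqm_refl.
by move/(tens_eqm_coef v v); rewrite ffunE eqxx !mul1r.
Qed.

Lemma act_ideal (P : pred L) l (x : cell_module K T l) a :
  (forall l m, P l -> (l <= m)%O -> P m) -> ideal_of P a -> ~~ P l -> x ** a = 0.
Proof.
move=> Pup Pa Pl; apply/ffunP => v.
have : cell_eqm l (tens (e_ v) x * a) (tens (e_ v) (x ** a)) by apply: tens_mulr.
move=> /(eqm_coef v v); rewrite tens_coef ffunE eqxx mul1r => <-.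
by rewrite (ideal_coef _ _ (ideal_mull Pup _ Pa) Pl) ffunE.
Qed.

Lemma form_vec l (t u : T l) : << e_ t, e_ u >> = cell_coef c (c t t * c u u) t u.
Proof.
rewrite /cell_form (bigD1 t) //= (bigD1 u) //= !ffunE !eqxx !mul1r.
rewrite big1 ?addr0 => [|w wu]; last by rewrite !ffunE (negPf wu) mulr0 mul0r.
rewrite big1 ?addr0 // => w wt; rewrite big1 // => v _.
by rewrite !ffunE (negPf wt) !mul0r.
Qed.

Lemma cform_addl l (x x' y : cell_module K T l) : << x + x', y >> = << x, y >> + << x', y >>.
Proof.
rewrite /cell_form -big_split; apply: eq_bigr => t _; rewrite -big_split.
by apply: eq_bigr => u _; rewrite ffunE !mulrDl.
Qed.

Lemma cform_scalel l k (x y : cell_module K T l) : << k *: x, y >> = k * << x, y >>.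
Proof.
rewrite /cell_form mulr_sumr; apply: eq_bigr => t _; rewrite mulr_sumr.
by apply: eq_bigr => u _; rewrite ffunE !mulrA.
Qed.

Lemma cform_addr l (x y y' : cell_module K T l) : << x, y + y' >> = << x, y >> + << x, y' >>.
Proof.
rewrite /cell_form -big_split; apply: eq_bigr => t _; rewrite -big_split.
by apply: eq_bigr => u _; rewrite ffunE mulrDr !mulrDl.
Qed.

Lemma cform_scaler l k (x y : cell_module K T l) : << x, k *: y >> = k * << x, y >>.
Proof.
rewrite /cell_form mulr_sumr; apply: eq_bigr => t _; rewrite mulr_sumr.
by apply: eq_bigr => u _; rewrite ffunE mulrCA !mulrA.
Qed.

Lemma cform0l l (y : cell_module K T l) : << 0, y >> = 0.
Proof. by rewrite -(scale0r 0) cform_scalel mul0r. Qed.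

Lemma cform0r l (x : cell_module K T l) : << x, 0 >> = 0.
Proof. by rewrite -(scale0r 0) cform_scaler mul0r. Qed.

Lemma cform_suml l (J : finType) (x : J -> cell_module K T l) y :
  << \sum_j x j, y >> = \sum_j << x j, y >>.
Proof.
by apply: (big_morph (fun x => << x, y >>)) => [u v|]; rewrite ?cform_addl ?cform0l.
Qed.

Lemma cform_sumr l (J : finType) x (y : J -> cell_module K T l) :
  << x, \sum_j y j >> = \sum_j << x, y j >>.
Proof.
by apply: (big_morph (fun y => << x, y >>)) => [u v|]; rewrite ?cform_addr ?cform0r.
Qed.

(** Within the cell, [tens_mulr] confines the product to row [s] and [tens_mull] to column [v]. One
    coefficient remains, and it depends on neither [s] nor [v], so [cell_form] may read it off at
    any place. *)
Lemma mul_c_eqm l (s t u v : T l) : cell_eqm l (c s t * c u v) (<< e_ t, e_ u >> *: c s v).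
Proof.
rewrite form_vec.
have Er (s' t' u' v' w w' : T l) : cell_coef c (c s' t' * c u' v') w w' =
    (w == s')%:R * (e_ t' ** c u' v') w'.
  have := tens_mulr (e_ s') (e_ t') (c u' v'); rewrite tens_vec.
  by move/(eqm_coef w w') => ->; rewrite tens_coef ffunE.
have El (s' t' u' v' w w' : T l) : cell_coef c (c s' t' * c u' v') w w' =
    (e_ u' ** star (c s' t')) w * (w' == v')%:R.
  have := tens_mull (e_ u') (e_ v') (c s' t'); rewrite tens_vec.
  by move/(eqm_coef w w') => ->; rewrite tens_coef [(e_ v') w']ffunE.
have -> : cell_coef c (c t t * c u u) t u = cell_coef c (c s t * c u v) s v.
  transitivity (cell_coef c (c s t * c u u) s u); first by rewrite !Er !eqxx.
  by rewrite !El !eqxx.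
have := tens_mulr (e_ s) (e_ t) (c u v); rewrite tens_vec => /eqm_trans; apply.
rewrite [X in tens _ X]cell_module_sum tens_sumr (bigD1 v) //= big1 ?addr0.
  by rewrite tensZr tens_vec Er eqxx mul1r; apply: eqm_refl.
move=> w wv; have := Er s t u v s w; rewrite El (negPf wv) mulr0 eqxx mul1r.
by rewrite tensZr => <-; rewrite scale0r.
Qed.

Lemma tens_mul l (x y z w : cell_module K T l) :
  cell_eqm l (tens x y * tens z w) (<< y, z >> *: tens x w).
Proof.
rewrite [X in tens X _ * _]cell_module_sum [X in _ *: tens X _]cell_module_sum !tens_suml.
rewrite mulr_suml scaler_sumr; apply: eqm_sum => s _.
rewrite !tensZl -scalerAl scalerA mulrC -scalerA; apply: eqmZ.
rewrite [w]cell_module_sum !tens_sumr mulr_sumr scaler_sumr; apply: eqm_sum => v _.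
rewrite !tensZr -scalerAr scalerA mulrC -scalerA; apply: eqmZ.
rewrite [y]cell_module_sum tens_sumr mulr_suml cform_suml scaler_suml; apply: eqm_sum => t _.
rewrite tensZr -scalerAl cform_scalel -scalerA; apply: eqmZ.
rewrite [z]cell_module_sum tens_suml mulr_sumr cform_sumr scaler_suml; apply: eqm_sum => u _.
rewrite tensZl -scalerAr cform_scaler -scalerA; apply: eqmZ.
by rewrite !tens_vec; apply: mul_c_eqm.
Qed.

(** Applying [star] to [c t t * c u u] reverses the factors and transposes the cell. *)
Lemma form_sym l (x y : cell_module K T l) : << x, y >> = << y, x >>.
Proof.
rewrite [x]cell_module_sum [y]cell_module_sum !cform_suml.
under eq_bigr do rewrite cform_scalel cform_sumr mulr_sumr.
rewrite exchange_big; apply: eq_bigr => u _; rewrite cform_scalel cform_sumr mulr_sumr.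
apply: eq_bigr => t _; rewrite !cform_scaler mulrCA; congr (_ * (_ * _)).
have : cell_eqm l (star (c t t * c u u)) (<< e_ t, e_ u >> *: c u t).
  by apply: eqm_trans (eqm_star (mul_c_eqm _ _ _ _)) _; rewrite starZ; apply/eqmZ/star_c_eqm.
rewrite starM => /eqm_sym tu.
have := eqm_trans (eqm_mull (star (c u u)) (star_c_eqm t t)) (eqm_mulr (c t t) (star_c_eqm u u)).
move=> /(eqm_trans tu)/eqm_trans/(_ (mul_c_eqm _ _ _ _)) /(eqm_coef u t).
by rewrite !cell_coefZ cell_coef_c !eqxx !mulr1.
Qed.

(** A tensor acts on its own cell module as an operator of rank at most one; this links faithfulness
    to nondegeneracy of the form. *)
Lemma act_tens l (x y z : cell_module K T l) : z ** tens x y = << z, x >> *: y.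
Proof.
apply/ffunP => v.
have : cell_eqm l (tens (e_ v) (z ** tens x y)) (tens (e_ v) (<< z, x >> *: y)).
  apply: eqm_trans (eqm_sym (tens_mulr _ _ _)) _; rewrite tensZr; exact: tens_mul.
by move/(tens_eqm_coef v v); rewrite ffunE eqxx !mul1r.
Qed.

(** In [tens e_t x * a * tens y e_t] the element [a] can be absorbed into either neighbour. So
    [star] is the adjoint for the form. *)
Lemma form_act l (x y : cell_module K T l) a : << x ** a, y >> = << x, y ** star a >>.
Proof.
have [t _|T0] := pickP (fun _ : T l => true); last first.
  by rewrite /cell_form !big1 // => t; have := T0 t.
have : cell_eqm l (<< x ** a, y >> *: tens (e_ t) (e_ t)) (<< x, y ** star a >> *: tens (e_ t) (e_ t)).
  apply: eqm_trans (eqm_sym (tens_mul _ _ _ _)) _.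
  apply: eqm_trans (eqm_mulr _ (eqm_sym (tens_mulr _ _ _))) _; rewrite -mulrA.
  exact: eqm_trans (eqm_mull _ (tens_mull _ _ _)) (tens_mul _ _ _ _).
by move/(eqm_coef t t); rewrite !cell_coefZ tens_coef ffunE eqxx !mulr1.
Qed.

End CellularTheory.

(** Von Neumann regularity, the consequence of semisimplicity from which nondegeneracy of the cell
    forms follows. *)
Definition regular_ring (A : pzRingType) : Prop := forall a : A, exists b, a = a * b * a.

Lemma split_semisimple_regular (F : fieldType) (A : algType F) :
  split_semisimple A -> regular_ring A.
Proof.
move=> [I [n [h hB]]] a; have [b [hb _]] := hB (fun i => pinvmx (h i a)).
have [a' [_ a'U]] := hB (fun i => h i a); exists b.
transitivity a'; first by apply/esym/a'U.
apply: a'U => i; rewrite !rmorphM /= hb.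
by apply: mulmxKpV.
Qed.

(** * Matrix units and semisimple cellular algebras *)

Section MatrixUnitBlocks.
Context (F : fieldType) (B : algType F) (L : finType) (T : L -> finType).
Context (E : forall l, T l -> T l -> B).
Hypothesis Emu : matrix_units E.

Local Notation ix s t := (Tagged (fun l => (T l * T l)%type) (s, t)).

Definition mu_block (l : L) : B := \sum_(s : T l) E s s.

Lemma muE l (s t u v : T l) : E s t * E u v = if t == u then E s v else 0.
Proof. by case: Emu => + _; apply. Qed.

Lemma mu0 l m (s t : T l) (u v : T m) : l != m -> E s t * E u v = 0.
Proof. by case: Emu => _; apply. Qed.

Lemma mu_block_l l (s t : T l) : mu_block l * E s t = E s t.
Proof.
rewrite mulr_suml (bigD1 s) //= muE eqxx big1 ?addr0 // => u us.
by rewrite muE (negPf us).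
Qed.

Lemma mu_block_r l (s t : T l) : E s t * mu_block l = E s t.
Proof.
rewrite mulr_sumr (bigD1 t) //= muE eqxx big1 ?addr0 // => u us.
by rewrite muE eq_sym (negPf us).
Qed.

Lemma mu_block0l l m (s t : T m) : l != m -> mu_block l * E s t = 0.
Proof. by move=> lm; rewrite mulr_suml big1 // => u _; rewrite mu0. Qed.

Lemma mu_block0r l m (s t : T m) : l != m -> E s t * mu_block l = 0.
Proof. by move=> lm; rewrite mulr_sumr big1 // => u _; rewrite mu0 // eq_sym. Qed.

(** Multiplying a relation by [E s s] on the left and [E t t] on the right isolates one term, and
    [E s t] is nonzero since [E s t * E t s = E s s]. *)
Lemma mu_free : (forall l (s : T l), E s s != 0) ->
  forall k, \sum_i k i *: cell_basis E i = 0 -> forall i, k i = 0.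
Proof.
move=> E0 k kE [l [s t]].
have : k (ix s t) *: E s t = 0.
  transitivity (E s s * (\sum_i k i *: cell_basis E i) * E t t); last first.
    by rewrite kE mulr0 mul0r.
  rewrite mulr_sumr mulr_suml (bigD1 (ix s t)) //= -scalerAr -scalerAl.
  rewrite /cell_basis /= muE eqxx muE eqxx big1 ?addr0 // => -[m [u v]] /= uv.
  rewrite -scalerAr -scalerAl; have [ml|ml] := eqVneq l m; last by rewrite mu0 // mul0r scaler0.
  subst m; rewrite muE; case: eqP => [su|]; last by rewrite mul0r scaler0.
  rewrite muE; case: eqP => [vt|]; last by rewrite scaler0.
  by subst u v; rewrite eqxx in uv.
move/eqP; rewrite scaler_eq0 => /orP[/eqP //|/eqP E0'].
by have := E0 _ s; have := muE s t t s; rewrite eqxx => <-; rewrite E0' mul0r eqxx.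
Qed.

Hypothesis EB : is_basis (cell_basis E).

Lemma mu_basis_ind (P : B -> Prop) : P 0 -> (forall x y, P x -> P y -> P (x + y)) ->
  (forall k x, P x -> P (k *: x)) -> (forall l (s t : T l), P (E s t)) -> forall x, P x.
Proof.
move=> P0 PD PZ PE x; rewrite (coordsE EB x); elim/big_ind: _ => // i _; exact/PZ/PE.
Qed.

Lemma mu_sum1 : \sum_l mu_block l = 1.
Proof.
suff Px (x : B) : (\sum_l mu_block l) * x = x by rewrite -[LHS]mulr1.
move: x; apply: mu_basis_ind => [|x y Px Py|k x Px|l s t].
- by rewrite mulr0.
- by rewrite mulrDr Px Py.
- by rewrite -scalerAr Px.
- rewrite mulr_suml (bigD1 l) //= mu_block_l big1 ?addr0 // => m ml.
  by rewrite mu_block0l.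
Qed.

Lemma mu_complete : complete_matrix_units E.
Proof. by split=> //; apply: mu_sum1. Qed.

Lemma mu_block_central l : central_idempotent (mu_block l).
Proof.
split.
  by rewrite {2}/mu_block mulr_sumr; apply: eq_bigr => s _; rewrite mu_block_l.
apply: mu_basis_ind => [|x y Px Py|k x Px|m s t].
- by rewrite mulr0 mul0r.
- by rewrite mulrDr mulrDl Px Py.
- by rewrite -scalerAr -scalerAl Px.
- have [lm|lm] := eqVneq l m; last by rewrite mu_block0l // mu_block0r.
  by subst m; rewrite mu_block_l mu_block_r.
Qed.

Lemma mu_corner l (s : T l) x : exists k : F, E s s * x * E s s = k *: E s s.
Proof.
move: x; apply: mu_basis_ind => [|x y [k Px] [k' Py]|k x [k' Px]|m u v].
- by exists 0; rewrite mulr0 mul0r scale0r.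
- by exists (k + k'); rewrite mulrDr mulrDl Px Py scalerDl.
- by exists (k * k'); rewrite -scalerAr -scalerAl Px scalerA.
- have [lm|lm] := eqVneq l m; last by exists 0; rewrite mu0 // mul0r scale0r.
  subst m; exists ((s == u) && (v == s))%:R; rewrite muE.
  case: eqP => [_|_]; last by rewrite mul0r scale0r.
  by rewrite muE; case: eqP => _; rewrite ?scale1r ?scale0r.
Qed.

Lemma mu_block_neq0 l (s : T l) : mu_block l != 0.
Proof.
apply/eqP => e0; have := base_neq0 EB (ix s s).
by rewrite /cell_basis /= -mu_block_l e0 mul0r eqxx.
Qed.

(** The corner at [E s s] is one-dimensional, so a central idempotent below the block is [k] times
    the block with [k * k = k]. *)
Lemma mu_block_minimal l (s : T l) : minimal_central_idempotent (mu_block l).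
Proof.
split; [exact: mu_block_neq0 s | exact: mu_block_central | move=> e [ee eC] el].
have [k kE] := mu_corner s e.
have ek : e = k *: mu_block l.
  rewrite -el {1}/mu_block mulr_sumr scaler_sumr; apply: eq_bigr => t _.
  transitivity (E t s * (E s s * e * E s s) * E s t).
    by rewrite -eC !mulrA -eC -!mulrA muE eqxx muE eqxx muE eqxx.
  by rewrite kE -scalerAr -scalerAl !muE !eqxx muE eqxx.
have /eqP : k * k *: mu_block l = k *: mu_block l.
  have [ll _] := mu_block_central l.
  by rewrite -[in RHS]ek -ee ek -scalerAl -scalerAr scalerA ll.
rewrite -subr_eq0 -scalerBl scaler_eq0 (negPf (mu_block_neq0 s)) orbF.
rewrite -[X in _ - X]mulr1 -mulrBr mulf_eq0 subr_eq0 => /orP[/eqP k0|/eqP k1].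
  by left; rewrite ek k0 scale0r.
by right; rewrite ek k1 scale1r.
Qed.

(** The chosen idempotent and the block are both minimal, and their product acts as the identity, so
    it is nonzero and equals each of them. The condition [act x0 0 <> x0] expresses that the module
    is nonzero, with no module structure on [M]. *)
Lemma mu_block_idempotent (M : Type) (act : M -> B -> M) l (s : T l) (x0 : M) :
  (forall x a b, act (act x a) b = act x (a * b)) ->
  (forall x, act x (mu_block l) = x) -> act x0 0 <> x0 ->
  block_idempotent act = mu_block l.
Proof.
move=> actA act_l x00; rewrite /block_idempotent; case: xgetP => [z _ [[z0 [zz zC] zmin] zact]|].
  have [_ [ll lC] lmin] := mu_block_minimal s.
  have zl0 : z * mu_block l <> 0.
    by move=> zl; apply: x00; rewrite -zl -actA zact act_l.
  have zlC : central_idempotent (z * mu_block l).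
    split; last by move=> b; rewrite -mulrA lC mulrA zC mulrA.
    by rewrite -mulrA [mu_block l * _]mulrA -zC -mulrA ll mulrA zz.
  case: (zmin _ zlC) => // [|zlz]; first by rewrite -zC mulrA zz.
  case: (lmin _ zlC) => // [|zll]; first by rewrite -mulrA ll.
  by rewrite -zlz.
by move=> /(_ (mu_block l)) []; split=> //; apply: mu_block_minimal s.
Qed.

End MatrixUnitBlocks.

(** * Nondegenerate forms and faithful cell modules *)

Section SemisimpleCellular.
Context (disp : Order.disp_t) (F : fieldType) (A : algType F).
Context (L : finPOrderType disp) (T : L -> finType).
Context (c : forall l, T l -> T l -> A) (star : A -> A).
Hypothesis cellA : cell_datum c star.
Hypothesis regA : regular_ring A.

Local Notation cb := (cell_basis c).
Local Notation ix s t := (Tagged (fun l => (T l * T l)%type) (s, t)).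
Local Notation "x ** a" := (cell_action c x a) (at level 40).
Local Notation "<< x , y >>" := (cell_form c x y) (at level 0).
Local Notation e_ t := (cell_vec F t).

Let cB : is_basis cb. Proof. by case: cellA. Qed.

(* If y is in the radical and a represents x (x) y, then a = a b a lies in the *)
(* ideal below, because the inner form value < y b, x > vanishes.              *)
Lemma form_nondegenerate l (y : cell_module F T l) : (forall z, << y, z >> = 0) -> y = 0.
Proof.
move=> y0; apply/ffunP => v; have [b aE] := regA (tens c (e_ v) y).
have : cell_eqm c l (tens c (e_ v) y) (0 *: tens c (e_ v) y).
  rewrite {1}aE -(y0 (e_ v ** star b)) -(form_act cellA).
  exact: eqm_trans (eqm_mulr cellA _ (tens_mulr cellA _ _ _)) (tens_mul cellA _ _ _ _).
by rewrite -(tensZr c) scale0r => /(tens_eqm_coef cellA v v); rewrite !ffunE eqxx !mul1r.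
Qed.

(** Induction on the number of labels below [l]. Once the coefficients below [l] vanish, [a] acts on
    the cell module of [l] as [B], its part in that cell. By [act_tens] this action is expressed
    through the form, whose nondegeneracy kills the coefficients. *)
Lemma cell_faithful a : (forall l (x : cell_module F T l), x ** a = 0) -> a = 0.
Proof.
move=> a0; suff a_coef n l : (#|[pred m : L | (m < l)%O]| < n)%N ->
    forall s t : T l, cell_coef c a s t = 0.
  apply: (coords_inj cB) => -[l [s t]]; rewrite coords0 //.
  exact: (a_coef (#|[pred m : L | (m < l)%O]|).+1).
elim: n l => // n IHn l; rewrite ltnS => ln.
pose y u : cell_module F T l := [ffun v => cell_coef c a u v].
pose B := \sum_u tens c (e_ u) (y u).
have BE (s t : T l) : cell_coef c B s t = cell_coef c a s t.
  rewrite (cell_coef_sum cellA) (bigD1 s) //= (tens_coef cellA) !ffunE eqxx mul1r.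
  rewrite big1 ?addr0 // => u us; rewrite (tens_coef cellA) !ffunE.
  by rewrite eq_sym (negPf us) mul0r.
have aB : ideal_of c (fun m => ~~ (m <= l)%O) (a - B).
  apply/(span_onP cB) => -[m [s t]]; rewrite negbK /= le_eqVlt.
  rewrite -[coords _ _ _]/(cell_coef c (a - B) s t) (cell_coefB cellA).
  case/orP => [/eqP ml|ml]; first by subst m; rewrite BE subrr.
  rewrite (IHn m) ?sub0r; last first.
    apply: leq_trans ln; apply: proper_card; apply/properP; split.
      by apply/fintype.subsetP => m'; rewrite !inE => /lt_trans; apply.
    by exists m; rewrite !inE ?ltxx.
  rewrite (cell_coef_sum cellA) big1 ?oppr0 // => u _.
  apply: (ideal_coef cellA _ _ (tens_ge c (e_ u) (y u))); by rewrite lt_geF.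
have actB (x : cell_module F T l) : \sum_u << x, e_ u >> *: y u = 0.
  transitivity (x ** B); first by rewrite (act_sumr cellA) //; apply: eq_bigr => u _; rewrite (act_tens cellA).
  rewrite -[RHS](a0 l x) -[a in RHS](subrK B) (actDr cellA).
  rewrite (act_ideal (P := fun m => ~~ (m <= l)%O) cellA _ _ aB) ?add0r ?lexx //.
  by move=> m m' /negP ml mm'; apply/negP => m'l; apply: ml; apply: le_trans m'l.
(* [z] is column [t] of the coefficient matrix; [actB] makes it orthogonal to every vector. *)
move=> s t; pose z : cell_module F T l := \sum_u ((y u t : F) *: e_ u).
suff : z = 0.
  move/ffunP => /(_ s); rewrite sum_ffunE (bigD1 s) //= !ffunE eqxx.
  rewrite [_ *: _]mulr1 big1 ?addr0 // => u us.
  by rewrite !ffunE eq_sym (negPf us) [_ *: _]mulr0.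
apply: form_nondegenerate => x; rewrite (form_sym cellA) cform_sumr.
transitivity ((\sum_u << x, e_ u >> *: y u) t); last by rewrite actB ffunE.
rewrite sum_ffunE; apply: eq_bigr => u _; rewrite cform_scaler mulrC.
by rewrite [in RHS]ffunE.
Qed.

(** The map [Th] to families of matrices is injective by faithfulness, and both sides have bases
    indexed by [cell_index T], so it is onto. This is the Wedderburn decomposition with the cell
    modules as blocks. *)
Lemma cell_action_surj (g : forall l, T l -> T l -> F) :
  exists a, forall l (s t : T l), (e_ s ** a) t = g l s t.
Proof.
pose W : lmodType F := {ffun cell_index T -> F^o}.
pose Th a : W := [ffun i => (cell_vec F (tagged i).1 ** a) (tagged i).2].
pose dl i : W := [ffun j => (j == i)%:R].
have dlE (x : W) : x = \sum_i (x i : F) *: dl i.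
  apply/ffunP => v; rewrite sum_ffunE (bigD1 v) //= !ffunE eqxx.
  rewrite [_ *: _]mulr1 big1 ?addr0 // => u uv.
  by rewrite !ffunE eq_sym (negPf uv) [_ *: _]mulr0.
have dlB : is_basis dl.
  apply/is_basisP; split=> [x|k]; first by exists x; apply: dlE.
  pose x : W := [ffun i => k i].
  have -> : \sum_i k i *: dl i = x.
    by rewrite [RHS]dlE; apply: eq_bigr => i _; rewrite ffunE.
  by move/ffunP => x0 i; have := x0 i; rewrite !ffunE.
have Th_sum (k : cell_index T -> F) : Th (\sum_i k i *: cb i) = \sum_i k i *: Th (cb i).
  apply/ffunP => i; rewrite ffunE (act_sumr cellA) // !sum_ffunE; apply: eq_bigr => j _.
  by rewrite (actZr cellA) // !ffunE.
have /is_basisP[ThB _] : is_basis (fun i => Th (cb i)).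
  apply: free_same_size_basis dlB _ => k; rewrite -Th_sum => /ffunP Th0.
  have : \sum_i k i *: cb i = 0.
    apply: cell_faithful => l x; rewrite [x]cell_module_sum act_suml big1 // => s _.
    rewrite actZl; set y := _ ** _; suff -> : y = 0 by rewrite scaler0.
    by apply/ffunP => t; have := Th0 (ix s t); rewrite !ffunE.
  by case/is_basisP: cB => _; apply.
have [k gE] := ThB [ffun i => g (tag i) (tagged i).1 (tagged i).2].
exists (\sum_i k i *: cb i) => l s t.
have := congr1 (fun x : W => x (ix s t)) gE; rewrite -Th_sum.
by rewrite [LHS]ffunE [RHS]ffunE /= => ->.
Qed.

Lemma cell_inj a b : (forall l (s : T l), e_ s ** a = e_ s ** b) -> a = b.
Proof.
move=> ab; apply/eqP; rewrite -subr_eq0; apply/eqP/cell_faithful => l x.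
rewrite [x]cell_module_sum act_suml big1 // => s _.
by rewrite actZl (actBr cellA) ab subrr scaler0.
Qed.

Lemma cell_matrix_units : exists E : forall l, T l -> T l -> A,
  [/\ complete_matrix_units E,
      forall l (s t u : T l), e_ u ** E l s t = (u == s)%:R *: e_ t &
      forall l m (s t : T l) (u : T m), l != m -> e_ u ** E l s t = 0].
Proof.
pose g l (s t : T l) m (u v : T m) : F := (ix u v == ix s t)%:R.
pose E l (s t : T l) := xget 0 [set a | forall m (u v : T m), (e_ u ** a) v = g l s t m u v]%classic.
have EP l (s t : T l) m (u v : T m) : (e_ u ** E l s t) v = g l s t m u v.
  have [a aP] := cell_action_surj (g l s t).
  by rewrite /E; case: xgetP => [b _ bP|/(_ a)/(_ aP)//]; apply: bP.
have EA l (s t u : T l) : e_ u ** E l s t = (u == s)%:R *: e_ t.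
  apply/ffunP => v; rewrite EP !ffunE /g eq_Tagged /= xpair_eqE.
  by do 2!case: eqP => _; rewrite /= ?scale1r ?scale0r.
have EA0 l m (s t : T l) (u : T m) : l != m -> e_ u ** E l s t = 0.
  move=> lm; apply/ffunP => v; rewrite EP ffunE /g; case: eqP => // /(congr1 tag) /= ml.
  by rewrite ml eqxx in lm.
have Emu : matrix_units E.
  split=> [l s t u v|l m s t u v lm]; apply: cell_inj => n w; rewrite (actM cellA).
    have [ln|ln] := eqVneq l n; last by rewrite EA0 // act0l; case: eqP; rewrite ?EA0 ?(act0r cellA).
    subst n; rewrite EA actZl EA.
    by case: (t == u); rewrite ?EA ?scale1r // scale0r scaler0 (act0r cellA).
  rewrite (act0r cellA) //; have [ln|ln] := eqVneq l n; last by rewrite EA0 // act0l.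
  by subst n; rewrite EA actZl EA0 ?scaler0 // eq_sym.
exists E; split=> //; apply: mu_complete => //.
apply: (free_same_size_basis cB) => k kE [l [s t]].
have := congr1 (fun a => (e_ s ** a) t : F) kE; rewrite (act0r cellA) cell_mod0 => <-.
rewrite (act_sumr cellA) cell_mod_sum (bigD1 (ix s t)) //= (actZr cellA) cell_modZ EP.
rewrite /g eqxx mulr1 big1 ?addr0 // => -[m [u v]] /= uv.
by rewrite (actZr cellA) cell_modZ EP /g eq_sym (negPf uv) mulr0.
Qed.

End SemisimpleCellular.

(** * Scalar extension *)

Section ScalarExtension.
Context (R F : idomainType) (f : {rmorphism R -> F}) (A : algType R) (B : algType F).
Context (j : {rmorphism A -> B}).
Hypothesis jB : scalar_extension f j.

Lemma ext_scale r a : j (r *: a) = f r *: j a. Proof. by case: jB. Qed.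

Lemma ext_lincomb (I : finType) (P : pred I) (k : I -> R) (a : I -> A) :
  j (\sum_(i | P i) k i *: a i) = \sum_(i | P i) f (k i) *: j (a i).
Proof. by rewrite rmorph_sum; apply: eq_bigr => i _; rewrite ext_scale. Qed.

Section Basis.
Context (I : finType) (b : I -> A).
Hypothesis bB : is_basis b.

(** Coordinates over [R] followed by [f] factor through a linear map [h], which gives independence.
    Expanding along [h] agrees with the identity on the image of [j], so uniqueness of
    factorizations gives spanning. *)
Lemma ext_basis : is_basis (fun i => j (b i)).
Proof.
have [_ jU] := jB.
pose W : lmodType F := {ffun I -> F^o}.
pose g (a : A) : W := [ffun i => f (coords b a i)].
have gD a a' : g (a + a') = g a + g a'.
  by apply/ffunP => i; rewrite !ffunE coordsD // rmorphD.
have gZ r a : g (r *: a) = f r *: g a.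
  by apply/ffunP => i; rewrite !ffunE coordsZ // rmorphM.
have [h [hj _]] := jU W g gD gZ.
apply/is_basisP; split=> [x|k k0 i]; last first.
  have : h (\sum_i k i *: j (b i)) = 0 by rewrite k0 linear0.
  rewrite linear_sum => /ffunP /(_ i); rewrite sum_ffunE (bigD1 i) //= linearZ hj !ffunE.
  rewrite coords_base // eqxx rmorph1 [_ *: _]mulr1 big1 ?addr0 // => l li.
  by rewrite linearZ /= hj !ffunE coords_base // eq_sym (negPf li) rmorph0 [_ *: _]mulr0.
have jD a a' : j (a + a') = j a + j a' by rewrite rmorphD.
have [h1 [h1j h1U]] := jU B j jD ext_scale.
pose h2f x : B := \sum_i (h x i : F) *: j (b i).
have h2L : linear h2f.
  move=> k u v; rewrite /h2f scaler_sumr -big_split; apply: eq_bigr => i _.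
  by rewrite linearP !ffunE scalerDl scalerA.
pose h2 : {linear B -> B} := HB.pack h2f (GRing.isLinear.Build _ _ _ _ h2f h2L).
have h2E : h2 =1 h1.
  apply: h1U => a; rewrite /h2 /= /h2f hj [in RHS](coordsE bB a) ext_lincomb.
  by apply: eq_bigr => i _; rewrite ffunE.
have h1E : idfun =1 h1 by apply: (h1U idfun).
exists (fun i => h x i); rewrite -[LHS]/(idfun x) h1E -h2E.
by apply: eq_bigr.
Qed.

Lemma ext_coords a i : coords (fun i => j (b i)) (j a) i = f (coords b a i).
Proof.
apply: (coords_uniq ext_basis (k := fun i => f (coords b a i))).
by rewrite -ext_lincomb -coordsE.
Qed.

Lemma ext_ind (P : B -> Prop) : P 0 -> (forall x y, P x -> P y -> P (x + y)) ->
  (forall k x, P x -> P (k *: x)) -> (forall a, P (j a)) -> forall x, P x.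
Proof.
move=> P0 PD PZ Pj x; rewrite (coordsE ext_basis x); elim/big_ind: _ => // i _; exact/PZ/Pj.
Qed.

End Basis.

Context (disp : Order.disp_t) (L : finPOrderType disp) (T : L -> finType).
Context (c : forall l, T l -> T l -> A) (star : A -> A).
Hypothesis cellA : cell_datum c star.

Local Notation cj := (fun l (s t : T l) => j (c s t)).
Local Notation cb := (cell_basis c).

Let cB : is_basis cb. Proof. by case: cellA. Qed.
Let cjB : is_basis (fun i => j (cb i)) := ext_basis cB.

Definition ext_star (x : B) : B :=
  \sum_i coords (fun i => j (cb i)) x i *: j (star (cb i)).

Lemma ext_star_j a : ext_star (j a) = j (star a).
Proof.
rewrite [in RHS](coordsE cB a) (star_sum cellA) rmorph_sum.
by apply: eq_bigr => i _; rewrite ext_coords // (starZ cellA) ext_scale.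
Qed.

Lemma ext_starD x y : ext_star (x + y) = ext_star x + ext_star y.
Proof.
by rewrite -big_split; apply: eq_bigr => i _; rewrite coordsD // scalerDl.
Qed.

Lemma ext_starZ k x : ext_star (k *: x) = k *: ext_star x.
Proof.
by rewrite scaler_sumr; apply: eq_bigr => i _; rewrite coordsZ // scalerA.
Qed.

Lemma ext_ideal (P : pred L) x : ideal_of c P x -> ideal_of cj P (j x).
Proof.
by move=> [k ->]; rewrite ext_lincomb; exists (fun i => f (k i)).
Qed.

Lemma ext_eqm l x y : cell_eqm c l x y -> cell_eqm cj l (j x) (j y).
Proof. by move=> /ext_ideal; rewrite rmorphB. Qed.

(** The axioms on arbitrary elements are stable under sums and scalars, so it suffices to check them
    on the image of [j]. *)
Lemma ext_cell_datum : cell_datum cj ext_star.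
Proof.
have s0 : ext_star 0 = 0 by rewrite -(scale0r 0) ext_starZ !scale0r.
split=> //.
- split; [exact: ext_starD | exact: ext_starZ | move=> x y | move=> x].
    move: x; apply: (ext_ind cB) => [|x x' Px Px'|k x Px|a].
    - by rewrite mul0r s0 mulr0.
    - by rewrite mulrDl !ext_starD Px Px' mulrDr.
    - by rewrite -scalerAl !ext_starZ Px scalerAr.
    move: y; apply: (ext_ind cB) => [|x x' Px Px'|k x Px|b].
    - by rewrite mulr0 s0 mul0r.
    - by rewrite mulrDr !ext_starD Px Px' mulrDl.
    - by rewrite -scalerAr !ext_starZ Px scalerAl.
    - by rewrite -rmorphM !ext_star_j (starM cellA) rmorphM.
  move: x; apply: (ext_ind cB) => [|x x' Px Px'|k x Px|a].
  - by rewrite !s0.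
  - by rewrite !ext_starD Px Px'.
  - by rewrite !ext_starZ Px.
  - by rewrite !ext_star_j (starK cellA).
- move=> l t; apply: (ext_ind cB) => [|x x' [r Px] [r' Px']|k x [r Px]|a].
  - exists (fun=> 0) => s; rewrite mulr0 sub0r big1 ?oppr0; first exact: span_on0.
    by move=> v _; rewrite scale0r.
  - exists (fun v => r v + r' v) => s; rewrite mulrDr; under eq_bigr do rewrite scalerDl.
    by rewrite big_split; apply: eqmD; [apply: Px | apply: Px'].
  - exists (fun v => k * r v) => s; under eq_bigr do rewrite -scalerA.
    by rewrite -scalerAr -scaler_sumr; apply: eqmZ; apply: Px.
  - exists (fun v => f (cell_coef c (c t t * a) t v)) => s.
    rewrite -rmorphM -ext_lincomb; apply: ext_eqm; exact: (cell_mulr_eqm cellA).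
- move=> l s t; rewrite ext_star_j; apply: ext_eqm; exact: (star_c_eqm cellA).
Qed.

Definition ext_vec l (x : cell_module R T l) : cell_module F T l := [ffun t => f (x t)].

Lemma ext_vecE l (x : cell_module R T l) t : ext_vec x t = f (x t).
Proof. by rewrite ffunE. Qed.

Lemma ext_vecD l (x y : cell_module R T l) : ext_vec (x + y) = ext_vec x + ext_vec y.
Proof. by apply/ffunP => t; rewrite !ffunE rmorphD. Qed.

Lemma ext_vecZ l k (x : cell_module R T l) : ext_vec (k *: x) = f k *: ext_vec x.
Proof. by apply/ffunP => t; rewrite !ffunE rmorphM. Qed.

Lemma ext_vec_e l (t : T l) : ext_vec (cell_vec R t) = cell_vec F t.
Proof. by apply/ffunP => v; rewrite !ffunE rmorph_nat. Qed.

Lemma ext_coef a l (s t : T l) : cell_coef cj (j a) s t = f (cell_coef c a s t).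
Proof. exact: ext_coords. Qed.

Lemma ext_action l (x : cell_module R T l) a :
  cell_action cj (ext_vec x) (j a) = ext_vec (cell_action c x a).
Proof.
apply/ffunP => v; rewrite !ffunE rmorph_sum; apply: eq_bigr => t _.
by rewrite ffunE -rmorphM ext_coef -rmorphM.
Qed.

Lemma ext_tens l (x y : cell_module R T l) :
  tens cj (ext_vec x) (ext_vec y) = j (tens c x y).
Proof.
rewrite /tens rmorph_sum; apply: eq_bigr => s _; rewrite ext_lincomb.
by apply: eq_bigr => t _; rewrite !ffunE rmorphM.
Qed.

Lemma ext_vec_span l (P : pred (T l)) (x : cell_module R T l) :
  span_on (fun t => cell_vec R t) P x -> span_on (fun t => cell_vec F t) P (ext_vec x).
Proof.
move=> [k ->]; exists (fun t => f (k t)).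
rewrite (big_morph (@ext_vec l) (@ext_vecD l) (id1 := 0)); last first.
  by apply/ffunP => t; rewrite !ffunE rmorph0.
by apply: eq_bigr => t _; rewrite ext_vecZ ext_vec_e.
Qed.

End ScalarExtension.

(** * Murphy bases *)

Section CellularBasisChange.
Context (disp : Order.disp_t) (K : idomainType) (A : algType K).
Context (L : finPOrderType disp) (T T' : L -> finType).
Context (c : forall l, T l -> T l -> A) (star : A -> A).
Context (p : forall l, T' l -> cell_module K T l) (c' : forall l, T' l -> T' l -> A).
Hypothesis cellA : cell_datum c star.
Hypothesis pB : forall l, is_basis (@p l).
Hypothesis c'E : forall l (s t : T' l), cell_eqm c l (c' s t) (tens c (p s) (p t)).

Let cB : is_basis (cell_basis c). Proof. by case: cellA. Qed.

Definition chg_vec l (x : cell_module K T' l) : cell_module K T l :=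
  \sum_t (x t : K) *: p t.

Lemma chg_vecD l (x y : cell_module K T' l) : chg_vec (x + y) = chg_vec x + chg_vec y.
Proof.
by rewrite -big_split; apply: eq_bigr => t _; rewrite cell_modD scalerDl.
Qed.

Lemma chg_vecZ l k (x : cell_module K T' l) : chg_vec (k *: x) = k *: chg_vec x.
Proof.
by rewrite scaler_sumr; apply: eq_bigr => t _; rewrite cell_modZ scalerA.
Qed.

Lemma chg_vec_e l (t : T' l) : chg_vec (cell_vec K t) = p t.
Proof.
rewrite /chg_vec (bigD1 t) //= ffunE eqxx scale1r big1 ?addr0 // => u ut.
by rewrite ffunE (negPf ut) scale0r.
Qed.

Lemma chg_vec_inj l (x y : cell_module K T' l) : chg_vec x = chg_vec y -> x = y.
Proof.
move=> xy; apply/ffunP => t.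
have xE := coords_uniq (@pB l) (erefl (chg_vec x)) t.
by rewrite -xE xy; apply: (coords_uniq (@pB l) (erefl (chg_vec y))).
Qed.

Lemma chg_vec_coords l (x : cell_module K T l) : chg_vec [ffun t => coords (@p l) x t] = x.
Proof. by rewrite [RHS](coordsE (@pB l)); apply: eq_bigr => t _; rewrite ffunE. Qed.

Lemma chg_ideal_c' (P : pred L) l (s t : T' l) :
  (forall l m, P l -> (l <= m)%O -> P m) -> P l -> ideal_of c P (c' s t).
Proof.
move=> Pup Pl; apply: (eqm_ideal Pup Pl (c'E s t)).
by apply: ideal_ofS (tens_ge c _ _) => m; apply: Pup.
Qed.

Lemma chg_tens_eqm l (x y : cell_module K T' l) :
  cell_eqm c l (tens c' x y) (tens c (chg_vec x) (chg_vec y)).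
Proof.
rewrite /chg_vec tens_suml; apply: eqm_sum => s _; rewrite tensZl tens_sumr scaler_sumr.
by apply: eqm_sum => t _; rewrite tensZr scalerA; apply/eqmZ.
Qed.

(** Expanding the basis vectors in [p] expresses [c u v] through [c'] up to more dominant cells;
    induction on the number of labels above. *)
Lemma chg_c_ideal l (s t : T l) : ideal_of c' (fun m => l <= m)%O (c s t).
Proof.
suff cI n m : (#|[pred m' : L | (m < m')%O]| < n)%N -> forall u v : T m,
    ideal_of c' (fun m' => m <= m')%O (c u v) by apply: cI (ltnSn _) _ _.
elim: n m => // n IHn m; rewrite ltnS => mn u v.
pose x := [ffun t => coords (@p m) (cell_vec K u) t] : cell_module K T' m.
pose y := [ffun t => coords (@p m) (cell_vec K v) t] : cell_module K T' m.
have := chg_tens_eqm x y; rewrite !chg_vec_coords tens_vec => /eqm_sym xy.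
rewrite -(subrK (tens c' x y) (c u v)); apply: span_onD; last exact: tens_ge.
apply: (span_on_ind (Q := ideal_of c' (fun m' => m <= m')%O) xy).
- exact: span_on0.
- by move=> ? ?; apply: span_onD.
- by move=> ? ?; apply: span_onZ.
move=> [m' [u' v']] /= mm'; apply: (ideal_ofS (P := fun m => (m' <= m)%O)).
  by move=> ?; apply: le_trans (ltW mm').
apply: IHn; apply: leq_trans mn; apply: proper_card; apply/properP; split.
  by apply/fintype.subsetP => ?; rewrite !inE; apply: lt_trans.
by exists m'; rewrite !inE ?ltxx.
Qed.

Lemma chg_ideal (P : pred L) x : (forall l m, P l -> (l <= m)%O -> P m) ->
  ideal_of c P x <-> ideal_of c' P x.
Proof.
move=> Pup; split=> Px; [apply: (span_on_ind (Q := ideal_of c' P) Px) |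
  apply: (span_on_ind (Q := ideal_of c P) Px)];
  try solve [exact: span_on0 | by move=> ? ?; apply: span_onD | by move=> ? ?; apply: span_onZ];
  move=> [l [s t]] /= Pl.
  by apply: ideal_ofS (chg_c_ideal s t) => m; apply: Pup.
exact: chg_ideal_c'.
Qed.

Lemma chg_eqm l x y : cell_eqm c l x y <-> cell_eqm c' l x y.
Proof. by apply: chg_ideal => ? ? ?; apply: lt_le_trans. Qed.

(** Independence is proved from the bottom of the poset upwards. When the coefficients below [l]
    vanish, the part [B] of the relation has no coefficients in cell [l] of the old basis, and
    independence of [p], applied to each tensor factor in turn, gives the claim. *)
Lemma chg_basis : is_basis (cell_basis c').
Proof.
apply/is_basisP; split=> [x|k k0].
  by apply/(chg_ideal (P := predT)) => //; case/is_basisP: cB => + _; apply.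
suff kI n l : (#|[pred m : L | (m < l)%O]| < n)%N -> forall u v : T' l,
    k (Tagged (fun l => (T' l * T' l)%type) (u, v)) = 0.
  by move=> [l [u v]]; apply: kI (ltnSn _) _ _.
elim: n l => // n IHn l; rewrite ltnS => ln.
pose kl (u v : T' l) := k (Tagged (fun l => (T' l * T' l)%type) (u, v) : cell_index T').
pose B := \sum_(q : T' l * T' l) kl q.1 q.2 *: tens c (p q.1) (p q.2).
have BI : ideal_of c (fun m => ~~ (m <= l)%O) (- B).
  have up m m' : ~~ (m <= l)%O -> (m <= m')%O -> ~~ (m' <= l)%O.
    by move=> /negP ml mm'; apply/negP => m'l; apply: ml; apply: le_trans m'l.
  rewrite -sub0r -k0.
  rewrite (_ : \sum_i k i *: cell_basis c' i = \sum_m \sum_(q : T' m * T' m)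
     k (Tagged (fun l => (T' l * T' l)%type) q) *: c' q.1 q.2); last first.
    by rewrite sig_big_dep; apply: eq_bigr => -[].
  rewrite (bigD1 l) //= addrAC; apply: span_onD.
    rewrite -sumrB; apply: span_on_sum => -[u v] _ /=.
    rewrite -scalerBr; apply: span_onZ.
    apply: (ideal_ofS (P := fun m => (l < m)%O) (Q := fun m => ~~ (m <= l)%O) _ (c'E u v)) => m.
    by move=> lm; rewrite lt_geF.
  apply: span_on_sum => m ml; apply: span_on_sum => -[u v] _ /=.
  have [mltl|mltl] := boolP (m < l)%O.
    rewrite IHn ?scale0r; first exact: span_on0.
    apply: leq_trans ln; apply: proper_card; apply/properP; split.
      by apply/fintype.subsetP => ?; rewrite !inE => /lt_trans; apply.
    by exists m; rewrite !inE ?ltxx.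
  apply: span_onZ; apply: (chg_ideal_c' (P := fun m => ~~ (m <= l)%O)) => //.
  by rewrite le_eqVlt negb_or ml.
have Bst (s t : T l) : \sum_u (\sum_v kl u v * (p v t : K)) * (p u s : K) = 0.
  transitivity (- cell_coef c (- B) s t); last first.
    by rewrite (ideal_coef cellA _ _ BI) ?oppr0 // lexx.
  rewrite -scaleN1r (cell_coefZ cellA) mulN1r opprK (cell_coef_sum cellA).
  rewrite -(pair_bigA _ (fun u v => cell_coef c (kl u v *: tens c (p u) (p v)) s t)) /=.
  apply: eq_bigr => u _; rewrite mulr_suml; apply: eq_bigr => v _.
  by rewrite (cell_coefZ cellA) (tens_coef cellA) -mulrA [(p v t : K) * _]mulrC.
move=> u v; have /is_basisP[_ pI] := @pB l.
apply: (pI (fun v => kl u v)); apply/ffunP => t; rewrite cell_mod_sum cell_mod0.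
transitivity (\sum_v kl u v * (p v t : K)); first by apply: eq_bigr => w _; rewrite cell_modZ.
apply: (pI (fun u => \sum_v kl u v * (p v t : K))); apply/ffunP => s.
rewrite cell_mod_sum cell_mod0 -[RHS](Bst s t).
by apply: eq_bigr => w _; rewrite cell_modZ.
Qed.

Lemma chg_cell_datum : cell_datum c' star.
Proof.
split; [by case: cellA | exact: chg_basis | move=> l t a | move=> l s t].
  exists (fun v => coords (@p l) (cell_action c (p t) a) v) => s.
  apply/(chg_eqm l); apply: (eqm_trans (eqm_mulr cellA a (c'E s t))).
  apply: (eqm_trans (tens_mulr cellA _ _ _)).
  rewrite {1}[cell_action _ _ _](coordsE (@pB l)) tens_sumr; apply: eqm_sum => v _.
  by rewrite tensZr; apply/eqmZ/eqm_sym.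
apply/(chg_eqm l); apply: (eqm_trans (eqm_star cellA (c'E s t))).
by apply: (eqm_trans (tens_star cellA _ _)); apply/eqm_sym.
Qed.

Lemma chg_action l (x : cell_module K T' l) a :
  chg_vec (cell_action c' x a) = cell_action c (chg_vec x) a.
Proof.
apply/ffunP => w; have c'A := chg_cell_datum.
have E (z : T' l) : cell_eqm c l (tens c (p z) (chg_vec (cell_action c' x a)))
    (tens c (p z) (cell_action c (chg_vec x) a)).
  rewrite -(chg_vec_e z); apply: (eqm_trans (eqm_sym (chg_tens_eqm _ _))).
  apply: (eqm_trans (y := tens c' (cell_vec K z) x * a)).
    by apply/(chg_eqm l)/eqm_sym; apply: (tens_mulr c'A).
  apply: (eqm_trans (eqm_mulr cellA a (chg_tens_eqm _ _))); exact: (tens_mulr cellA).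
(* [E z] gives equality only after multiplication by [p z w]; a combination of these factors equals
   1, which removes them without division. *)
have := congr1 (fun x : cell_module K T l => x w : K) (coordsE (@pB l) (cell_vec K w)).
rewrite cell_mod_sum ffunE eqxx mulr1n => w1.
rewrite -[LHS]mul1r -[RHS]mul1r w1 !mulr_suml; apply: eq_bigr => z _.
by rewrite cell_modZ -!mulrA (tens_eqm_coef cellA w w (E z)).
Qed.

End CellularBasisChange.

(** * Paths and their ranking *)

Section Paths.
Context (R : idomainType) (D : cellular_tower R).

Definition extend r (mu : points D r) (nu : points D r.+1) (e : edge mu nu) (v : Std mu) :
  Std nu :=
  existT (fun l : {l : points D r | edge l nu} => Std (val l)) (exist _ mu e) v.

Lemma Std_succ_ind r (nu : points D r.+1) (P : Std nu -> Prop) :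
  (forall mu (e : edge mu nu) v, P (extend e v)) -> forall t, P t.
Proof. by move=> PE [[mu e] v]; apply: PE. Qed.

Lemma big_Std (V : nmodType) r (nu : points D r.+1) (G : Std nu -> V) :
  \sum_t G t = \sum_(a : {l : points D r | edge l nu}) \sum_(v : Std (val a)) G (Tagged (fun a => Std (val a)) v).
Proof. by rewrite sig_big_dep; apply: eq_bigr => -[]. Qed.

(* Numbers the paths to a point compatibly with the reverse lexicographic      *)
(* order: the last vertices are compared first, by dominance.                  *)
Fixpoint rank (r : nat) : forall nu : points D r, Std nu -> nat :=
  match r return forall nu : points D r, Std nu -> nat with
  | 0 => fun _ _ => 0
  | r'.+1 => fun nu t =>
      (#|[pred l : points D r' | (l < prev_point t)%O]| *
         (\max_(u : all_paths D r') rank (tagged u)).+1 + rank (prev_path t))%N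
  end.

(** The multiplier [N] exceeds every rank at level [r], so the last but one vertex decides the
    comparison. *)
Lemma rank_lt_point r (nu : points D r.+1) (s t : Std nu) :
  (prev_point s < prev_point t)%O -> (rank s < rank t)%N.
Proof.
move=> st /=; set N := (\max_u _).+1.
have sN : (rank (prev_path s) < N)%N.
  by rewrite ltnS (leq_bigmax (Tagged (@Std R D r) (prev_path s))).
apply: (leq_trans (n := (#|[pred l : points D r | (l < prev_point s)%O]|.+1 * N)%N)).
  by rewrite mulSnr ltn_add2l.
apply: leq_trans (leq_addr _ _); rewrite leq_mul2r; apply/orP; right.
apply: proper_card; apply/properP; split.
  by apply/fintype.subsetP => ?; rewrite !inE => /lt_trans; apply.
by exists (prev_point s); rewrite !inE ?ltxx.
Qed.

Lemma rank_lt_path r (mu : points D r) (nu : points D r.+1) (e : edge mu nu) (s t : Std mu) :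
  (rank s < rank t)%N -> (rank (extend e s) < rank (extend e t))%N.
Proof. by move=> st /=; rewrite ltn_add2l. Qed.

End Paths.

(** * Path vectors and restriction filtrations *)

Section MurphyBases.
Context (R : idomainType) (D : diagram_algebras R).

Local Notation dp t := (dpath (@dfac R D) t).

Definition gpath r (l : points D r) (t : Std l) : Delta l := Dact (gen D l) (dp t).

Let cellr r : cell_datum (@cellb R D r) (@star R D r) := ct_cellular D r.

(** [A_0] is [R], so [gen D l] spans the cell module. As [A_0] is nonzero there is a basis vector,
    and it excludes torsion. *)
Lemma gpath0_basis (l : points D 0) : is_basis (@gpath 0 l).
Proof.
have lE : l = empty_pt D := level0_pt l.
have gE (x : Delta l) : exists k, x = k *: gen D l.
  have [a ->] := gen_cyclic x; have [k' _ k'K] := level0_alg D.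
  by exists (k' a); rewrite -(k'K a) (actZr (cellr 0)) (act1 (cellr 0)) k'K.
have [[m [t _]] _] : exists i : cell_index (tabs D 0), true.
  case: (pickP (fun _ : cell_index (tabs D 0) => true)) => [i _|T0]; first by exists i.
  have [_ bB _ _] := cellr 0; have := oner_neq0 (alg D 0).
  by rewrite (coordsE bB 1) big1 ?eqxx // => i; have := T0 i.
have ml : m = l by rewrite lE; apply: level0_pt.
subst m; apply/is_basisP; split=> [x|k].
  have [k ->] := gE x; exists (fun=> k); rewrite (bigD1 tt) //= big1 ?addr0; last by case.
  by rewrite /gpath /= /Dact (act1 (cellr 0)).
rewrite (bigD1 tt) //= big1 ?addr0; last by case.
rewrite /gpath /= /Dact (act1 (cellr 0)) => k0 [].
have [k' tE] := gE (cell_vec R t).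
have : (k tt *: cell_vec R t) t = 0 :> R by rewrite tE scalerA mulrC -scalerA k0 scaler0 ffunE.
by rewrite cell_modZ ffunE eqxx mulr1.
Qed.

Section Filtration.
Context (r : nat) (IH : forall l : points D r, is_basis (@gpath r l)).
Context (nu : points D r.+1) (n : nat) (ls : n.-tuple (points D r)).
Context (M : nat -> set (Delta nu)) (g : forall i : 'I_n, Delta nu -> Delta (tnth ls i)).
Hypothesis Mg : cell_filtration M g.
Hypothesis ls_edge : forall l, (l \in ls) = edge l nu.
Hypothesis g_gen : forall i : 'I_n, let x := Dact (gen D nu) (dfac D (tnth ls i) nu) in
  M i.+1 x /\ g i x = gen D (tnth ls i).

Let M_sub i : (i <= n)%N -> restricted_submodule (M i).
Proof. by case: Mg => _ _ _ + _; apply. Qed.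

Let M0 i : (i <= n)%N -> M i 0. Proof. by move=> /M_sub[]. Qed.
Let MD i x y : (i <= n)%N -> M i x -> M i y -> M i (x + y).
Proof. by move=> /M_sub[_ + _ _]; apply. Qed.
Let MZ i k x : (i <= n)%N -> M i x -> M i (k *: x).
Proof. by move=> /M_sub[_ _ + _]; apply. Qed.
Let Mact i x a : (i <= n)%N -> M i x -> M i (Dact x (inc r a)).
Proof. by move=> /M_sub[_ _ _]; apply. Qed.

Let M_le i j x : (i <= j)%N -> (j <= n)%N -> M i x -> M j x.
Proof.
elim: j => [|j IHj]; first by rewrite leqn0 => /eqP ->.
rewrite leq_eqVlt => /orP[/eqP -> //|ij] jn Mx; case: Mg => _ _ Minc _ _.
by apply: (Minc j jn); apply: IHj => //; apply: ltnW.
Qed.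

Let g_iso (i : 'I_n) : subquotient_iso (M i) (M i.+1) (g i).
Proof. by case: Mg => _ _ _ _ [_]; apply. Qed.

Let ls_uniq : uniq ls.
Proof.
case: Mg => _ _ _ _ [+ _]; apply: sorted_uniq; last by move=> x; rewrite ltxx.
by move=> x y z yx xz; apply: lt_trans xz yx.
Qed.

Let gen_path (i : 'I_n) (e : edge (tnth ls i) nu) w :
  let x := Dact (gen D nu) (dfac D (tnth ls i) nu * inc r w) in
  M i.+1 x /\ g i x = Dact (gen D (tnth ls i)) w.
Proof.
have [Mx gx] := g_gen i; have [_ gact _ _] := g_iso i => /=.
rewrite [Dact _ (_ * _)](actM (cellr r.+1)) -gx; split; last exact: gact.
exact: Mact.
Qed.

Let lsi (i : 'I_n) : edge (tnth ls i) nu. Proof. by rewrite -ls_edge mem_tnth. Qed.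

(** Filtration step through which [t] passes; small values belong to the more dominant points. *)
Let idx (t : Std nu) : nat := index (prev_point t) ls.

Let idx_tnth (i : 'I_n) : index (tnth ls i) ls = i.
Proof. by rewrite (tnth_nth (tnth ls i)) index_uniq // size_tuple. Qed.

Let idx_extend (i : 'I_n) (v : Std (tnth ls i)) : idx (extend (lsi i) v) = i.
Proof. exact: idx_tnth. Qed.

Let gpath_extend mu (e : edge mu nu) (v : Std mu) :
  gpath (extend e v) = Dact (gen D nu) (dfac D mu nu * inc r (dp v)).
Proof. by []. Qed.

Let g_lin (i : 'I_n) (J : finType) (k : J -> R) (x : J -> Delta nu) :
  (forall j, M i.+1 (x j)) ->
  M i.+1 (\sum_j k j *: x j) /\ g i (\sum_j k j *: x j) = \sum_j k j *: g i (x j).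
Proof.
move=> Mx; have [gl _ _ gk] := g_iso i.
have g0 : g i 0 = 0 by apply/gk; apply: M0 => //; apply: ltnW.
elim/big_rec2: _ => [|j y z _ [Mz gz]]; first by split=> //; apply: M0.
by split; [apply: MD => //; apply: MZ | rewrite gl // gz].
Qed.

Let path_in_M (t : Std nu) : M (idx t).+1 (gpath t).
Proof.
elim/Std_succ_ind: t => mu e v; have /tnthP[i muE] : mu \in ls by rewrite ls_edge.
subst mu; rewrite gpath_extend /idx /prev_point /= idx_tnth.
by have [] := gen_path e (dp v).
Qed.

(** Expand the image of [x] in the cell module of level [r] and lift it along paths; the remainder
    lies one filtration step lower. *)
Let sub_span j x : (j <= n)%N -> M j x -> span_on (@gpath r.+1 nu) (fun t => idx t < j)%N x.
Proof.
elim: j x => [|j IHj] x jn Mx.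
  by case: Mg => /(_ x) [/(_ Mx) -> _] _ _ _ _; apply: span_on0.
pose i : 'I_n := Ordinal jn.
pose k v := coords (@gpath r (tnth ls i)) (g i x) v.
pose y := \sum_v k v *: gpath (extend (lsi i) v).
have [My gy] : M i.+1 y /\ g i y = \sum_v k v *: g i (gpath (extend (lsi i) v)).
  by apply: g_lin => v; rewrite gpath_extend; have [] := gen_path (lsi i) (dp v).
have [gl _ _ gk] := g_iso i.
have gxy : g i (-1 *: y + x) = 0.
  rewrite gl // gy (coordsE (@IH (tnth ls i)) (g i x)) scaleN1r addrC.
  apply/eqP; rewrite subr_eq0; apply/eqP/eq_bigr => v _.
  by rewrite gpath_extend; have [_ ->] := gen_path (lsi i) (dp v).
have Mxy : M j (-1 *: y + x).
  by apply/(gk (-1 *: y + x)) => //; apply: MD => //; apply: MZ.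
rewrite -(addNKr y x) addrC -scaleN1r; apply: span_onD.
  apply: (span_onS _ (IHj _ (ltnW jn) Mxy)) => t; exact: leqW.
apply: span_on_sum => v _; apply: span_onZ; apply: span_on_base.
by rewrite idx_extend.
Qed.

(** Coefficients of a relation vanish from the top step of the filtration downwards, since modulo
    lower steps the relation lives in a single cell module of level [r]. *)
Lemma filtration_gpath_basis : is_basis (@gpath r.+1 nu).
Proof.
apply/is_basisP; split=> [x|k k0].
  by case: Mg => _ /(_ x) /(sub_span (leqnn n)) + _ _ _; apply: span_onS.
suff kI j : (j <= n)%N -> (forall t, (j <= idx t)%N -> k t = 0) -> forall t, k t = 0.
  apply: (kI n) => // t; elim/Std_succ_ind: t => mu e v.
  by rewrite leqNgt -{1}(size_tuple ls) index_mem ls_edge e.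
elim: j => [|j IHj] jn kj t; first exact: kj.
pose i : 'I_n := Ordinal jn; apply: (IHj (ltnW jn)) => {}t; rewrite leq_eqVlt => /orP[|/kj//].
move=> /eqP; elim/Std_succ_ind: t => mu e v jE.
have muE : mu = tnth ls i.
  by rewrite (tnth_nth mu) /= jE nth_index // ls_edge.
subst mu; pose y := \sum_(w : Std (tnth ls i)) k (extend e w) *: gpath (extend e w).
have [My gy] : M i.+1 y /\ g i y =
    \sum_(w : Std (tnth ls i)) k (extend e w) *: g i (gpath (extend e w)).
  by apply: g_lin => w; rewrite gpath_extend; have [] := gen_path e (dp w).
have gy0 : g i y = 0.
  have [_ _ _ gk] := g_iso i; apply/gk => //.
  pose a0 : {l : points D r | edge l nu} := exist _ (tnth ls i) e.
  pose tg (a : {l : points D r | edge l nu}) (w : Std (val a)) : Std nu :=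
    Tagged (fun a : {l : points D r | edge l nu} => Std (val a)) w.
  (* Of the remaining terms, those at earlier positions lie in [M j] and those at later positions
     have coefficient 0 already. *)
  have /eqP : y + \sum_(a | a != a0) \sum_(w : Std (val a)) k (tg a w) *: gpath (tg a w) = 0.
    by rewrite -[RHS]k0 big_Std [RHS](bigD1 a0).
  rewrite addr_eq0 => /eqP ->; rewrite -scaleN1r; apply: MZ; first exact: ltnW.
  elim/big_ind: _ => [||a aa0]; [exact/M0/ltnW | by move=> *; apply: MD => //; apply: ltnW |].
  elim/big_ind: _ => [||w _]; [exact/M0/ltnW | by move=> *; apply: MD => //; apply: ltnW |].
  have [aj|ja] := ltnP (idx (tg a w)) j.
    by apply: MZ; [exact: ltnW | apply: (M_le aj (ltnW jn)); apply: path_in_M].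
  rewrite kj ?scale0r; first exact/M0/ltnW.
  rewrite leq_eqVlt in ja; case/orP: ja => // /eqP ja; case/negP: aa0.
  have al : sval a \in ls by rewrite ls_edge; exact: (svalP a).
  apply/eqP/val_inj; rewrite /= (tnth_nth (sval a)) /= ja /idx /prev_point /=.
  by rewrite nth_index.
have /is_basisP[_ pI] := @IH (tnth ls i).
apply: (pI (fun w => k (extend e w))); rewrite -[RHS]gy0 gy; apply: eq_bigr => w _.
by rewrite gpath_extend; have [_ ->] := gen_path e (dp w).
Qed.

(** The difference is killed by [g i], so it lies in [M i], which is spanned by paths through points
    listed before [mu], that is, more dominant ones. *)
Lemma filtration_branching mu (e : edge mu nu) w (k : Std mu -> R) :
  Dact (gen D mu) w = \sum_v k v *: gpath v ->
  span_on (@gpath r.+1 nu) (fun t => (mu < prev_point t)%O)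
    (Dact (gen D nu) (dfac D mu nu * inc r w) - \sum_v k v *: gpath (extend e v)).
Proof.
have /tnthP[i muE] : mu \in ls by rewrite ls_edge.
subst mu => wE.
have [Mx gx] := gen_path e w; set x := Dact _ (_ * _) in Mx gx *.
set y := \sum_v _.
have [My gy] : M i.+1 y /\ g i y = \sum_v k v *: g i (gpath (extend e v)).
  by apply: g_lin => v; rewrite gpath_extend; have [] := gen_path e (dp v).
have [gl _ _ gk] := g_iso i.
have Mxy : M i (x - y).
  apply/gk; first by rewrite -scaleN1r; apply: MD => //; apply: MZ.
  rewrite addrC -scaleN1r gl // gx wE gy scaleN1r addrC.
  apply/eqP; rewrite subr_eq0; apply/eqP/eq_bigr => v _.
  by rewrite gpath_extend; have [_ ->] := gen_path e (dp v).
apply: (span_onS _ (sub_span (ltnW (ltn_ord i)) Mxy)) => t; elim/Std_succ_ind: t => mu e' v.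
rewrite /idx /prev_point /= => mui.
have /tnthP[j muE] : mu \in ls by rewrite ls_edge.
subst mu; rewrite idx_tnth in mui.
case: Mg => _ _ _ _ [+ _]; rewrite (sorted_pairwise (leT := fun x y : points D r => (y < x)%O)); last first.
  by move=> ? ? ? yx xz; apply: lt_trans xz yx.
move=> /(pairwiseP (tnth ls i)) /(_ j i); rewrite -!tnth_nth !inE size_tuple.
by apply.
Qed.

End Filtration.
End MurphyBases.

(** * Murphy elements as a cellular basis *)

Section MurphyCellular.
Context (R : idomainType) (D : diagram_algebras R).

Local Notation dp t := (dpath (@dfac R D) t).
Local Notation mu_ r := (@murphy R D r).

Let cellr r : cell_datum (@cellb R D r) (@star R D r) := ct_cellular D r.

Lemma gpath_basis r (l : points D r) : is_basis (@gpath R D r l).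
Proof.
elim: r l => [|r IH] l; first exact: gpath0_basis.
have [n [ls [M [g [Mg ls_edge g_gen]]]]] := dfac_filtration l.
exact: filtration_gpath_basis Mg ls_edge g_gen.
Qed.

(** The equation for [cell_alpha] fixes the coefficients in cell [l], and membership in the ideal
    excludes labels not above [l]. *)
Lemma mgen_gen_eqm r (l : points D r) :
  cell_eqm (cellb D r) l (mgen D l) (tens (cellb D r) (gen D l) (gen D l)).
Proof.
have [mge malpha] := mgen_cell l; have [_ cB _ _] := cellr r.
apply/(span_onP cB) => -[m [s t]] /= lm.
rewrite -[coords _ _ _]/(cell_coef (cellb D r) (mgen D l - tens (cellb D r) (gen D l) (gen D l)) s t).
rewrite (cell_coefB (cellr r)); have [ml|ml] := eqVneq l m.
  subst m; rewrite (tens_coef (cellr r)).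
  by move/ffunP: malpha => /(_ (s, t)); rewrite !ffunE /= => ->; rewrite subrr.
have lm' : ~~ (l <= m)%O by rewrite le_eqVlt negb_or ml.
rewrite (ideal_coef (cellr r) s t mge) //.
by rewrite (ideal_coef (cellr r) s t (tens_ge _ _ _)) // subrr.
Qed.

(** The elements d_s and d_t move into the two factors of the tensor square of [gen D l], so Murphy
    elements arise by a change of basis along [gpath]. *)
Lemma murphy_tens r (l : points D r) (s t : Std l) :
  cell_eqm (cellb D r) l (murphy s t) (tens (cellb D r) (gpath s) (gpath t)).
Proof.
have cr := cellr r; apply: eqm_trans (eqm_mulr cr _ (eqm_mull cr _ (mgen_gen_eqm l))) _.
apply: eqm_trans (eqm_mulr cr _ (tens_mull cr _ _ _)) _; rewrite (starK cr).
exact: tens_mulr.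
Qed.

Lemma murphy_datum r : cell_datum (mu_ r) (@star R D r).
Proof. exact: chg_cell_datum (cellr r) (@gpath_basis r) (@murphy_tens r). Qed.

Lemma murphy_basis r : is_basis (cell_basis (mu_ r)).
Proof. by case: (murphy_datum r). Qed.

Lemma cellb_murphy_ideal r (P : pred (points D r)) x :
  (forall l m, P l -> (l <= m)%O -> P m) -> ideal_of (cellb D r) P x -> ideal_of (mu_ r) P x.
Proof.
by move=> Pup; have [+ _] := chg_ideal (@gpath_basis r) (@murphy_tens r) x Pup.
Qed.

Definition genM r (l : points D r) : MDelta l :=
  [ffun t => coords (@gpath R D r l) (gen D l) t].

Lemma chg_genM r (l : points D r) : chg_vec (@gpath R D r) (genM l) = gen D l.
Proof. exact: chg_vec_coords (@gpath_basis r) _ _. Qed.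

Lemma genM_dpath r (l : points D r) (t : Std l) : MDact (genM l) (dp t) = cell_vec R t.
Proof.
apply: (chg_vec_inj (@gpath_basis r)).
rewrite (chg_action (cellr r) (@gpath_basis r) (@murphy_tens r)) chg_genM chg_vec_e.
by [].
Qed.

Lemma mgen_eqm r (l : points D r) :
  cell_eqm (mu_ r) l (mgen D l) (tens (mu_ r) (genM l) (genM l)).
Proof.
apply/(chg_eqm (@gpath_basis r) (@murphy_tens r)).
apply: (eqm_trans (mgen_gen_eqm l)); rewrite -chg_genM.
exact: eqm_sym (chg_tens_eqm (@murphy_tens r) _ _).
Qed.

(** [filtration_branching] transported to Murphy coordinates. All later triangularity rests on
    it. *)
Lemma branching r (mu : points D r) (nu : points D r.+1) (e : edge mu nu) w :
  span_on (fun t : Std nu => cell_vec R t) (fun t => (mu < prev_point t)%O)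
    (MDact (genM nu) (dfac D mu nu * inc r w) -
     \sum_v (MDact (genM mu) w v : R) *: cell_vec R (extend e v)).
Proof.
have [n [ls [M [g [Mg ls_edge g_gen]]]]] := dfac_filtration nu.
pose k v : R := MDact (genM mu) w v.
have kE : Dact (gen D mu) w = \sum_v k v *: gpath v.
  rewrite -[gen D mu]chg_genM; symmetry.
  exact: (chg_action (cellr r) (@gpath_basis r) (@murphy_tens r)).
have [k' k'E] := filtration_branching (@gpath_basis r) Mg ls_edge g_gen e kE.
exists k'; apply: (chg_vec_inj (@gpath_basis r.+1)); rewrite -scaleN1r chg_vecD chg_vecZ.
rewrite (chg_action (cellr r.+1) (@gpath_basis r.+1) (@murphy_tens r.+1)) chg_genM.
have chg_sum (J : finType) (P : pred J) (h : J -> R) (x : J -> Std nu) :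
    chg_vec (@gpath R D r.+1) (\sum_(j | P j) h j *: cell_vec R (x j)) =
    \sum_(j | P j) h j *: gpath (x j).
  elim/big_rec2: _ => [|j y z _ <-]; last by rewrite chg_vecD chg_vecZ chg_vec_e.
  by rewrite -(scale0r 0) chg_vecZ !scale0r.
by rewrite !chg_sum scaleN1r.
Qed.

End MurphyCellular.

(** * Extended towers *)

Section CellVectors.
Context (disp : Order.disp_t) (K : idomainType) (L : finPOrderType disp).
Context (T : L -> finType) (l : L).

Lemma cell_vec_basis : is_basis (fun t : T l => cell_vec K t).
Proof.
apply/is_basisP; split=> [x|k /ffunP k0 t].
  by exists (fun t => x t); rewrite [LHS]cell_module_sum.
have := k0 t; rewrite sum_ffunE (bigD1 t) //= !ffunE eqxx [_ *: _]mulr1.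
by rewrite big1 ?addr0 // => u ut; rewrite !ffunE eq_sym (negPf ut) [_ *: _]mulr0.
Qed.

Lemma cell_vec_coords (x : cell_module K T l) t : coords (fun t : T l => cell_vec K t) x t = x t.
Proof.
apply: (coords_uniq cell_vec_basis (k := fun t => x t)); exact: cell_module_sum.
Qed.

Lemma cell_vec_spanP (P : pred (T l)) (x : cell_module K T l) :
  span_on (fun t : T l => cell_vec K t) P x <-> forall t, ~~ P t -> x t = 0.
Proof.
split=> [/(span_onP cell_vec_basis) x0 t Pt|x0]; first by rewrite -cell_vec_coords x0.
by apply/(span_onP cell_vec_basis) => t Pt; rewrite cell_vec_coords x0.
Qed.

End CellVectors.

Section TowerExtension.
Context (R : idomainType) (D : diagram_algebras R) (E : fieldType).
Context (f : {rmorphism R -> E}) (B : nat -> algType E).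
Context (j : forall r, {rmorphism alg D r -> B r}) (incB : forall r, {lrmorphism B r -> B r.+1}).
Hypothesis jB : forall r, scalar_extension f (j r).
Hypothesis j_inc : forall r a, incB r (j r a) = j r.+1 (inc r a).

Local Notation dp t := (dpath (@dfac R D) t).
Local Notation muB r := (fun (l : points D r) (s t : Std l) => j r (murphy s t)).
Local Notation "x ** a" := (cell_action (muB _) x a) (at level 40).
Local Notation e_ t := (cell_vec E t).
Local Notation bB r := (fun i => j r (cell_basis (@murphy R D r) i)).

Definition tower_star r : B r -> B r := ext_star (j r) (@murphy R D r) (@star R D r).

Lemma murphyB_datum r : cell_datum (muB r) (@tower_star r).
Proof. exact (ext_cell_datum (jB r) (murphy_datum D r)). Qed.

Lemma murphyB_basis r : is_basis (bB r).
Proof. exact (ext_basis (jB r) (@murphy_basis R D r)). Qed.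

Lemma murphyB_ind r (P : B r -> Prop) : P 0 -> (forall x y, P x -> P y -> P (x + y)) ->
  (forall k x, P x -> P (k *: x)) -> (forall a, P (j r a)) -> forall x, P x.
Proof. exact (ext_ind (jB r) (@murphy_basis R D r) (P := P)). Qed.

Lemma starB_j r a : tower_star (j r a) = j r (star a).
Proof. exact (ext_star_j (jB r) (murphy_datum D r) a). Qed.

Lemma starB_inc r x : tower_star (incB r x) = incB r (tower_star x).
Proof.
have s0 i : tower_star (0 : B i) = 0 by rewrite (star0 (murphyB_datum i)).
move: x; apply: murphyB_ind => [|x y Px Py|k x Px|a].
- by rewrite !(s0, rmorph0).
- by rewrite rmorphD !(starD (murphyB_datum _)) Px Py rmorphD.
- by rewrite linearZ /= !(starZ (murphyB_datum _)) Px linearZ.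
- by rewrite j_inc !starB_j ct_star_inc j_inc.
Qed.

Definition genB r (l : points D r) : cell_module E (@Std R D r) l := ext_vec f (genM l).

Lemma genB_dpath r (l : points D r) (t : Std l) : genB l ** j r (dp t) = e_ t.
Proof.
rewrite (ext_action (jB r) (murphy_datum D r)) -[cell_action _ _ _]/(MDact _ _).
by rewrite genM_dpath ext_vec_e.
Qed.

Lemma mgenB_eqm r (l : points D r) :
  cell_eqm (muB r) l (j r (mgen D l)) (tens (muB r) (genB l) (genB l)).
Proof.
by rewrite (ext_tens (jB r)); apply: (ext_eqm (jB r)); apply: mgen_eqm.
Qed.

Lemma branchB r (mu : points D r) (nu : points D r.+1) (e : edge mu nu) w :
  span_on (fun t : Std nu => e_ t) (fun t => (mu < prev_point t)%O)
    (genB nu ** (j r.+1 (dfac D mu nu) * incB r w) -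
     \sum_v ((genB mu ** w) v : E) *: e_ (extend e v)).
Proof.
have act0 i (l : points D i) (x : cell_module E (@Std R D i) l) : x ** 0 = 0.
  exact: act0r (murphyB_datum i) _ _.
move: w; apply: murphyB_ind => [|x y Px Py|k x Px|a].
- rewrite rmorph0 mulr0 !act0 big1 ?subrr; first exact: span_on0.
  by move=> v _; rewrite ffunE scale0r.
- rewrite rmorphD mulrDr !(actDr (murphyB_datum _)).
  under eq_bigr do rewrite cell_modD scalerDl.
  by rewrite big_split opprD addrACA; apply: span_onD.
- rewrite linearZ /= -scalerAr !(actZr (murphyB_datum _)).
  under eq_bigr do rewrite cell_modZ -scalerA.
  by rewrite -scaler_sumr -scalerBr; apply: span_onZ.
rewrite j_inc -rmorphM !(ext_action (jB _) (murphy_datum D _)).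
have := ext_vec_span f (branching e a); congr (span_on _ _ _).
rewrite -scaleN1r ext_vecD ext_vecZ rmorphN1 scaleN1r; congr (_ - _).
elim/big_rec2: _ => [|v x y _ <-]; first by apply/ffunP => t; rewrite !ffunE rmorph0.
by rewrite ext_vecD ext_vecZ ext_vec_e ext_vecE.
Qed.

Section Branching.
Context (r : nat) (mu : points D r) (nu : points D r.+1) (e : edge mu nu) (w : B r).
Let y : cell_module E (@Std R D r.+1) nu := genB nu ** (j r.+1 (dfac D mu nu) * incB r w).

Let yE t : ~~ (mu < prev_point t)%O -> y t = \sum_v (genB mu ** w) v * (t == extend e v)%:R :> E.
Proof.
move=> mut; have /cell_vec_spanP /(_ t mut) := branchB e w.
rewrite cell_modB => /eqP; rewrite subr_eq0 => /eqP; rewrite -/y => ->.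
by rewrite cell_mod_sum; apply: eq_bigr => v _; rewrite cell_modZ cell_vecE.
Qed.

Lemma branchB_path v : y (extend e v) = (genB mu ** w) v.
Proof.
rewrite yE ?ltxx // (bigD1 v) //= eqxx mulr1 big1 ?addr0 // => u uv.
rewrite (_ : (extend e v == extend e u) = false) ?mulr0 //.
by apply: contraNF uv => /eqP/eqP; rewrite /extend eq_Tagged /= eq_sym.
Qed.

Lemma branchB_0 t : ~~ (mu <= prev_point t)%O -> y t = 0.
Proof.
rewrite le_eqVlt negb_or => /andP[mut mutl]; rewrite yE // big1 // => v _.
case: eqP => [tE|_]; last by rewrite mulr0.
by rewrite tE /prev_point /= eqxx in mut.
Qed.

(** A path in the support of [y] either runs through a point more dominant than [mu], hence has
    larger rank, or runs through [mu], where its coefficient is that of the lower level. *)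
Lemma branchB_rank_lt t v : (forall u, (rank u <= rank v)%N -> (genB mu ** w) u = 0) ->
  (rank t <= rank (extend e v))%N -> y t = 0.
Proof.
move=> w0; elim/Std_succ_ind: t => l el u utv.
have [mul|mul] := boolP (mu <= l)%O; last exact: branchB_0.
rewrite le_eqVlt in mul; case/orP: mul => [/eqP mul|mul].
  subst l; rewrite (bool_irrelevance el e) branchB_path; apply: w0.
  by rewrite leqNgt; apply: contraL utv => /(rank_lt_path e); rewrite -ltnNge (bool_irrelevance el e).
by have := rank_lt_point (mul : (prev_point (extend e v) < prev_point (extend el u))%O); rewrite ltnNge utv.
Qed.

End Branching.

Lemma branchB_vec r (mu : points D r) (nu : points D r.+1) (e : edge mu nu) (v : Std mu) w :
  e_ (extend e v) ** incB r w = genB nu ** (j r.+1 (dfac D mu nu) * incB r (j r (dp v) * w)).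
Proof.
rewrite -genB_dpath -(actM (murphyB_datum _)); congr (_ ** _).
rewrite -[dp (extend e v)]/(dfac D mu nu * inc r (dp v)).
by rewrite [in RHS]rmorphM /= mulrA j_inc rmorphM.
Qed.

(** Structure constants come from [R], so one formula serves both fields of fractions. This and the
    next three formulas make evaluation compatible with all operations. *)
Lemma extB_mul r (x y : B r) k : coords (bB r) (x * y) k =
  \sum_i \sum_i' coords (bB r) x i * coords (bB r) y i' *
    f (coords (cell_basis (@murphy R D r)) (cell_basis (@murphy R D r) i * cell_basis (@murphy R D r) i') k).
Proof.
have mB := @murphyB_basis r.
rewrite {1}[x](coordsE mB) {1}[y](coordsE mB) mulr_suml coords_sum //; apply: eq_bigr => i _.
rewrite mulr_sumr coords_sum //; apply: eq_bigr => i' _.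
rewrite -scalerAl -scalerAr scalerA coordsZ // -rmorphM.
by rewrite (ext_coords (jB r) (@murphy_basis R D r)).
Qed.

Lemma extB_inc r (x : B r) k : coords (bB r.+1) (incB r x) k =
  \sum_i coords (bB r) x i *
    f (coords (cell_basis (@murphy R D r.+1)) (inc r (cell_basis (@murphy R D r) i)) k).
Proof.
rewrite {1}[x](coordsE (@murphyB_basis r)) linear_sum (coords_sum (@murphyB_basis _)).
apply: eq_bigr => i _; rewrite linearZ /= (coordsZ (@murphyB_basis _)) j_inc.
by rewrite (ext_coords (jB _) (@murphy_basis R D _)).
Qed.

Lemma extB_action r (l : points D r) (x : cell_module E (@Std R D r) l) a v :
  (x ** a) v = \sum_t \sum_i x t * coords (bB r) a i *
    f (cell_coef (@murphy R D r) (murphy t t * cell_basis (@murphy R D r) i) t v).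
Proof.
rewrite ffunE; apply: eq_bigr => t _.
rewrite {1}[a](coordsE (@murphyB_basis r)) mulr_sumr (cell_coef_sum (murphyB_datum r)) mulr_sumr.
apply: eq_bigr => i _; rewrite -scalerAr (cell_coefZ (murphyB_datum r)) mulrA -rmorphM.
by rewrite (ext_coef (jB r) (murphy_datum D r)).
Qed.

Lemma extB_form r (l : points D r) (x y : cell_module E (@Std R D r) l) :
  cell_form (muB r) x y = \sum_t \sum_u x t * y u *
    f (cell_coef (@murphy R D r) (murphy t t * murphy u u) t u).
Proof.
apply: eq_bigr => t _; apply: eq_bigr => u _.
by rewrite -rmorphM (ext_coef (jB r) (murphy_datum D r)).
Qed.

End TowerExtension.

(** * Seminormal forms *)

Section Seminormal.
Context (R : idomainType) (D : diagram_algebras R).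
Local Notation F := {fraction R}.
Local Notation fF := (@tofrac R : {rmorphism R -> F}).

Let jX r : scalar_extension fF (@jF R D r) := jF_ext D r.

Local Notation muF r := (@murphyF R D r).
Local Notation "x ** a" := (DactF x a) (at level 40).
Local Notation "<< x , y >>" := (formF x y) (at level 0).
Local Notation e_ t := (mvecF t).
Local Notation dp t := (dpath (@dfac R D) t).

Definition starF r : algF D r -> algF D r := tower_star (@jF R D) (r := r).

Lemma cellF r : cell_datum (muF r) (@starF r).
Proof. exact (murphyB_datum jX r). Qed.

Let regF r : regular_ring (algF D r) := split_semisimple_regular (algF_split D r).

Lemma starF_inc r (x : algF D r) : starF (incF r x) = incF r (starF x).
Proof. exact (starB_inc jX (@jF_inc R D) x). Qed.

(** The idempotent chosen in [zF] is a block sum of the units from [cell_matrix_units]; the path [s]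
    witnesses that the cell module is nonzero. *)
Lemma zF_spec r (l : points D r) (s : Std l) :
  [/\ central_idempotent (zF l), forall x : DeltaF l, x ** zF l = x &
      forall m (x : DeltaF m), l != m -> x ** zF l = 0].
Proof.
have [E [[Emu EB _] EA EA0]] := cell_matrix_units (cellF r) (@regF r).
have act_l (x : DeltaF l) : x ** mu_block E l = x.
  rewrite {1}[x]cell_module_sum [RHS]cell_module_sum [LHS]act_suml; apply: eq_bigr => u _.
  rewrite [LHS]actZl; congr (_ *: _); rewrite [LHS](act_sumr (cellF r)) (bigD1 u) //= EA eqxx scale1r.
  rewrite big1 ?addr0 // => v vu; by rewrite EA eq_sym (negPf vu) scale0r.
have zE : zF l = mu_block E l.
  apply: (mu_block_idempotent Emu EB s (x0 := e_ s)) => //.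
    by move=> x a b; rewrite [RHS](actM (cellF r)).
  rewrite [X in X <> _](act0r (cellF r)) => /ffunP /(_ s); rewrite !ffunE eqxx => /eqP.
  by rewrite eq_sym oner_eq0.
rewrite zE; split=> //; first exact: mu_block_central.
move=> m x lm; rewrite [x]cell_module_sum [LHS]act_suml big1 // => u _.
rewrite [LHS]actZl [X in _ *: X](act_sumr (cellF r)) big1 ?scaler0 // => v _; exact: EA0.
Qed.

Lemma DactF_inj r (a b : algF D r) :
  (forall (l : points D r) (s : Std l), e_ s ** a = e_ s ** b) -> a = b.
Proof. exact: (cell_inj (cellF r) (@regF r)). Qed.

Lemma DactM r (l : points D r) (x : DeltaF l) a b : x ** (a * b) = (x ** a) ** b.
Proof. exact (actM (cellF r) x a b). Qed.

Lemma DactFZr r (l : points D r) k (x : DeltaF l) a : x ** (k *: a) = k *: (x ** a).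
Proof. exact (actZr (cellF r) k x a). Qed.

Lemma DactFZl r (l : points D r) k (x : DeltaF l) a : (k *: x) ** a = k *: (x ** a).
Proof. exact (actZl _ k x a). Qed.

Lemma DactF0l r (l : points D r) a : (0 : DeltaF l) ** a = 0.
Proof. exact (act0l _ l a). Qed.

Lemma DactF0r r (l : points D r) (x : DeltaF l) : x ** 0 = 0.
Proof. exact (act0r (cellF r) x). Qed.

(** [zF l] acts on each cell module as 0 or 1, hence is self-adjoint there; nondegeneracy and
    faithfulness conclude. *)
Lemma zF_star r (l : points D r) (s : Std l) : starF (zF l) = zF l.
Proof.
have [_ ll l0] := zF_spec s; apply: DactF_inj => n u; apply/eqP; rewrite -subr_eq0; apply/eqP.
apply: (form_nondegenerate (cellF r) (@regF r)) => y.
rewrite cform_addl -scaleN1r cform_scalel mulN1r; apply/eqP; rewrite subr_eq0; apply/eqP.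
have -> : cell_form (muF r) (e_ u ** starF (zF l)) y = cell_form (muF r) (e_ u) (y ** zF l).
  by rewrite (form_act (cellF r)) (starK (cellF r)).
have [ln|ln] := eqVneq l n; last by rewrite !l0 // cform0r cform0l.
by subst n; rewrite !ll.
Qed.

Lemma GZF_succ r (mu : points D r) (nu : points D r.+1) (e : edge mu nu) (v : Std mu) :
  GZF (extend e v) = incF r (GZF v) * zF nu.
Proof. by []. Qed.

Lemma GZF_star r (l : points D r) (t : Std l) : starF (GZF t) = GZF t.
Proof.
elim: r l t => [|r IH] l t; first exact: zF_star.
have [[_ zC] _ _] := zF_spec t.
move: t; apply: Std_succ_ind => mu e v; rewrite GZF_succ (starM (cellF _)).
by rewrite (zF_star (extend e v)) zC starF_inc IH.
Qed.

Lemma GZF_act0 r (l m : points D r) (t : Std m) (x : DeltaF l) : l != m -> x ** GZF t = 0.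
Proof.
move=> lm; have [_ _ z0] := zF_spec t; rewrite eq_sym in lm.
by case: r l m lm t x z0 => [|r] l m lm t x z0; rewrite /= ?DactM z0.
Qed.

Lemma GZF_mul0 r (l m : points D r) (s : Std l) (t : Std m) : l != m -> GZF s * GZF t = 0.
Proof.
move=> lm; apply: DactF_inj => n u; rewrite DactM DactF0r.
have [nl|nl] := eqVneq n l; last by rewrite (GZF_act0 s _ nl) DactF0l.
by subst n; rewrite GZF_act0.
Qed.

(** Centrality of [zF l] reduces the product to the level below, where different paths either end at
    different points or are covered by induction. *)
Lemma GZF_mul_same r (l : points D r) (s t : Std l) :
  GZF s * GZF t = if s == t then GZF s else 0.
Proof.
elim: r l s t => [|r IH] l s t; have [[zz zC] _ _] := zF_spec s.
  by case: s t => -[] /=.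
have GE (s' t' : Std l) : GZF s' * GZF t' =
    incF r (GZF (prev_path s') * GZF (prev_path t')) * zF l.
  by rewrite /= -mulrA [zF l * _]mulrA zC -!mulrA zz mulrA -rmorphM.
rewrite GE; case: eqP => [<-|].
  by rewrite IH eqxx.
move: s t {zz zC GE}; apply: Std_succ_ind => mu e v; apply: Std_succ_ind => mu' e' v'.
rewrite /prev_path /=; have [mm|mm] := eqVneq mu mu'.
  subst mu'; rewrite (bool_irrelevance e' e) IH => vv'.
  by case: eqP => [vE|_]; [rewrite vE in vv' | rewrite rmorph0 mul0r].
by rewrite GZF_mul0 // rmorph0 mul0r.
Qed.

Lemma GZF_prev_mul r (mu : points D r) (nu : points D r.+1) (e : edge mu nu)
    (v : Std mu) (s : Std nu) :
  incF r (GZF v) * GZF s = if extend e v == s then GZF (extend e v) else 0.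
Proof.
rewrite -GZF_mul_same; have [[zz zC] _ _] := zF_spec s.
move: s; apply: Std_succ_ind => mu' e' v'.
by rewrite !GZF_succ -[RHS]mulrA [zF nu * _]mulrA zC -[_ * zF nu * _]mulrA zz.
Qed.

Lemma fvec_GZF r (l : points D r) (s t : Std l) :
  fvec s ** GZF t = if s == t then fvec s else 0.
Proof.
rewrite /fvec -DactM GZF_mul_same; case: eqP => // _; exact: DactF0r.
Qed.

(** The last central idempotent acts as 1. What remains comes from the level below, and the
    branching rule carries over its coefficients; any other path gained runs through a more dominant
    point and has larger rank. *)
Lemma fvec_tri r (l : points D r) (s t : Std l) :
  (rank s <= rank t)%N -> fvec t s = (s == t)%:R.
Proof.
elim: r l s t => [|r IH] l s t st.
  by have [_ zz _] := zF_spec t; rewrite /fvec /= zz ffunE.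
have [_ zz _] := zF_spec t; move: s t st.
apply: Std_succ_ind => mu' e' v'; apply: Std_succ_ind => mu e v st.
rewrite /fvec GZF_succ DactM zz.
rewrite [_ ** _](branchB_vec jX (@jF_inc R D)).
have [mm|mm] := eqVneq mu' mu; last first.
  rewrite (branchB_0 jX (@jF_inc R D) e); last first.
    rewrite le_eqVlt /prev_point /= eq_sym negb_or mm /=; apply: contraL st => st.
    by rewrite -ltnNge; apply: rank_lt_point.
  rewrite (_ : (extend e' v' == extend e v) = false) //.
  by apply: contraNF mm => /eqP/(congr1 (fun u : Std l => prev_point u))/eqP.
subst mu'; rewrite (bool_irrelevance e' e) in st *.
rewrite (branchB_path jX (@jF_inc R D)).
have -> : (extend e v' == extend e v) = (v' == v).
  by rewrite /extend eq_Tagged.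
rewrite -(IH _ v' v); last first.
  by rewrite leqNgt; apply: contraL st => st; rewrite -ltnNge; apply: rank_lt_path.
by rewrite (actM (murphyB_datum jX r)) (genB_dpath jX).
Qed.

(** By [fvec_tri] the seminormal vectors are unitriangular over the standard ones, so downward
    induction on the rank reduces to [DactF_inj]. *)
Lemma fvec_inj r (a b : algF D r) :
  (forall (l : points D r) (s : Std l), fvec s ** a = fvec s ** b) -> a = b.
Proof.
move=> ab; apply: DactF_inj => l s.
suff abn n (u : Std l) : (\max_(t : Std l) rank t - rank u < n)%N -> e_ u ** a = e_ u ** b.
  exact: abn (ltnSn _).
elim: n u => [u|n IHn u]; first by rewrite ltn0.
rewrite ltnS => un.
have fE : fvec u = e_ u + \sum_(v : Std l | (rank u < rank v)%N) (fvec u v : F) *: e_ v.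
  rewrite {1}[fvec u]cell_module_sum (bigID (fun v => rank u < rank v)%N) /= addrC; congr (_ + _).
  rewrite (bigD1 u) /= ?ltnn // fvec_tri // eqxx scale1r big1 ?addr0 // => v /andP[uv vu].
  by rewrite fvec_tri 1?leqNgt // (negPf vu) scale0r.
have := ab l u; rewrite fE [LHS]actDl [RHS]actDl.
set x := \sum_(v | _) _; suff -> : cell_action (muF r) x a = cell_action (muF r) x b.
  by move/addIr.
rewrite /x [LHS](big_morph (fun x => cell_action (muF r) x a) (id1 := 0) (op1 := +%R)); first last.
- exact: act0l.
- by move=> ? ?; apply: actDl.
rewrite [RHS](big_morph (fun x => cell_action (muF r) x b) (id1 := 0) (op1 := +%R)); first last.
- exact: act0l.
- by move=> ? ?; apply: actDl.
apply: eq_bigr => v uv; rewrite !actZl; congr (_ *: _); apply: IHn.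
apply: leq_trans un; apply: ltn_sub2l => //.
by apply: leq_trans uv _; apply: (leq_bigmax v).
Qed.

(** [GZF s] is self-adjoint; it fixes [fvec s] and kills [fvec t]. *)
Lemma fvec_form0 r (l : points D r) (s t : Std l) : s != t -> << fvec s, fvec t >> = 0.
Proof.
move=> st; have := fvec_GZF s s; rewrite eqxx => <-.
rewrite /formF [LHS](form_act (cellF r)) -/(starF _) GZF_star.
by rewrite [cell_action _ _ _]fvec_GZF eq_sym (negPf st) cform0r.
Qed.

Lemma fvec_form r (l : points D r) (s : Std l) : << fvec s, e_ s >> = << fvec s, fvec s >>.
Proof.
have := form_act (cellF r) (fvec s) (e_ s) (GZF s); rewrite GZF_star.
by rewrite [cell_action _ (fvec s) _]fvec_GZF eqxx.
Qed.

Lemma fvec_Felt r (l : points D r) (s t u : Std l) :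
  fvec u ** Felt s t = if u == s then << fvec s, fvec s >> *: fvec t else 0.
Proof.
rewrite /Felt !DactM fvec_GZF; case: eqP => [->|_]; last by rewrite !DactF0l.
rewrite [X in X ** _](_ : _ = << fvec s, e_ s >> *: e_ t); last first.
  by rewrite -(tens_vec (muF r)) [LHS](act_tens (cellF r)).
by rewrite fvec_form DactFZl.
Qed.

Lemma fvec_Felt0 r (l m : points D r) (s t : Std l) (u : Std m) :
  m != l -> fvec u ** Felt s t = 0.
Proof. by move=> ml; rewrite /Felt !DactM (GZF_act0 s _ ml) !DactF0l. Qed.

Lemma Felt_diag r (l : points D r) (t : Std l) : Felt t t = << fvec t, fvec t >> *: GZF t.
Proof.
apply: fvec_inj => m u; rewrite DactFZr.
have [ml|ml] := eqVneq m l; last by rewrite fvec_Felt0 // GZF_act0 // scaler0.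
subst m; rewrite fvec_Felt fvec_GZF; case: eqP => [->|_] //.
by rewrite scaler0.
Qed.

Lemma Felt_mul r (l : points D r) (s t u v : Std l) :
  Felt s t * Felt u v = if t == u then << fvec t, fvec t >> *: Felt s v else 0.
Proof.
apply: fvec_inj => m w; rewrite DactM.
have [ml|ml] := eqVneq m l; last first.
  rewrite fvec_Felt0 // DactF0l; case: ifP => _; last by rewrite DactF0r.
  by rewrite DactFZr fvec_Felt0 // scaler0.
subst m; rewrite fvec_Felt; case: eqP => [->|ws].
  rewrite DactFZl fvec_Felt; case: eqP => [->|_]; last first.
    by rewrite scaler0 DactF0r.
  by rewrite DactFZr fvec_Felt eqxx scale_swap.
rewrite DactF0l; case: ifP => _; last by rewrite DactF0r.
by rewrite DactFZr fvec_Felt (introF eqP ws) scaler0.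
Qed.

Lemma Felt_mul0 r (l m : points D r) (s t : Std l) (u v : Std m) :
  l != m -> Felt s t * Felt u v = 0.
Proof.
move=> lm; rewrite /Felt -!mulrA [GZF t * _]mulrA GZF_mul0 //.
by rewrite mul0r !mulr0.
Qed.

(** Both idempotents act on the tensor factors, the left one through self-adjointness. After
    evaluation this gives the leading coefficient of [Feltbar]. *)
Lemma Felt_eqm r (l : points D r) (s t : Std l) :
  cell_eqm (muF r) l (Felt s t) (tens (muF r) (fvec s) (fvec t)).
Proof.
have cF := cellF r; rewrite /Felt -(tens_vec (muF r)).
apply: eqm_trans (eqm_mulr cF _ (tens_mull cF _ _ _)) _.
by rewrite -/(starF _) GZF_star; apply: (tens_mulr cF).
Qed.

End Seminormal.

(** * Evaluation *)

Section EvaluationScalars.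
Context (R S : idomainType) (pi : {rmorphism R -> S}).
Local Notation "a %:f" := (tofrac a) (at level 2, format "a %:f").

Lemma pi_tofrac_neq0 s : pi s != 0 -> s%:f != 0 :> {fraction R}.
Proof. by rewrite tofrac_eq0; apply: contraNneq => ->; rewrite rmorph0. Qed.

(** The value does not depend on the fraction chosen: equality of fractions is a cross-multiplied
    identity in [R], which [pi] preserves. *)
Lemma evalF_frac a s : pi s != 0 -> evalF pi (a%:f / s%:f) = (pi a)%:f / (pi s)%:f.
Proof.
move=> s0; rewrite /evalF; case: xgetP => [y _ [a' [s' [s'0 aE ->]]]|]; last first.
  by move=> /(_ ((pi a)%:f / (pi s)%:f)) []; exists a, s.
have : a * s' = a' * s.
  apply/eqP; rewrite -tofrac_eq !tofracM -eqr_div ?pi_tofrac_neq0 //.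
  by rewrite aE.
move/(congr1 pi); rewrite !rmorphM => aE'.
by apply/eqP; rewrite eqr_div ?tofrac_eq0 // -!tofracM -aE'.
Qed.

Lemma eval_tofrac a : evaluable pi a%:f /\ evalF pi a%:f = (pi a)%:f.
Proof.
have p1 : pi 1 != 0 by rewrite rmorph1 oner_neq0.
have aE : a%:f = a%:f / 1%:f by rewrite tofrac1 divr1.
split; first by exists a, 1.
by rewrite {1}aE evalF_frac // rmorph1 tofrac1 divr1.
Qed.

Lemma eval0 : evaluable pi 0 /\ evalF pi 0 = 0.
Proof. by have := eval_tofrac 0; rewrite tofrac0 rmorph0 tofrac0. Qed.

Lemma eval1 : evaluable pi 1 /\ evalF pi 1 = 1.
Proof. by have := eval_tofrac 1; rewrite tofrac1 rmorph1 tofrac1. Qed.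

Lemma eval_add x y : evaluable pi x -> evaluable pi y ->
  evaluable pi (x + y) /\ evalF pi (x + y) = evalF pi x + evalF pi y.
Proof.
move=> [a [s [s0 ->]]] [b [t [t0 ->]]].
have st : pi (s * t) != 0 by rewrite rmorphM mulf_neq0.
have E : a%:f / s%:f + b%:f / t%:f = (a * t + b * s)%:f / (s * t)%:f.
  by rewrite addf_div ?pi_tofrac_neq0 // tofracD !tofracM.
split; first by exists (a * t + b * s), (s * t).
by rewrite E !evalF_frac // addf_div ?tofrac_eq0 // rmorphD !rmorphM tofracD !tofracM.
Qed.

Lemma eval_mul x y : evaluable pi x -> evaluable pi y ->
  evaluable pi (x * y) /\ evalF pi (x * y) = evalF pi x * evalF pi y.
Proof.
move=> [a [s [s0 ->]]] [b [t [t0 ->]]].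
have st : pi (s * t) != 0 by rewrite rmorphM mulf_neq0.
have E : a%:f / s%:f * (b%:f / t%:f) = (a * b)%:f / (s * t)%:f.
  by rewrite mulf_div !tofracM.
split; first by exists (a * b), (s * t).
by rewrite E !evalF_frac // mulf_div !rmorphM.
Qed.

Lemma eval_sum (I : finType) (P : pred I) (x : I -> {fraction R}) :
  (forall i, P i -> evaluable pi (x i)) ->
  evaluable pi (\sum_(i | P i) x i) /\
  evalF pi (\sum_(i | P i) x i) = \sum_(i | P i) evalF pi (x i).
Proof.
move=> Px; elim/big_rec2: _ => [|i y z Pi [zE <-]]; first exact: eval0.
exact: eval_add (Px i Pi) zE.
Qed.

End EvaluationScalars.

Section Evaluation.
Context (R S : idomainType) (pi : {rmorphism R -> S}).
Context (D : diagram_algebras R) (W : diagram_quotients pi D).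
Local Notation K := {fraction S}.
Local Notation fF := (@tofrac R : {rmorphism R -> {fraction R}}).

(** Named so that it carries a ring morphism structure and [algK] becomes an instance of an extended
    tower. *)
Definition tofrac_pi : R -> K := fun a => tofrac (pi a).
HB.instance Definition _ := GRing.RMorphism.copy tofrac_pi (@tofrac S \o pi).
Local Notation fK := (tofrac_pi : {rmorphism R -> K}).

Let jXF r : scalar_extension fF (@jF R D r) := jF_ext D r.
Let jXK r : scalar_extension fK (@jK R S pi D W r) := jK_ext W r.

Local Notation cF r := (coords (cell_basis (@murphyF R D r))).
Local Notation cK r := (coords (cell_basis (@murphyK R S pi D W r))).
Local Notation evA x := (evalA W x).

Lemma basisF r : is_basis (cell_basis (@murphyF R D r)).
Proof. exact (murphyB_basis jXF (r := r)). Qed.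

Lemma basisK r : is_basis (cell_basis (@murphyK R S pi D W r)).
Proof. exact (murphyB_basis jXK (r := r)). Qed.

Lemma evalA_coords r (x : algF D r) i : cK r (evA x) i = evalF pi (cF r x i).
Proof. exact (coords_uniq (@basisK r) (k := fun i => evalF pi (cF r x i)) (erefl _) i). Qed.

Lemma evalA_inj r (x : algF D r) (y : algK W r) :
  (forall i, cK r y i = evalF pi (cF r x i)) -> evA x = y.
Proof. by move=> xy; apply: (coords_inj (@basisK r)) => i; rewrite evalA_coords xy. Qed.

Lemma evalA_j r a : evaluableA pi (jF r a) /\ evA (jF r a) = jK r a.
Proof.
have aE i : cF r (jF r a) i = tofrac (coords (cell_basis (@murphy R D r)) a i).
  exact (ext_coords (jXF r) (@murphy_basis R D r) a i).
split; first by move=> i; rewrite aE; case: (eval_tofrac pi (coords (cell_basis (@murphy R D r)) a i)).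
apply: evalA_inj => i; rewrite aE.
have [_ ->] := eval_tofrac pi (coords (cell_basis (@murphy R D r)) a i).
exact (ext_coords (jXK r) (@murphy_basis R D r) a i).
Qed.

Lemma evalA0 r : evaluableA pi (0 : algF D r) /\ evA (0 : algF D r) = 0.
Proof. by have := evalA_j (r := r) 0; rewrite !rmorph0. Qed.

Lemma evalAZ r k (x : algF D r) : evaluable pi k -> evaluableA pi x ->
  evaluableA pi (k *: x) /\ evA (k *: x) = evalF pi k *: evA x.
Proof.
move=> kE xE; split=> [i|]; first by rewrite coordsZ; [case: (eval_mul kE (xE i)) | exact: basisF].
apply: evalA_inj => i; rewrite (coordsZ (@basisK r)) (coordsZ (@basisF r)) evalA_coords.
by case: (eval_mul kE (xE i)).
Qed.

Lemma evalAM r (x y : algF D r) : evaluableA pi x -> evaluableA pi y ->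
  evaluableA pi (x * y) /\ evA (x * y) = evA x * evA y.
Proof.
move=> xE yE.
pose g i j k := coords (cell_basis (@murphy R D r)) (cell_basis (@murphy R D r) i * cell_basis (@murphy R D r) j) k.
have xyF k : cF r (x * y) k = \sum_i \sum_j cF r x i * cF r y j * tofrac (g i j k).
  exact (extB_mul jXF x y k).
have xyK k : cK r (evA x * evA y) k = \sum_i \sum_j cK r (evA x) i * cK r (evA y) j * tofrac (pi (g i j k)).
  exact (extB_mul jXK (evA x) (evA y) k).
have E1 i j k : evaluable pi (cF r x i * cF r y j * tofrac (g i j k)) /\
   evalF pi (cF r x i * cF r y j * tofrac (g i j k)) =
   evalF pi (cF r x i) * evalF pi (cF r y j) * tofrac (pi (g i j k)).
  have [gE <-] := eval_tofrac pi (g i j k); have [xyE <-] := eval_mul (xE i) (yE j).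
  exact: eval_mul.
have E2 i k := eval_sum (P := predT) (fun j _ => (E1 i j k).1).
have E3 k := eval_sum (P := predT) (fun i _ => (E2 i k).1).
split=> [k|]; first by rewrite xyF; apply: (E3 k).1.
apply: evalA_inj => k; rewrite xyF xyK (E3 k).2; apply: eq_bigr => i _.
rewrite (E2 i k).2; apply: eq_bigr => j _; rewrite (E1 i j k).2.
by rewrite !evalA_coords.
Qed.

Lemma evalA_inc r (x : algF D r) : evaluableA pi x ->
  evaluableA pi (incF r x) /\ evA (incF r x) = incK W r (evA x).
Proof.
move=> xE.
pose g i k := coords (cell_basis (@murphy R D r.+1)) (inc r (cell_basis (@murphy R D r) i)) k.
have xF k : cF r.+1 (incF r x) k = \sum_i cF r x i * tofrac (g i k).
  exact (extB_inc jXF (@jF_inc R D) x k).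
have xK k : cK r.+1 (incK W r (evA x)) k = \sum_i cK r (evA x) i * tofrac (pi (g i k)).
  exact (extB_inc jXK (@jK_inc R S pi D W) (evA x) k).
have E1 i k : evaluable pi (cF r x i * tofrac (g i k)) /\
   evalF pi (cF r x i * tofrac (g i k)) = evalF pi (cF r x i) * tofrac (pi (g i k)).
  by have [gE <-] := eval_tofrac pi (g i k); apply: eval_mul.
have E2 k := eval_sum (P := predT) (fun i _ => (E1 i k).1).
split=> [k|]; first by rewrite xF; apply: (E2 k).1.
apply: evalA_inj => k; rewrite xF xK (E2 k).2; apply: eq_bigr => i _.
by rewrite (E1 i k).2 evalA_coords.
Qed.

Definition evaluableD r (l : points D r) (x : DeltaF l) : Prop := forall t, evaluable pi (x t).

Lemma evalD_act r (l : points D r) (x : DeltaF l) (a : algF D r) :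
  evaluableD x -> evaluableA pi a ->
  evaluableD (DactF x a) /\ evalD pi (DactF x a) = DactK (evalD pi x) (evA a).
Proof.
move=> xE aE.
pose g i (t v : Std l) := cell_coef (@murphy R D r) (murphy t t * cell_basis (@murphy R D r) i) t v.
have aF v : DactF x a v = \sum_t \sum_i x t * cF r a i * tofrac (g i t v).
  exact (extB_action jXF x a v).
have aK v : DactK (evalD pi x) (evA a) v =
    \sum_t \sum_i evalD pi x t * cK r (evA a) i * tofrac (pi (g i t v)).
  exact (extB_action jXK (evalD pi x) (evA a) v).
have E1 i t v : evaluable pi (x t * cF r a i * tofrac (g i t v)) /\
   evalF pi (x t * cF r a i * tofrac (g i t v)) =
   evalF pi (x t) * evalF pi (cF r a i) * tofrac (pi (g i t v)).
  have [gE <-] := eval_tofrac pi (g i t v); have [xaE <-] := eval_mul (xE t) (aE i).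
  exact: eval_mul.
have E2 t v := eval_sum (P := predT) (fun i _ => (E1 i t v).1).
have E3 v := eval_sum (P := predT) (fun t _ => (E2 t v).1).
split=> [v|]; first by rewrite aF; apply: (E3 v).1.
apply/ffunP => v; rewrite aK ffunE aF (E3 v).2; apply: eq_bigr => t _.
rewrite (E2 t v).2; apply: eq_bigr => i _; rewrite (E1 i t v).2.
by rewrite evalA_coords ffunE.
Qed.

Lemma evalD_form r (l : points D r) (x y : DeltaF l) :
  evaluableD x -> evaluableD y -> evaluable pi (formF x y).
Proof.
move=> xE yE; rewrite /formF (extB_form jXF x y).
apply: (eval_sum _).1 => t _; apply: (eval_sum _).1 => u _.
apply: (eval_mul _ _).1; first exact: (eval_mul _ _).1.
exact: (eval_tofrac _ _).1.
Qed.

Lemma evalD_vec r (l : points D r) (t : Std l) :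
  evaluableD (mvecF t) /\ evalD pi (mvecF t) = cell_vec K t.
Proof.
split=> [v|]; first by rewrite ffunE; case: eqP => _; [case: (eval1 pi)|case: (eval0 pi)].
by apply/ffunP => v; rewrite !ffunE; case: eqP => _; [case: (eval1 pi)|case: (eval0 pi)].
Qed.

Lemma evalDZ r (l : points D r) k (x : DeltaF l) : evaluable pi k -> evaluableD x ->
  evalD pi (k *: x) = evalF pi k *: evalD pi x.
Proof.
move=> kE xE; apply/ffunP => t; rewrite !ffunE; exact: (eval_mul kE (xE t)).2.
Qed.

End Evaluation.

(** For a nonzero entry [P i k], the elementary matrix at (k, l) exposes row [l] of [Q]. *)
Lemma matrix_prime (F : fieldType) n (P Q : 'M[F]_n.+1) :
  (forall M, P * M * Q = 0) -> P = 0 \/ Q = 0.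
Proof.
move=> PQ; have [->|P0] := eqVneq P 0; [by left | right].
have [i [k Pik]] : exists i k, P i k != 0.
  have [//|P0'] := pselect (exists i k, P i k != 0); case/eqP: P0.
  apply/matrixP => i k; rewrite mxE; apply/eqP/negPn/negP => Pik.
  by apply: P0'; exists i, k.
apply/matrixP => l m; rewrite mxE; apply/eqP.
have /matrixP/(_ i m) := PQ (delta_mx k l); rewrite [RHS]mxE.
rewrite -!mulmxE -mulmxA mxE (bigD1 k) //= big1 ?addr0 => [|k' kk']; last first.
  rewrite mxE big1 ?mulr0 // => l' _; rewrite mxE (negPf kk') mul0r //.
rewrite mxE (bigD1 l) //= mxE !eqxx mul1r big1 ?addr0 => [|l' ll']; last first.
  by rewrite mxE (negPf ll') andbF mul0r.
by move/eqP; rewrite mulf_eq0 (negPf Pik).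
Qed.

(** * Quotients *)

Section StarStableKernels.
Context (disp : Order.disp_t) (F : fieldType) (A : algType F).
Context (L : finPOrderType disp) (T : L -> finType).
Context (c : forall l, T l -> T l -> A) (star : A -> A).
Hypothesis cellA : cell_datum c star.

(* Simple modules of a cellular algebra are self-dual: on the maximal cell     *)
(* where psi does not vanish, psi x = 0 forces <y x, z> = 0 for all y and z,   *)
(* a condition that is symmetric under star.                                   *)
Lemma matrix_kernel_star n (psi : {lrmorphism A -> 'M[F]_n.+1}) :
  (forall M, exists x, psi x = M) -> forall x, psi x = 0 -> psi (star x) = 0.
Proof.
move=> psi_surj.
pose P l := [exists s : T l, exists t : T l, psi (c s t) != 0].
have [l0 Pl0] : exists l, P l.
  have [//|P0] := pselect (exists l, P l).
  have : psi 1 = 0.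
    have [_ cB _ _] := cellA; rewrite (coordsE cB 1) linear_sum big1 // => -[l [s t]] _.
    rewrite linearZ /=; suff -> : psi (c s t) = 0 by rewrite scaler0.
    apply/eqP/negPn/negP => st; apply: P0; exists l.
    by apply/existsP; exists s; apply/existsP; exists t.
  by move/eqP; rewrite rmorph1 oner_eq0.
(* Having fewest labels above it makes [l] maximal among the cells on which [psi] does not
   vanish. *)
have [l /existsP[a /existsP[b ab]] lmax] :=
  arg_minnP (fun l => #|[pred m : L | (l < m)%O]|) Pl0.
have psi_gt x : cell_ideal_gt c l x -> psi x = 0.
  move=> lx; apply: (span_on_ind (Q := fun x => psi x = 0) lx).
  - exact: rmorph0.
  - by move=> u v u0 v0; rewrite rmorphD /= u0 v0 addr0.
  - by move=> k u u0; rewrite linearZ /= u0 scaler0.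
  move=> [m [s t]] /= lm; apply/eqP/negPn/negP => st.
  have /lmax : P m by apply/existsP; exists s; apply/existsP; exists t.
  rewrite leqNgt => /negP; apply; apply: proper_card; apply/properP; split.
    by apply/fintype.subsetP => ?; rewrite !inE; apply: lt_trans.
  by exists m; rewrite !inE ?ltxx.
have psi_eqm x y : cell_eqm c l x y -> psi x = psi y.
  by move=> /psi_gt /eqP; rewrite rmorphB subr_eq0 => /eqP.
have form0 x (s t : T l) : psi x = 0 -> cell_form c (cell_action c (cell_vec F s) x) (cell_vec F t) = 0.
  move=> x0; apply/eqP; have := oner_neq0 F; have : psi (c a s * x * c t b) = 0.
    by rewrite !rmorphM /= x0 mulr0 mul0r.
  rewrite -(tens_vec c a s) -(tens_vec c t b).
  rewrite (psi_eqm _ _ (eqm_trans (eqm_mulr cellA _ (tens_mulr cellA _ _ _)) (tens_mul cellA _ _ _ _))).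
  by rewrite tens_vec linearZ => /eqP; rewrite scaler_eq0 (negPf ab) orbF.
have psi3 x (s t u v : T l) : psi x = 0 -> psi (c u t * star x * c s v) = 0.
  move=> x0; rewrite -(tens_vec c u t) -(tens_vec c s v).
  rewrite (psi_eqm _ _ (eqm_trans (eqm_mulr cellA _ (tens_mulr cellA _ _ _)) (tens_mul cellA _ _ _ _))).
  by rewrite (form_sym cellA) -(form_act cellA) form0 // linearZ /= scale0r.
(* Since [psi (c a b)] is nonzero, primeness of the matrix ring removes the left cell factor here
   and the right one afterwards. *)
have psi2 x (s v : T l) : psi x = 0 -> psi (star x * c s v) = 0.
  move=> x0; rewrite rmorphM.
  case: (@matrix_prime F n (psi (c a b)) (psi (star x) * psi (c s v))) => // [M|ab0].
    have [y <-] := psi_surj M; rewrite -!rmorphM -[y](starK cellA) /=.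
    rewrite -mulrA [star _ * _]mulrA -(starM cellA) mulrA; apply: psi3.
    by rewrite rmorphM /= x0 mul0r.
  by rewrite ab0 eqxx in ab.
move=> x x0; case: (@matrix_prime F n (psi (star x)) (psi (c a b))) => // [M|ab0].
  have [y <-] := psi_surj M; rewrite -!rmorphM -[y](starK cellA) /=.
  by rewrite -(starM cellA) psi2 // rmorphM /= x0 mulr0.
by rewrite ab0 eqxx in ab.
Qed.

Lemma split_kernel_star (Q : algType F) (phi : {lrmorphism A -> Q}) :
  split_semisimple Q -> (forall y, exists x, phi x = y) ->
  forall x, phi x = 0 -> phi (star x) = 0.
Proof.
move=> [I [n [h hB]]] phi_surj x x0.
have h_inj y : (forall i, h i y = 0) -> y = 0.
  move=> y0; have [y' [_ y'U]] := hB (fun i => 0).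
  by rewrite -(y'U y y0); apply: y'U => i; rewrite rmorph0.
apply: h_inj => i.
apply: (@matrix_kernel_star _ (h i \o phi)) => [M|]; last by rewrite /= x0 rmorph0.
(* The family equal to [M] in block [i] and to 0 elsewhere; block sizes vary, so [M] is transported
   along the equality of indices. *)
have [y [yE _]] := hB (fun i' => if i' =P i is ReflectT E then
  eq_rect _ (fun k => 'M[F]_((n k).+1)) M _ (esym E) else 0).
have [z zE] := phi_surj y; exists z; rewrite /= zE yE.
by case: eqP => // E; rewrite (eq_axiomK E).
Qed.

End StarStableKernels.

(** * Dimension over the algebraic closure *)

Section DimensionCount.
Context (F : fieldType) (Kb : closedFieldType) (iota : {rmorphism F -> Kb}).
Context (Q : algType F) (Qb : falgType Kb) (jb : {rmorphism Q -> Qb}).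
Hypothesis jbE : scalar_extension iota jb.

(** The images of [b] span the extended algebra and their number is its dimension, so they are free;
    independence descends along the injective [iota]. *)
Lemma spanning_dim_basis (I : finType) (b : I -> Q) :
  (forall x, span_on b predT x) -> #|I| = \dim (fullv : {vspace Qb}) -> is_basis b.
Proof.
move=> bS Idim; apply/is_basisP; split=> // k k0 i.
pose X : #|I|.-tuple Qb := [tuple jb (b (enum_val i)) | i < #|I|].
have Xi l : jb (b l) = X`_(enum_rank l).
  by rewrite -tnth_nth tnth_mktuple enum_rankK.
have jlin (k' : I -> F) : jb (\sum_i k' i *: b i) = \sum_i iota (k' i) *: jb (b i).
  by rewrite rmorph_sum; apply: eq_bigr => l _; case: jbE => ->.
have Xfull : (fullv <= <<X>>)%VS.
  apply/subvP => v _; have [_ jU] := jbE.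
  (* The complementary projection and the zero map both vanish on the image of [jb], so uniqueness
     in the universal property identifies them. *)
  have [||h [_ hU]] := jU Qb (fun=> 0).
  - by move=> ? ?; rewrite addr0.
  - by move=> ? ?; rewrite scaler0.
  have h0 : (0 : 'End(Qb)) =1 h by apply: hU => a; apply: zero_lfunE.
  have hE u : (\1 - projv <<X>>)%VF u = u - projv <<X>> u.
    by rewrite add_lfunE opp_lfunE id_lfunE.
  have hp : (\1 - projv <<X>>)%VF =1 h.
    apply: hU => a; rewrite [LHS]hE; have [k' ->] := bS a.
    rewrite projv_id ?subrr // jlin; apply: memv_suml => l _.
    by apply/memvZ; rewrite Xi; apply/memv_span/mem_nth; rewrite size_tuple.
  have := hp v; rewrite -h0 hE zero_lfunE => /eqP; rewrite subr_eq0 => /eqP ->.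
  exact: memv_proj.
have /basis_free/freeP Xfree : basis_of fullv X.
  by rewrite basisEdim Xfull size_tuple Idim leqnn.
have : iota (k i) = 0.
  have := Xfree (fun i => iota (k (enum_val i))) _ (enum_rank i); rewrite enum_rankK; apply.
  rewrite (reindex enum_rank) /=; last by apply: onW_bij; exact: enum_rank_bij.
  rewrite -[RHS](rmorph0 jb) -[in RHS]k0 jlin; apply: eq_bigr => l _; by rewrite enum_rankK Xi.
by move/eqP; rewrite fmorph_eq0 => /eqP.
Qed.

End DimensionCount.

(** * Permissible Murphy elements *)

Section QuotientBasis.
Context (R S : idomainType) (pi : {rmorphism R -> S}).
Context (D : diagram_algebras R) (W : diagram_quotients pi D).
Hypothesis Q_split : forall r, split_semisimple (algQ W r).
Local Notation K := {fraction S}.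
Local Notation fK := (tofrac_pi pi : {rmorphism R -> K}).

Let jX r : scalar_extension fK (@jK R S pi D W r) := jK_ext W r.

Local Notation muK r := (@murphyK R S pi D W r).
Local Notation dp t := (dpath (@dfac R D) t).
Local Notation e_ t := (cell_vec K t).
Local Notation "x ** a" := (DactK (W := W) x a) (at level 40).
Local Notation genK l := (genB fK l).
Local Notation mK l := (jK (d := W) _ (mgen D l)).

Definition starK_ r : algK W r -> algK W r := tower_star (@jK R S pi D W) (r := r).

Lemma cellK r : cell_datum (muK r) (@starK_ r).
Proof. exact (murphyB_datum jX r). Qed.

Lemma size_vertices r (l : points D r) (t : Std l) : size (vertices t) = r.+1.
Proof. by elim: r l t => // r IH l t; rewrite /= size_rcons IH. Qed.

Lemma last_vertex_perm r (l : points D r) (t : Std l) :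
  perm_path (@perm R S pi D W) t -> perm W l.
Proof.
case: r l t => [|r] l t; rewrite /perm_path /=; first by rewrite andbT.
by rewrite all_rcons => /andP[].
Qed.

Lemma perm_path_extend r (mu : points D r) (nu : points D r.+1) (e : edge mu nu) (v : Std mu) :
  perm_path (@perm R S pi D W) (extend e v) =
  perm W nu && perm_path (@perm R S pi D W) v.
Proof. by rewrite /perm_path /= all_rcons. Qed.

Lemma genK_neq0 r (l : points D r) (t : Std l) : genK l != 0.
Proof.
apply/eqP => g0; have := genB_dpath jX t; rewrite g0 act0l => /ffunP /(_ t).
by rewrite !ffunE eqxx => /eqP; rewrite eq_sym oner_eq0.
Qed.

Lemma mK_mul_eqm r (l : points D r) a :
  cell_eqm (muK r) l (mK l * a) (tens (muK r) (genK l) (genK l ** a)).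
Proof.
exact (eqm_trans (eqm_mulr (cellK r) a (mgenB_eqm jX l)) (tens_mulr (cellK r) _ _ _)).
Qed.

(* The nonpermissible vertex of t nearest to the root is removed by rewriting  *)
(* m_mu = b - b'; the factorizations m_nu d = u^* m_mu transport this to l.    *)
Lemma nonperm_reduction r (l : points D r) (t : Std l) :
  ~~ perm_path (@perm R S pi D W) t ->
  exists w, phi r (mK l * jK r (dp t)) = phi r (mK l * w) /\
    forall s, (rank s <= rank t)%N -> (genK l ** w) s = 0.
Proof.
elim: r l t => [|r IH] l t.
  rewrite /perm_path /= andbT /perm_vertex /= (level0_pt l).
  by rewrite (perm_empty W).
move: t; apply: Std_succ_ind => mu e v; rewrite perm_path_extend negb_and.
have [vp|vp _] := boolP (perm_path (@perm R S pi D W) v); last first.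
  have [w [wE w0]] := IH _ _ vp.
  exists (jK r.+1 (dfac D mu l) * incK W r w); split.
    have [u uE] := ubranch e.
    have key x : mK l * (jK r.+1 (dfac D mu l) * incK W r x) =
        jK r.+1 (star u) * incK W r (mK mu * x).
      by rewrite mulrA -rmorphM uE rmorphM /= -jK_inc -mulrA -rmorphM.
    have -> : jK r.+1 (dp (extend e v)) = jK r.+1 (dfac D mu l) * incK W r (jK r (dp v)).
      by rewrite jK_inc -rmorphM.
    by rewrite !key [LHS]rmorphM [RHS]rmorphM /= !phi_inc wE.
  move=> s sv; apply: (branchB_rank_lt jX (@jK_inc R S pi D W) _ sv) => u uv.
  exact: w0.
(* Here [l] itself is the first nonpermissible vertex. *)
rewrite orbF => lp.
have [|b [b' [_ mE b0 [a b'E] b'gt]]] := @perm_kernel R S pi D W r.+1 l (extend e v) r.+1 l.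
  have vE : vertices (extend e v) = vertices v ++ [:: Tagged (points D) l].
    by rewrite cats1.
  split=> //.
    by rewrite [vertices _]vE onth_cat size_vertices ltnn subnn.
  by rewrite [vertices _]vE take_cat size_vertices ltnn subnn cats0.
have b'I : cell_ideal_gt (muK r.+1) l b'.
  case: b'gt => k ->; apply: span_on_sum => i li; apply: span_onZ.
  apply: (ext_ideal (jX _) (P := fun m => (l < m)%O)); apply: cellb_murphy_ideal.
    by move=> m m'; apply: lt_le_trans.
  exact: span_on_base.
(* [b' = m_l a] lies in more dominant cells, so the tensor of the generator with its image under [a]
   has zero coefficients in cell [l]. *)
have ga0 : genK l ** a = 0.
  apply/ffunP => s.
  have : cell_eqm (muK r.+1) l (tens (muK r.+1) (genK l) (genK l ** a)) 0.
    apply: (eqm_trans (eqm_sym (mK_mul_eqm l a))).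
    by rewrite -b'E /cell_eqm subr0.
  have [u gu] : exists u, genK l u != 0.
    have [//|g0] := pselect (exists u, genK l u != 0).
    have /eqP[] := genK_neq0 (extend e v); apply/ffunP => u; rewrite [RHS]ffunE; apply/eqP/negPn/negP => gu.
    by apply: g0; exists u.
  move=> /(eqm_coef (cellK r.+1) u s); rewrite (tens_coef (cellK r.+1)).
  rewrite -(scale0r 0) (cell_coefZ (cellK _)) mul0r => /eqP; rewrite mulf_eq0 (negPf gu) => /eqP ->.
  by rewrite ffunE.
(* Modulo the kernel of [phi], [m_l] equals [- m_l a]; the new factor sends the generator to 0,
   which is more than the rank condition asks. *)
exists (- a * jK r.+1 (dp (extend e v))); split.
  rewrite mulrA mulrN -b'E mE mulrBl rmorphB /= [phi _ (b * _)]rmorphM /= b0 mul0r sub0r.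
  by rewrite -rmorphN mulNr.
move=> s _.
rewrite [_ ** _](actM (cellK _)) -scaleN1r [X in cell_action _ X _](actZr (cellK _)).
rewrite [X in _ *: X]ga0 scaler0; rewrite [cell_action _ _ _]act0l; exact: ffunE.
Qed.

(** Membership in the sum of the kernel of [phi] and the ideal of cells more dominant than [l]. *)
Definition phi_null r (l : points D r) (x : algK W r) : Prop :=
  exists2 y, cell_ideal_gt (muK r) l y & phi r (x - y) = 0.

Local Notation tensK x y := (tens (muK _) x y).
Local Notation pperm t := (perm_path (@perm R S pi D W) t).

Lemma phi_nullD r (l : points D r) x y :
  phi_null l x -> phi_null l y -> phi_null l (x + y).
Proof.
move=> [x' lx px] [y' ly py]; exists (x' + y'); first exact: span_onD.
by rewrite opprD addrACA rmorphD /= px py addr0.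
Qed.

Lemma phi_nullZ r (l : points D r) k x : phi_null l x -> phi_null l (k *: x).
Proof.
move=> [x' lx px]; exists (k *: x'); first exact: span_onZ.
by rewrite -scalerBr linearZ /= px scaler0.
Qed.

Lemma phi_null_mull r (l : points D r) a x : phi_null l x -> phi_null l (a * x).
Proof.
move=> [y ly xy]; exists (a * y); first exact: (ideal_mull (cellK r) (@gt_up _ _ l)).
by rewrite -mulrBr rmorphM /= xy mulr0.
Qed.

(** Split semisimplicity of [Q_r] enters here, through stability of the kernel under [star]. *)
Lemma phi_null_star r (l : points D r) x : phi_null l x -> phi_null l (starK_ x).
Proof.
move=> [y ly xy]; exists (starK_ y); first exact: (ideal_star (cellK r) (@gt_up _ _ l)).
rewrite -(starB (cellK r)).
exact: (split_kernel_star (cellK r) (Q_split r) (@phi_surj _ _ _ _ W r)).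
Qed.

Lemma phi_null_eqm r (l : points D r) x y : cell_eqm (muK r) l x y -> phi_null l y -> phi_null l x.
Proof.
move=> xy [z lz yz]; exists (x - y + z); first exact: span_onD.
by rewrite opprD addrA subKr.
Qed.

Lemma phi_null_gt r (l : points D r) x : cell_ideal_gt (muK r) l x -> phi_null l x.
Proof. by move=> lx; exists x => //; rewrite subrr rmorph0. Qed.

Lemma phi_null0 r (l : points D r) : phi_null l 0.
Proof. by apply: phi_null_gt; apply: span_on0. Qed.

Lemma phi_null_sum r (l : points D r) (J : finType) (P : pred J) (x : J -> algK W r) :
  (forall j, P j -> phi_null l (x j)) -> phi_null l (\sum_(j | P j) x j).
Proof. by move=> Px; elim/big_ind: _ => //; [apply: phi_null0 | apply: phi_nullD]. Qed.

(** Each [e_ s] is the generator moved by d_s, which left multiplication puts into the first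
    factor. *)
Lemma phi_null_tens r (l : points D r) (y : DeltaK S l) :
  phi_null l (tensK (genK l) y) -> forall x, phi_null l (tensK x y).
Proof.
move=> gy x; rewrite [x]cell_module_sum tens_suml; apply: phi_null_sum => s _.
rewrite tensZl; apply: phi_nullZ; rewrite -(genB_dpath jX s).
apply: phi_null_eqm (phi_null_mull (starK_ (jK r (dp s))) gy).
apply: eqm_sym; have := tens_mull (cellK r) (genK l) y (starK_ (jK r (dp s))).
by rewrite (starK (cellK r)).
Qed.

Lemma phi_null_tens_sym r (l : points D r) (x y : DeltaK S l) :
  phi_null l (tensK x y) -> phi_null l (tensK y x).
Proof.
move/phi_null_star; apply: phi_null_eqm.
exact: eqm_sym (tens_star (cellK r) _ _).
Qed.

(** Downward induction on the rank: [nonperm_reduction] trades a nonpermissible [t] for paths of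
    larger rank, which are already reduced. The rank clause protects the coefficients at smaller
    ranks. *)
Lemma perm_reduction_gen r (l : points D r) (t : Std l) : exists z : DeltaK S l,
  [/\ forall u, z u != 0 -> pperm u, pperm t -> z = e_ t,
      ~~ pperm t -> forall u, (rank u <= rank t)%N -> z u = 0 &
      phi_null l (tensK (genK l) (e_ t - z))].
Proof.
suff zn n (u : Std l) : (\max_(t : Std l) rank t - rank u < n)%N -> exists z : DeltaK S l,
    [/\ forall v, z v != 0 -> pperm v, pperm u -> z = e_ u,
      ~~ pperm u -> forall v, (rank v <= rank u)%N -> z v = 0 &
      phi_null l (tensK (genK l) (e_ u - z))] by exact: zn (ltnSn _).
elim: n u => // n IHn u un.
have [up|up] := boolP (pperm u).
  exists (e_ u); split=> // [v|]; last by rewrite subrr tens0r; apply: phi_null0.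
  by rewrite ffunE; case: (v =P u) => [->|_] //; rewrite eqxx.
have [w [wE w0]] := nonperm_reduction up.
pose Z v (z : DeltaK S l) := [/\ forall v', z v' != 0 -> pperm v',
  forall v', (rank v' < rank v)%N -> z v' = 0 & phi_null l (tensK (genK l) (e_ v - z))].
(* Choice needs a total function; 0 is a dummy value at ranks not above that of [u]. *)
have /choice[z zP] : forall v, exists z, (rank u < rank v)%N -> Z v z.
  move=> v; have [uv|_] := boolP (rank u < rank v)%N; last by exists 0.
  have [|z [z1 z2 z3 z4]] := IHn v.
    apply: (leq_trans _ (un : (_ <= n)%N)); apply: ltn_sub2l => //.
    by apply: leq_trans uv _; apply: (leq_bigmax v).
  exists z => _; split=> // v' vv'; have [vp|vp] := boolP (pperm v); last exact/z3/ltnW.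
  by rewrite z2 // ffunE; case: eqP vv' => // ->; rewrite ltnn.
pose x := genK l ** w.
have xE : x = \sum_(v | (rank u < rank v)%N) (x v : K) *: e_ v.
  rewrite {1}[x]cell_module_sum (bigID (fun v => rank u < rank v)%N) /= [X in _ + X]big1 ?addr0 //.
  by move=> v; rewrite -leqNgt => /w0 w0v; rewrite [x v]w0v scale0r.
pose y : DeltaK S l := \sum_(v | (rank u < rank v)%N) (x v : K) *: z v.
exists y; split=> // [v|_ v vu|].
- rewrite cell_mod_sum; apply: contraNT => vp; rewrite big1 // => v' uv'.
  rewrite cell_modZ; have [zp _ _] := zP v' uv'.
  have [->|/zp] := eqVneq (z v' v) 0; first by rewrite mulr0.
  by rewrite (negPf vp).
- rewrite cell_mod_sum big1 // => v' uv'; have [_ z0 _] := zP v' uv'.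
  by rewrite cell_modZ z0 ?mulr0 //; apply: leq_ltn_trans uv'.
rewrite -(subrK x (e_ u)) -addrA tensDr; apply: phi_nullD; last first.
  rewrite xE /y -sumrB tens_sumr; apply: phi_null_sum => v uv.
  by rewrite -scalerBr tensZr; apply: phi_nullZ; have [] := zP v uv.
rewrite -scaleN1r tensDr tensZr scaleN1r.
apply: (phi_null_eqm (y := mK l * jK r (dp u) - mK l * w)).
  apply: eqmD; last by rewrite -!scaleN1r; apply/eqmZ/eqm_sym/mK_mul_eqm.
  by apply: eqm_sym; have := mK_mul_eqm l (jK r (dp u)); rewrite [_ ** _](genB_dpath jX).
by exists 0; [apply: span_on0 | rewrite subr0 rmorphB /= wE subrr].
Qed.

(** Evaluated seminormal vectors have this shape. Each further term reduces to itself or to paths of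
    still larger rank, so the coefficient 1 at [t] survives. *)
Lemma perm_reduction r (l : points D r) (t : Std l) (x : DeltaK S l) :
  pperm t -> (forall s, (rank s <= rank t)%N -> x s = (s == t)%:R) ->
  exists z : DeltaK S l, [/\ forall u, z u != 0 -> pperm u, z t = 1 &
    forall y, phi_null l (tensK y (x - z))].
Proof.
move=> tp xt; have /choice[z zP] := @perm_reduction_gen r l.
exists (\sum_v (x v : K) *: z v); split.
- move=> u; rewrite cell_mod_sum; apply: contraNT => up; rewrite big1 // => v _.
  rewrite cell_modZ; have [zp _ _ _] := zP v.
  have [->|/zp] := eqVneq (z v u) 0; first by rewrite mulr0.
  by rewrite (negPf up).
- have [_ /(_ tp) zt _ _] := zP t; rewrite cell_mod_sum (bigD1 t isT) big1 => [|v vt].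
    apply: (etrans (addr0 _)); rewrite cell_modZ zt.
    rewrite xt; last exact: leqnn.
    by rewrite cell_vecE eqxx mulr1.
  rewrite cell_modZ; have [tv|vt'] := ltnP (rank t) (rank v); last by rewrite xt // (negPf vt) mul0r.
  have [_ z2 z3 _] := zP v; have [vp|vp] := boolP (pperm v); last by rewrite z3 ?mulr0 // ltnW.
  by rewrite z2 // ffunE eq_sym (negPf vt) mulr0.
apply: phi_null_tens; rewrite {1}[x]cell_module_sum -sumrB tens_sumr; apply: phi_null_sum => v _.
by rewrite -scalerBr tensZr; apply: phi_nullZ; have [] := zP v.
Qed.

Local Notation muQ r := (@murphyQ R S pi D W r).

Lemma tens_perm_span r (l : points D r) (x y : DeltaK S l) :
  (forall u, x u != 0 -> pperm u) -> (forall u, y u != 0 -> pperm u) ->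
  phi r (tensK x y) = \sum_(s : pStd W l) \sum_(t : pStd W l)
    ((x (val s) : K) * (y (val t) : K)) *: @murphyQ R S pi D W r l s t.
Proof.
move=> xp yp; rewrite /tens linear_sum.
have sumE (G : Std l -> algQ W r) : (forall u, ~~ pperm u -> G u = 0) ->
    \sum_u G u = \sum_(s : pStd W l) G (val s).
  move=> G0; rewrite (bigID (fun u => pperm u)) /= [X in _ + X]big1 // addr0.
  rewrite (reindex_omap (val : pStd W l -> _) insub) //= => [|u up]; last by rewrite insubT.
  by apply: eq_bigl => s; rewrite (valP s) valK eqxx.
have zero (z : DeltaK S l) u : (forall u, z u != 0 -> pperm u) -> ~~ pperm u -> z u = 0.
  by move=> zp up; apply/eqP; apply: contraNT up; apply: zp.
rewrite sumE => [|u up]; last first.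
  rewrite linear_sum big1 // => t _; rewrite linearZ /= (zero x) // mul0r scale0r //.
apply: eq_bigr => s _; rewrite linear_sum sumE => [|u up]; last first.
  by rewrite linearZ /= (zero y) // mulr0 scale0r.
by apply: eq_bigr => t _; rewrite linearZ.
Qed.

(** Row and column are reduced separately to permissible vectors; the errors lie in more dominant
    cells and are handled by induction on the number of labels above. *)
Lemma phi_murphy_span r (l : points D r) (s t : Std l) :
  span_on (cell_basis (muQ r)) (fun i => l <= tag i)%O (phi r (@murphyK R S pi D W r l s t)).
Proof.
suff cI n m : (#|[pred m' : points D r | (m < m')%O]| < n)%N -> forall u v : Std m,
    span_on (cell_basis (muQ r)) (fun i => m <= tag i)%O (phi r (@murphyK R S pi D W r m u v)).
  by apply: cI (ltnSn _) _ _.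
elim: n m => // n IHn m; rewrite ltnS => mn u v.
have null_span x : phi_null m x -> span_on (cell_basis (muQ r)) (fun i => m <= tag i)%O (phi r x).
  move=> [y my /eqP]; rewrite rmorphB subr_eq0 => /eqP -> /=.
  apply: (span_on_ind (Q := fun y => span_on (cell_basis (muQ r)) (fun i => m <= tag i)%O (phi r y)) my).
  - by rewrite rmorph0; apply: span_on0.
  - by move=> ? ?; rewrite rmorphD; apply: span_onD.
  - by move=> ? ?; rewrite linearZ; apply: span_onZ.
  move=> [m' [u' v']] /= mm'; apply: (span_onS (P := fun i => (m' <= tag i)%O)).
    by move=> i; apply: le_trans (ltW mm').
  apply: IHn; apply: leq_trans mn; apply: proper_card; apply/properP; split.
    by apply/fintype.subsetP => ?; rewrite !inE; apply: lt_trans.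
  by exists m'; rewrite !inE ?ltxx.
have [x [xp _ _ xn]] := perm_reduction_gen u; have [y [yp _ _ yn]] := perm_reduction_gen v.
rewrite -(tens_vec (muK r)) -[e_ u](subrK x) tensDl rmorphD /=; apply: span_onD.
  by apply/null_span/phi_null_tens_sym/phi_null_tens.
rewrite -[e_ v](subrK y) tensDr rmorphD /=; apply: span_onD; first exact/null_span/phi_null_tens.
rewrite (tens_perm_span xp yp); apply: span_on_sum => a _; apply: span_on_sum => b _.
apply: span_onZ; pose i : cell_index (@pStd R S pi D W r) :=
  Tagged (fun l => (pStd W l * pStd W l)%type) (a, b).
by apply: (@span_on_base _ _ _ (cell_basis (muQ r)) _ i); rewrite /= lexx.
Qed.

Lemma phi_ideal_span r (P : pred (points D r)) x : (forall l m, P l -> (l <= m)%O -> P m) ->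
  ideal_of (muK r) P x -> span_on (cell_basis (muQ r)) (fun i => P (tag i)) (phi r x).
Proof.
move=> Pup Px; apply: (span_on_ind (Q := fun x =>
  span_on (cell_basis (muQ r)) (fun i => P (tag i)) (phi r x)) Px).
- by rewrite rmorph0; apply: span_on0.
- by move=> ? ?; rewrite rmorphD; apply: span_onD.
- by move=> ? ?; rewrite linearZ; apply: span_onZ.
move=> [l [s t]] /= Pl; apply: span_onS (phi_murphy_span s t) => i; exact: Pup.
Qed.

(** A spanning family of the size prescribed by (Q3). Nonpermissible points add nothing to the
    count, since no permissible path ends there. *)
Lemma murphyQ_basis r : is_basis (cell_basis (muQ r)).
Proof.
apply: (spanning_dim_basis (@jbar_ext R S pi D W r)) => [x|].
  have [y <-] := phi_surj x; apply: (@phi_ideal_span r predT) => //.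
  have /is_basisP[KS _] : is_basis (cell_basis (muK r)) by case: (cellK r).
  exact: KS.
rewrite (dim_quotient W) -sum1_card.
rewrite (eq_bigr (fun i : cell_index (@pStd R S pi D W r) => (fun l (p : pStd W l * pStd W l) => 1%N) (tag i) (tagged i))) //.
rewrite -(sig_big_dep (fun l => true) (fun l p => true) (fun l (p : pStd W l * pStd W l) => 1%N)).
rewrite (bigID (fun l => perm W l)) /= [X in (_ + X)%N]big1 ?addn0 => [|l lp].
  by apply: eq_bigr => l _; rewrite sum1_card card_prod mulnn.
rewrite sum1_card card_prod; have [[t tp]|p0] := pickP (fun _ : pStd W l => true).
  by rewrite (last_vertex_perm tp) in lp.
by rewrite (eq_card0 p0).
Qed.

End QuotientBasis.

(** * Seminormal forms in the quotient *)

Lemma scale_mul_scale (K : comNzRingType) (A : algType K) (a b : K) (x y : A) :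
  (a *: x) * (b *: y) = a *: (b *: (x * y)).
Proof. by rewrite -scalerAl -scalerAr. Qed.

Lemma scale_scale0 (K : comNzRingType) (V : lmodType K) (a b : K) : a *: (b *: (0 : V)) = 0.
Proof. by rewrite !scaler0. Qed.

Lemma scale_scaleK (F : fieldType) (V : lmodType F) (a b : F) (v : V) : b != 0 ->
  a *: (b^-1 *: (b *: v)) = a *: v.
Proof. by move=> b0; rewrite (scalerK b0). Qed.

Section SeminormalQuotient.
Context (R S : idomainType) (pi : {rmorphism R -> S}).
Context (D : diagram_algebras R) (W : diagram_quotients pi D).
Context (q : forall r (l : points D r), DeltaK S l -> DeltaQ W l).
Hypothesis q_head : head_map q.
Hypothesis Q_split : forall r, split_semisimple (algQ W r).
Hypothesis SN : forall r (nu : points D r) (t : Std nu),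
  perm_path (@perm R S pi D W) t -> evaluableA pi (GZF t).

Local Notation K := {fraction S}.
Local Notation evA x := (evalA W x).
Local Notation ix s t := (Tagged (fun l => (pStd W l * pStd W l)%type) (s, t)).

Let perm_end r (l : points D r) (t : pStd W l) : perm W l.
Proof. exact: last_vertex_perm (valP t). Qed.

Let GE r (l : points D r) (t : pStd W l) : evaluableA pi (GZF (val t)) := SN (valP t).

Lemma fvec_eval r (l : points D r) (t : pStd W l) : evaluableD pi (fvec (val t)).
Proof. exact: (evalD_act W (evalD_vec pi (val t)).1 (GE t)).1. Qed.

Lemma Felt_eval r (l : points D r) (s t : pStd W l) : evaluableA pi (Felt (val s) (val t)).
Proof.
have mE : evaluableA pi (murphyF (val s) (val t)) := (evalA_j W (murphy (val s) (val t))).1.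
exact: (evalAM W (evalAM W (GE s) mE).1 (GE t)).1.
Qed.

Lemma form_eval r (l : points D r) (s t : pStd W l) :
  evaluable pi (formF (fvec (val s)) (fvec (val t))).
Proof. exact: (evalD_form (fvec_eval s) (fvec_eval t)). Qed.

(** The congruence is a condition on Murphy coefficients outside the more dominant cells, and
    evaluation is coefficientwise. *)
Lemma evalA_eqm r (l : points D r) (X : algF D r) (x y : DeltaF l) :
  evaluableD pi x -> evaluableD pi y ->
  cell_eqm (@murphyF R D r) l X (tens (@murphyF R D r) x y) ->
  cell_eqm (@murphyK R S pi D W r) l (evA X)
    (tens (@murphyK R S pi D W r) (evalD pi x) (evalD pi y)).
Proof.
move=> xE yE Xxy; apply/(span_onP (@basisK R S pi D W r)) => -[m [u v]] /= lm.
rewrite (coordsB (@basisK R S pi D W r)) evalA_coords; apply/eqP; rewrite subr_eq0; apply/eqP.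
have [ml|ml] := eqVneq l m.
  subst m; transitivity (evalF pi (x u * y v)).
    congr (evalF pi _); have := eqm_coef (cellF D r) u v Xxy.
    by rewrite (tens_coef (cellF D r)).
  rewrite (eval_mul (xE u) (yE v)).2.
  transitivity ((evalD pi x u : K) * (evalD pi y v : K)); first by rewrite !ffunE.
  exact/esym/(tens_coef (cellK W r)).
have lm' : ~~ (l <= m)%O by rewrite le_eqVlt negb_or ml.
have X0 : cell_coef (@murphyF R D r) X u v = 0.
  have := ideal_coef (cellF D r) u v Xxy lm; rewrite (cell_coefB (cellF D r)).
  by rewrite (ideal_coef (cellF D r) u v (tens_ge _ x y) lm') subr0.
transitivity (evalF pi 0); first by congr (evalF pi _); exact: X0.
rewrite (eval0 pi).2.
exact/esym/(ideal_coef (cellK W r) u v (tens_ge _ (evalD pi x) (evalD pi y)) lm').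
Qed.

(** Modulo more dominant cells this is the image of the tensor square of a permissible vector [z]
    with [z t = 1], so its coefficient at (t, t) in the basis [murphyQ] is 1. *)
Lemma Feltbar_neq0 r (l : points D r) (t : pStd W l) : Feltbar W (val t) (val t) != 0.
Proof.
have QB := @murphyQ_basis R S pi D W Q_split r.
pose x := evalD pi (fvec (val t)).
have xt s : (rank s <= rank (val t))%N -> x s = (s == val t)%:R.
  move=> st; rewrite ffunE fvec_tri //; case: (s == val t); first exact: (eval1 pi).2.
  exact: (eval0 pi).2.
have [z [zp zt zn]] := perm_reduction (valP t) xt.
pose mK := @murphyK R S pi D W r.
have : phi_null l (evA (Felt (val t) (val t)) - tens mK z z).
  have FE := evalA_eqm (fvec_eval t) (fvec_eval t) (Felt_eqm (val t) (val t)).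
  apply: (phi_null_eqm (y := tens mK x x - tens mK z z)).
    by apply: eqmD => //; apply: eqm_refl.
  have -> : tens mK x x - tens mK z z = tens mK x (x - z) + tens mK (x - z) z.
    have -> : x - z = x + -1 *: z by rewrite scaleN1r.
    by rewrite tensDr tensDl tensZr tensZl !scaleN1r addrA subrK.
  by apply: phi_nullD; [apply: zn | apply: (phi_null_tens_sym Q_split); apply: zn].
move=> [y ly Fy].
have yS := phi_ideal_span Q_split (@gt_up _ _ l) ly.
have FE : Feltbar W (val t) (val t) = phi r (tens mK z z) + phi r y.
  apply/eqP; rewrite -subr_eq0; apply/eqP; rewrite -[RHS]Fy !rmorphB /=.
  by rewrite opprD addrA.
apply/eqP => F0; have := coords0 QB (ix t t); rewrite -F0 FE (coordsD QB).
rewrite [X in _ + X](iffLR (span_onP QB _ _) yS) ?ltxx // addr0 (tens_perm_span zp zp).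
rewrite (coords_sum QB) (bigD1 t) //= (coords_sum QB) (bigD1 t) //= (coordsZ QB).
rewrite [X in _ * X + _](coords_base QB (ix t t)) eqxx zt !mul1r.
rewrite big1 => [|s st]; last first.
  rewrite (coordsZ QB) [X in _ * X](coords_base QB (ix t s)) eq_Tagged /= xpair_eqE.
  by rewrite [t == s]eq_sym (negPf st) andbF mulr0.
rewrite big1 => [|s st]; last first.
  rewrite (coords_sum QB) big1 // => u _.
  rewrite (coordsZ QB) [X in _ * X](coords_base QB (ix s u)) eq_Tagged /= xpair_eqE.
  by rewrite [t == s]eq_sym (negPf st) mulr0.
by move/eqP; rewrite !addr0 oner_eq0.
Qed.

Lemma Feltbar_diag r (l : points D r) (t : pStd W l) :
  Feltbar W (val t) (val t) = formbar pi (val t) (val t) *: Fbar W (val t).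
Proof.
rewrite /Feltbar Felt_diag (evalAZ W (form_eval t t) (GE t)).2.
by rewrite linearZ.
Qed.

Lemma formbar_neq0 r (l : points D r) (t : pStd W l) : formbar pi (val t) (val t) != 0.
Proof.
by have := Feltbar_neq0 t; rewrite Feltbar_diag; apply: contraNneq => ->; rewrite scale0r.
Qed.

Lemma Feltbar_mul r (l : points D r) (s t u v : pStd W l) :
  Feltbar W (val s) (val t) * Feltbar W (val u) (val v) =
    if t == u then formbar pi (val t) (val t) *: Feltbar W (val s) (val v) else 0.
Proof.
rewrite /Feltbar -rmorphM /= -(evalAM W (Felt_eval s t) (Felt_eval u v)).2 Felt_mul val_eqE.
case: (t == u); last by rewrite (evalA0 W r).2 rmorph0.
by rewrite (evalAZ W (form_eval t t) (Felt_eval s v)).2 linearZ.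
Qed.

Lemma Feltbar_mul0 r (l mu : points D r) (s t : pStd W l) (u v : pStd W mu) : l != mu ->
  Feltbar W (val s) (val t) * Feltbar W (val u) (val v) = 0.
Proof.
move=> lm; rewrite /Feltbar -rmorphM /= -(evalAM W (Felt_eval s t) (Felt_eval u v)).2.
by rewrite Felt_mul0 // (evalA0 W r).2 rmorph0.
Qed.

Lemma Ebar_matrix_units r : matrix_units (fun (l : points D r) (s t : pStd W l) =>
  Ebar W (val s) (val t)).
Proof.
split=> [l s t u v|l m s t u v lm]; rewrite [LHS]scale_mul_scale.
  rewrite Feltbar_mul.
  case: (t =P u) => [<-|_]; last exact: scale_scale0.
  exact: scale_scaleK (formbar_neq0 t).
by rewrite Feltbar_mul0 //; apply: scale_scale0.
Qed.

Lemma Ebar_diag r (l : points D r) (s : pStd W l) : Ebar W (val s) (val s) = Fbar W (val s).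
Proof. by rewrite /Ebar Feltbar_diag (scalerK (formbar_neq0 s)). Qed.

Lemma Fbar_neq0 r (l : points D r) (t : pStd W l) : Fbar W (val t) != 0.
Proof.
by have := Feltbar_neq0 t; rewrite Feltbar_diag; apply: contraNneq => ->; rewrite scaler0.
Qed.

(** Matrix units with nonzero diagonal are independent, and they share the index set of the basis
    [murphyQ]. *)
Lemma Ebar_basis r : is_basis (cell_basis (fun (l : points D r) (s t : pStd W l) =>
  Ebar W (val s) (val t))).
Proof.
apply: (free_same_size_basis (murphyQ_basis Q_split (r := r))).
apply: (mu_free (Ebar_matrix_units r)) => l s; rewrite Ebar_diag; exact: Fbar_neq0.
Qed.

Lemma Fbar_sum1 r : \sum_(l : points D r) \sum_(s : pStd W l) Fbar W (val s) = 1.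
Proof.
rewrite -(mu_sum1 (Ebar_matrix_units r) (@Ebar_basis r)); apply: eq_bigr => l _.
by apply: eq_bigr => s _; rewrite Ebar_diag.
Qed.

(** A lift to the algebra over [K] of the block idempotent of [Q_r] at [l]. *)
Definition Fblock r (l : points D r) : algK W r := \sum_(s : pStd W l) evA (GZF (val s)).

Lemma phi_Fblock_sum r : phi r (\sum_(l : points D r) Fblock l) = 1.
Proof.
rewrite -[RHS]Fbar_sum1 linear_sum; apply: eq_bigr => l _.
by rewrite linear_sum.
Qed.

Section HeadMap.
Context (r : nat) (l : points D r) (lp : perm W l).

Lemma q_lin k x y : q (k *: x + y) = k *: q x + q y :> DeltaQ W l.
Proof. by case: (q_head lp). Qed.

Lemma q_act x a : q (DactK x a) = DactQ (q x) (phi r a) :> DeltaQ W l.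
Proof. by case: (q_head lp). Qed.

Lemma q_vec (t : pStd W l) : q (cell_vec K (val t)) = cell_vec K t.
Proof. by case: (q_head lp). Qed.

Lemma q0 : q (0 : DeltaK S l) = 0.
Proof. by have := q_lin (-1) 0 0; rewrite scaler0 addr0 scaleN1r addNr. Qed.

Lemma qZ k x : q (k *: x) = k *: q x :> DeltaQ W l.
Proof. by rewrite -[k *: x]addr0 q_lin q0 addr0. Qed.

Lemma q_sum (J : finType) (P : pred J) (x : J -> DeltaK S l) :
  q (\sum_(j | P j) x j) = \sum_(j | P j) q (x j).
Proof.
apply: (big_morph (fun x => q x)) => [u v|]; last exact: q0.
by have := q_lin 1 u v; rewrite !scale1r.
Qed.

Lemma q_surj (x : DeltaQ W l) : exists y, q y = x.
Proof.
exists (\sum_t (x t : K) *: cell_vec K (val t)).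
rewrite q_sum [RHS](@cell_module_sum _ _ _ (@pStd R S pi D W r) l).
by apply: eq_bigr => t _; rewrite qZ q_vec.
Qed.

Lemma DactK_Fblock0 (m : points D r) (u : pStd W m) (x : DeltaK S l) : l != m ->
  DactK x (evA (GZF (val u))) = 0.
Proof.
move=> lm; rewrite [x]cell_module_sum [LHS]act_suml big1 // => t _.
rewrite [LHS]actZl -(evalD_vec pi t).2 -[X in _ *: X]/(DactK _ _).
rewrite -(evalD_act W (evalD_vec pi t).1 (GE u)).2 GZF_act0 //.
suff -> : evalD pi (0 : DeltaF l) = 0 by rewrite scaler0.
by apply/ffunP => v; rewrite !ffunE (eval0 pi).2.
Qed.

Lemma DactK_Fblocks (x : DeltaK S l) : DactK x (\sum_m Fblock m) = DactK x (Fblock l).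
Proof.
rewrite [LHS](act_sumr (cellK W r)) (bigD1 l) //= big1 ?addr0 // => m ml.
rewrite [LHS](act_sumr (cellK W r)) big1 // => s _.
by apply: DactK_Fblock0; rewrite eq_sym.
Qed.

(** All blocks together map to 1 in [Q_r], and those other than [l] act as 0 on this cell module. *)
Lemma q_Fblock (x : DeltaK S l) : q (DactK x (Fblock l)) = q x.
Proof.
rewrite -DactK_Fblocks q_act phi_Fblock_sum -(rmorph1 (phi r)) -q_act.
by congr q; apply: (act1 (cellK W r)).
Qed.

Lemma DactQ_Fblock (x : DeltaQ W l) : DactQ x (phi r (Fblock l)) = x.
Proof. by have [y <-] := q_surj x; rewrite -q_act q_Fblock. Qed.

Lemma DactQ_mul (x : DeltaQ W l) a b : DactQ (DactQ x a) b = DactQ x (a * b).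
Proof.
have [y <-] := q_surj x; have [a' <-] := phi_surj a; have [b' <-] := phi_surj b.
rewrite -!q_act -rmorphM -q_act; congr q; exact/esym/(actM (cellK W r)).
Qed.

Lemma DactQ0 (x : DeltaQ W l) : DactQ x 0 = 0.
Proof.
have [y <-] := q_surj x; rewrite -(rmorph0 (phi r)) -q_act -q0; congr q.
exact: (act0r (cellK W r)).
Qed.

End HeadMap.

Lemma zQ_Fbar r (l : points D r) (t : pStd W l) : zQ W l = \sum_(s : pStd W l) Fbar W (val s).
Proof.
have lp := perm_end t.
have blockE : mu_block (fun (l : points D r) (s t : pStd W l) => Ebar W (val s) (val t)) l =
    phi r (Fblock l).
  by rewrite linear_sum; apply: eq_bigr => s _; rewrite Ebar_diag.
rewrite (_ : \sum_s _ = phi r (Fblock l)); last by rewrite linear_sum.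
rewrite -blockE; apply: (mu_block_idempotent (Ebar_matrix_units r) (@Ebar_basis r) t (x0 := cell_vec K t)).
- exact: DactQ_mul.
- by move=> x; rewrite blockE DactQ_Fblock.
rewrite DactQ0 // => /ffunP /(_ t); rewrite !ffunE eqxx => /eqP.
by rewrite eq_sym oner_eq0.
Qed.

(** Write the top idempotent as a sum over permissible paths; multiplication by the idempotent of
    the truncated path keeps only the term of [t]. *)
Lemma Fbar_GZQ r (l : points D r) (t : pStd W l) : Fbar W (val t) = GZQ W (val t).
Proof.
elim: r l t => [|r IH] l t.
  by rewrite /= (zQ_Fbar t) (bigD1 t) //= big1 ?addr0.
case: t => t tp; rewrite -[val _]/t; move: t tp; apply: Std_succ_ind => mu e v.
rewrite perm_path_extend => /andP[lp vp].
have tp : perm_path (@perm R S pi D W) (extend e v) by rewrite perm_path_extend lp vp.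
pose t : pStd W l := Sub (extend e v) tp.
rewrite -[GZQ _ _]/(incQ r (GZQ W v) * zQ W l) -[v]/(val (Sub v vp : pStd W mu)) -IH /=.
rewrite (zQ_Fbar t) mulr_sumr (bigD1 t) //= {2 3}/Fbar -phi_inc.
have GvE := evalA_inc W (SN vp); rewrite -GvE.2.
have E (s : pStd W l) : phi r.+1 (evA (incF r (GZF v))) * Fbar W (val s) =
    if extend e v == val s then Fbar W (extend e v) else 0.
  rewrite -rmorphM -(evalAM W GvE.1 (GE s)).2 GZF_prev_mul.
  by case: ifP => // _; rewrite (evalA0 W r.+1).2 rmorph0.
rewrite (E t) eqxx big1 ?addr0 // => s st.
by rewrite (E s); case: eqP => // es; case/eqP: st; apply: val_inj.
Qed.

Lemma fbar_Feltbar r (l : points D r) (t u v : pStd W l) :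
  DactQ (fbar q (val t)) (Feltbar W (val u) (val v)) =
    if t == u then formbar pi (val t) (val t) *: fbar q (val v) else 0.
Proof.
have lp := perm_end t.
rewrite /fbar /Feltbar -q_act // -(evalD_act W (fvec_eval t) (Felt_eval u v)).2 fvec_Felt val_eqE.
case: eqP => [->|_]; first by rewrite (evalDZ (form_eval u u) (fvec_eval v)) qZ.
rewrite -(q0 lp); congr q.
by apply/ffunP => w; rewrite !ffunE (eval0 pi).2.
Qed.

Lemma fbar_Feltbar0 r (l mu : points D r) (t : pStd W l) (u v : pStd W mu) : l != mu ->
  DactQ (fbar q (val t)) (Feltbar W (val u) (val v)) = 0.
Proof.
move=> lm; have lp := perm_end t.
rewrite /fbar /Feltbar -q_act // -(evalD_act W (fvec_eval t) (Felt_eval u v)).2 fvec_Felt0 //.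
rewrite -(q0 lp); congr q.
by apply/ffunP => w; rewrite !ffunE (eval0 pi).2.
Qed.

Lemma formbar_neq0_iff r (l : points D r) (s t : pStd W l) :
  formbar pi (val t) (val s) != 0 <-> t = s.
Proof.
split=> [|->]; last exact: formbar_neq0.
have [//|ts] := eqVneq t s.
by rewrite /formbar fvec_form0 ?(eval0 pi).2 ?eqxx // val_eqE.
Qed.

Section MatrixCoefficients.
Context (r : nat) (l : points D r) (a : alg D r) (ca : Std l -> Std l -> {fraction R}).
Hypothesis caE : forall t : Std l,
  DactF (fvec t) (jF r a) = \sum_(s : Std l) ca s t *: fvec s.

Lemma coefficient_GZF (s t : Std l) :
  DactF (DactF (fvec t) (jF r a)) (GZF s) = ca s t *: fvec s.
Proof.
rewrite caE [LHS]act_suml (bigD1 s) //= big1 ?addr0 => [|u us].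
  by rewrite [LHS]DactFZl fvec_GZF eqxx.
by rewrite [LHS]DactFZl fvec_GZF (negPf us) scaler0.
Qed.

Let fa_eval (t : pStd W l) : evaluableD pi (DactF (fvec (val t)) (jF r a)).
Proof. exact: (evalD_act W (fvec_eval t) (evalA_j W a).1).1. Qed.

(** The coefficient is the [s] coordinate of the evaluable vector f_t a F_s, because f_s has
    coefficient 1 at [s]. *)
Lemma coefficient_eval (s t : pStd W l) : evaluable pi (ca (val s) (val t)).
Proof.
have := (evalD_act W (fa_eval t) (GE s)).1 (val s).
by rewrite coefficient_GZF cell_modZ fvec_tri // eqxx mulr1.
Qed.

(** Inserting [Fblock l] does not change the image in the head and splits the vector into its
    components along permissible [s]; this is why only those occur in the sum. *)
Lemma coefficient_action (t : pStd W l) :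
  DactQ (fbar q (val t)) (phi r (evA (jF r a))) =
    \sum_(s : pStd W l) evalF pi (ca (val s) (val t)) *: fbar q (val s).
Proof.
have lp := perm_end t.
rewrite /fbar -q_act // -(q_Fblock lp) [X in q X](act_sumr (cellK W r)) q_sum //.
apply: eq_bigr => s _; rewrite -qZ //; congr q.
rewrite -(evalD_act W (fvec_eval t) (evalA_j W a).1).2.
rewrite -[LHS]/(DactK _ _) -(evalD_act W (fa_eval t) (GE s)).2 coefficient_GZF.
exact: evalDZ (coefficient_eval s t) (fvec_eval s).
Qed.

End MatrixCoefficients.

End SeminormalQuotient.

Theorem theorem3p15 (R S : idomainType) (pi : {rmorphism R -> S})
    (pi_surj : forall y : S, exists x : R, pi x = y)
    (D : diagram_algebras R) (W : diagram_quotients pi D)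
    (q : forall r (l : points D r), DeltaK S l -> DeltaQ W l)
    (q_head : head_map q)
    (L : forall r, alg D r.+1) (d : forall r, points D r -> R)
    (LJM : separated_JM L d)
    (Q_split : forall r, split_semisimple (algQ W r))
    (SN : forall r (nu : points D r) (t : Std nu),
       perm_path (@perm R S pi D W) t -> evaluableA pi (GZF t)) :
  (* 1 *)
  (forall r (nu : points D r) (t : pStd W nu), (0 < r)%N ->
     Fbar W (val t) = GZQ W (val t)) /\
  (* 2 *)
  (forall r (l : points D r) (t u v : pStd W l),
     DactQ (fbar q (val t)) (Feltbar W (val u) (val v)) =
       if t == u then formbar pi (val t) (val t) *: fbar q (val v) else 0) /\
  (forall r (l mu : points D r) (t : pStd W l) (u v : pStd W mu), l != mu ->
     DactQ (fbar q (val t))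
       (Feltbar W (val u) (val v)) = 0) /\
  (forall r (l : points D r) (s t u v : pStd W l),
     Feltbar W (val s) (val t) * Feltbar W (val u) (val v) =
       if t == u then formbar pi (val t) (val t) *: Feltbar W (val s) (val v)
       else 0) /\
  (forall r (l mu : points D r) (s t : pStd W l) (u v : pStd W mu), l != mu ->
     Feltbar W (val s) (val t) * Feltbar W (val u) (val v) = 0) /\
  (* 3 *)
  (forall r (l : points D r) (s t : pStd W l),
     formbar pi (val t) (val s) != 0 <-> t = s) /\
  (* 4 *)
  (forall r (l : points D r) (t : pStd W l),
     (formbar pi (val t) (val t))^-1 *: Feltbar W (val t) (val t) =
       Fbar W (val t)) /\
  (* 5 *)
  (forall r,
     complete_matrix_units (fun (l : points D r) (s t : pStd W l) =>
       Ebar W (val s) (val t)) /\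
     forall (l : points D r) (s : pStd W l),
       Ebar W (val s) (val s) = Fbar W (val s)) /\
  (* 6 *)
  (forall r (l : points D r) (a : alg D r) (ca : Std l -> Std l -> {fraction R}),
     (forall t : Std l,
        DactF (fvec t) (jF r a) = \sum_(s : Std l) ca s t *: fvec s) ->
     forall t : pStd W l,
       (forall s : pStd W l, evaluable pi (ca (val s) (val t))) /\
       DactQ (fbar q (val t)) (phi r (evalA W (jF r a))) =
         \sum_(s : pStd W l) evalF pi (ca (val s) (val t)) *: fbar q (val s)).
Proof.
split; first exact (fun r nu t _ => Fbar_GZQ q_head Q_split SN t).
split; first exact (fbar_Feltbar q_head SN).
split; first exact (fbar_Feltbar0 q_head SN).
split; first exact (Feltbar_mul SN).
split; first exact (Feltbar_mul0 SN).
split; first exact (formbar_neq0_iff Q_split SN).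
split; first exact (Ebar_diag Q_split SN).
split=> [r|r l a ca caE t].
  split; last exact (@Ebar_diag _ _ _ _ _ Q_split SN r).
  apply: mu_complete; first exact (Ebar_matrix_units Q_split SN r).
  exact (@Ebar_basis _ _ _ _ _ Q_split SN r).
split=> [s|]; first exact (coefficient_eval SN caE s t).
exact (coefficient_action q_head Q_split SN caE t).
Qed.
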